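(* Let $\lambda,\mu$ be real numbers with $\lambda,\mu>(r-1)\frac d2$. The polynomials $C^{(k)}_{\lambda,\mu}$, $k\in\mathbb N$, form an orthogonal family in $L^2\big(I,\det(e-v)^\lambda\det(e+v)^\mu\,dv\big)$, where $I=\{v\in V:\ e+v\in\Omega,\ e-v\in\Omega\}$; that is, for all $k\ne l$ in $\mathbb N$, $$\int_I C^{(k)}_{\lambda,\mu}(v)\,C^{(l)}_{\lambda,\mu}(v)\,\det(e-v)^\lambda\det(e+v)^\mu\,dv=0 .$$
   Context: Let $V$ be a simple Euclidean Jordan algebra of dimension $n$, rank $r$ and characteristic number $d$ (so $n=r+\frac{r(r-1)}2d$), with unit $e$, trace $\mathrm{tr}$, determinant $\det$, inner product $(x,y)=\mathrm{tr}(xy)$, and $dv$ the associated Lebesgue measure. $\Omega$ is the open cone of squares (symmetric cone); $\mathbb N=\{0,1,2,\dots\}$. For $s,t\in\mathbb C$, $k\in\mathbb N$, define on $\Omega\times\Omega$ $$c_{s,t}^{(k)}(x,y)=(\det x)^{-s}(\det y)^{-t}\det\Big(\tfrac{\partial}{\partial x}-\tfrac{\partial}{\partial y}\Big)^k\big((\det x)^{s+k}(\det y)^{t+k}\big),$$ where for a polynomial $p$ on $V\times V$ the constant coefficient operator $p(\frac{\partial}{\partial x},\frac{\partial}{\partial y})$ is determined by $p(\frac{\partial}{\partial x},\frac{\partial}{\partial y})e^{(x,\xi)+(y,\zeta)}=p(\xi,\zeta)e^{(x,\xi)+(y,\zeta)}$. It is known that $c^{(k)}_{s,t}$ extends to a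 polynomial on $V\times V$. The polynomial $C^{(k)}_{\lambda,\mu}$ on $V$ is $$C^{(k)}_{\lambda,\mu}(x)=c^{(k)}_{\lambda,\mu}\Big(\frac{e-x}2,\frac{e+x}2\Big).$$ *)

(* Defs.v *)
From HB Require Import structures.
From mathcomp Require Import all_boot all_order all_algebra.
From mathcomp Require Import all_classical all_reals all_analysis.
(* The notations of [mpoly] clash with those of the analysis library. *)
From mathcomp Require mpoly.
Import(canonicals,coercions) mpoly.

Set Implicit Arguments.
Unset Strict Implicit.
Unset Printing Implicit Defensive.

Import Order.TTheory GRing.Theory Num.Theory.
Import numFieldNormedType.Exports.

Local Open Scope classical_set_scope.
Local Open Scope ring_scope.

(* The library's instance of this fact is not found by inference on a product
   of two sigma-finite measures. *)
Lemma sigma_finite_product_measure1 d1 d2 (T1 : measurableType d1)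
    (T2 : measurableType d2) (R : realType)
    (m1 : {sigma_finite_measure set T1 -> \bar R})
    (m2 : {sigma_finite_measure set T2 -> \bar R}) :
  sigma_finite setT (m1 \x m2)%E.
Proof.
have /sigma_finiteP[F [TF ndF Foo]] := sigma_finiteT m1.
have /sigma_finiteP[G [TG ndG Goo]] := sigma_finiteT m2.
exists (fun n => F n `*` G n).
  rewrite -setXTT TF TG predeqE => -[x y]; split.
    move=> [/= [n _ Fnx] [k _ Gky]]; exists (maxn n k) => //; split.
    - by move: x Fnx; exact/subsetPset/ndF/leq_maxl.
    - by move: y Gky; exact/subsetPset/ndG/leq_maxr.
  by move=> [n _ []/= ? ?]; split; exists n.
move=> k; have [? ?] := Foo k; have [? ?] := Goo k.
split; first exact: measurableX.
by rewrite product_measure1E// lte_mul_pinfty// ge0_fin_numE.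
Qed.

Section TupleMeasure.
Context d (T : measurableType d) (R : realType) (n : nat).
Variables (m1 : {sigma_finite_measure set T -> \bar R})
          (m2 : {sigma_finite_measure set (n.-tuple T) -> \bar R}).

Definition tcons (p : T * n.-tuple T) : n.+1.-tuple T :=
  [the n.+1.-tuple T of p.1 :: p.2].

Lemma measurable_tcons : measurable_fun setT tcons.
Proof. exact: (@measurable_cons _ _ _ T fst n snd). Qed.

Definition measure_tcons : set (n.+1.-tuple T) -> \bar R :=
  pushforward (m1 \x m2)%E tcons.

Let measure_tcons0 : measure_tcons set0 = 0%E.
Proof. by rewrite /measure_tcons /pushforward preimage_set0 measure0. Qed.

Let measure_tcons_ge0 A : (0 <= measure_tcons A)%E.
Proof. exact: (measure_ge0 (m1 \x m2)%E). Qed.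

Let measure_tcons_sigma_additive : semi_sigma_additive measure_tcons.
Proof.
move=> F mF tF mUF; rewrite /measure_tcons /pushforward preimage_bigcup.
apply: measure_semi_sigma_additive.
- by move=> k; rewrite -[X in measurable X]setTI; exact: measurable_tcons.
- apply/trivIsetP => /= i j _ _ ij; rewrite -preimage_setI.
  by move/trivIsetP : tF => /(_ _ _ _ _ ij) ->//; rewrite preimage_set0.
- rewrite -preimage_bigcup -[X in measurable X]setTI.
  exact: measurable_tcons.
Qed.

HB.instance Definition _ := isMeasure.Build _ _ _ measure_tcons
  measure_tcons0 measure_tcons_ge0 measure_tcons_sigma_additive.

Let sigma_finite_measure_tcons : sigma_finite setT measure_tcons.
Proof.
have [F FT Fo] := sigma_finite_product_measure1 m1 m2.
pose g (t : n.+1.-tuple T) : T * n.-tuple T := (thead t, [tuple of behead t]).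
have mg : measurable_fun setT g.
  apply/measurable_fun_pair; first exact: measurable_tnth.
  exact: measurable_behead.
have gK : cancel tcons g.
  by case=> x t; rewrite /g /tcons; congr pair; apply/val_inj.
exists (fun k => g @^-1` F k).
  by rewrite -preimage_bigcup -FT preimage_setT.
move=> k; have [mF oF] := Fo k; split.
  by rewrite -[_ @^-1` _]setTI; exact: mg.
rewrite /measure_tcons /pushforward -comp_preimage.
by rewrite (_ : g \o tcons = id) //; apply/funext => p /=; rewrite gK.
Qed.

HB.instance Definition _ := Measure_isSigmaFinite.Build _ _ _ measure_tcons
  sigma_finite_measure_tcons.

End TupleMeasure.

Section LebesgueTuple.
Context (R : realType).
Local Notation mR := (measurableTypeR R).

Fixpoint lebesgue_tuple (n : nat) :
    {sigma_finite_measure set (n.-tuple mR) -> \bar R} :=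
  match n with
  | 0 => dirac ([tuple] : 0.-tuple mR)
  | m.+1 => measure_tcons (@lebesgue_measure R) (lebesgue_tuple m)
  end.

Lemma lebesgue_tuple_box (n : nat) (A : 'I_n -> set mR) :
  (forall i, measurable (A i)) ->
  lebesgue_tuple n [set t | forall i, A i (tnth t i)] =
  (\prod_(i < n) lebesgue_measure (A i))%E.
Proof.
elim: n A => [|n IH] A mA.
  by rewrite big_ord0 /= diracE mem_set// => -[].
rewrite big_ord_recl/= -IH// /measure_tcons /pushforward.
rewrite (_ : _ @^-1` _ = A ord0 `*` [set t | forall i, A (lift ord0 i) (tnth t i)]).
  rewrite product_measure1E//.
  rewrite (_ : [set _ | _] =
    \bigcap_(i in setT) ((@tnth n mR)^~ i @^-1` A (lift ord0 i))); last first.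
    by apply/seteqP; split=> t /= h i; [move=> _; exact: h | exact: (h i I)].
  apply: fin_bigcap_measurable => // i _.
  by rewrite -[_ @^-1` _]setTI; exact: measurable_tnth.
apply/seteqP; split=> -[x t] /=.
  move=> h; split=> [|i]; first exact: (h ord0).
  by have := h (lift ord0 i); rewrite tnthS.
by move=> [h0 h] i; case: (unliftP ord0 i) => [j|] -> //; rewrite tnthS.
Qed.

End LebesgueTuple.

Section DiffOp.
Context (R : realType) (W : vectType R).
Implicit Types (f P : W -> R) (v x : W).

Definition mpoly_represents N (B : N.-tuple W) (p : mpoly.mpoly N R) f : Prop :=
  forall x, f x = mpoly.meval (fun i => coord B i x) p.

Definition polynomial_fun f : Prop :=
  exists p, mpoly_represents (vbasis {:W}) p f.

Lemma polynomial_fun_basis N (B : N.-tuple W) f :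
  basis_of {:W} B -> polynomial_fun f -> exists p, mpoly_represents B p f.
Proof.
move=> Bb [p pE].
pose lq := [tuple \sum_(j < N) (coord (vbasis {:W}) i (tnth B j)
  *: mpoly.mpolyX R (mpoly.mnm1 j)) | i < \dim {:W}].
exists (mpoly.comp_mpoly lq p) => x; rewrite pE mpoly.comp_mpoly_meval.
apply: mpoly.meval_eq => i; rewrite tnth_mktuple.
rewrite {1}(coord_basis Bb (memvf x)) !linear_sum /=.
apply: eq_bigr => j _.
by rewrite linearZ /= -tnth_nth mpoly.mevalZ mpoly.mevalXU mulrC.
Qed.

Definition dir_deriv v f : W -> R :=
  fun x => derive1 (fun h : R => f (x + h *: v)) 0.

Section Basis.
Variables (N : nat) (B : N.-tuple W).

Definition monomial_deriv (m : mpoly.multinom N) f : W -> R :=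
  foldr (fun i g => iter (mpoly.fun_of_multinom m i) (dir_deriv (tnth B i)) g)
    f (enum 'I_N).

(* The expression of the polynomial function [P] in the coordinates of the
   basis [B]; it is unique because [R] is infinite. *)
Definition mpoly_of P : mpoly.mpoly N R :=
  xget (0 : mpoly.mpoly N R) [set p | mpoly_represents B p P].

(* [diff_op P] is P(d/dx) when [B] is orthonormal for the inner product that
   identifies W with its dual; see [diff_op_expR] and
   [diff_op_prod_expR]. *)
Definition diff_op P f : W -> R := fun x =>
  \sum_(m <- mpoly.msupp (mpoly_of P))
    mpoly.mcoeff m (mpoly_of P) * monomial_deriv m f x.

Lemma diff_op_expR (ip : W -> W -> R) P :
  (forall a x y z, ip (a *: x + y) z = a * ip x z + ip y z) ->
  (forall x y, ip x y = ip y x) ->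
  basis_of {:W} B ->
  (forall i j, ip (tnth B i) (tnth B j) = (i == j)%:R) ->
  (exists p, mpoly_represents B p P) ->
  forall xi x, diff_op P (fun y => expR (ip y xi)) x = P xi * expR (ip x xi).
Proof.
move=> ipP ipC Bb Bo Pp xi x.
have ipl0 z : ip 0 z = 0.
  have := ipP 1 0 0 z; rewrite scale1r addr0 mul1r => /eqP.
  by rewrite -subr_eq0 opprD addrA subrr sub0r oppr_eq0 => /eqP.
have ip_coord i : ip (tnth B i) xi = coord B i xi.
  rewrite {1}(coord_basis Bb (memvf xi)) ipC.
  rewrite (big_morph (ip^~ (tnth B i)) (id1 := 0) (op1 := +%R)) //.
    rewrite (bigD1 i)//= big1 ?addr0 => [|j ji].
      by rewrite -tnth_nth -[_ *: _]addr0 ipP ipl0 Bo eqxx addr0 mulr1.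
    by rewrite -tnth_nth -[_ *: _]addr0 ipP ipl0 Bo (negbTE ji) addr0 mulr0.
  by move=> y z; rewrite -[y in LHS]scale1r ipP mul1r.
have dE v a : dir_deriv v (fun y => a * expR (ip y xi)) =
              (fun y => (a * ip v xi) * expR (ip y xi)).
  apply/funext => y; rewrite /dir_deriv.
  have -> : (fun h : R => a * expR (ip (y + h *: v) xi)) =
            (fun h : R => a * expR (ip v xi * h + ip y xi)).
    by apply/funext => h; rewrite [y + _]addrC ipP [h * _]mulrC.
  have dg : is_derive (0 : R) (1 : R) (fun h : R => ip v xi * h + ip y xi)
      (ip v xi).
    have -> : (fun h : R => ip v xi * h + ip y xi) =
              ip v xi *: (@idfun R) + cst (ip y xi) by [].
    by apply: is_derive_eq; rewrite addr0 scaler1.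
  have d1 : is_derive (0 : R) (1 : R)
      (expR \o (fun h : R => ip v xi * h + ip y xi))
      (ip v xi * expR (ip v xi * 0 + ip y xi)).
    by rewrite mulrC; exact: is_derive1_comp.
  rewrite derive1E.
  have -> : (fun h : R => a * expR (ip v xi * h + ip y xi)) =
    a *: (expR \o (fun h : R => ip v xi * h + ip y xi)) by [].
  by rewrite derive_val /= mulr0 add0r; exact: mulrA.
have iterE v k a : iter k (dir_deriv v) (fun y => a * expR (ip y xi)) =
    (fun y => (a * ip v xi ^+ k) * expR (ip y xi)).
  elim: k => [|k IH]; first by rewrite expr0 mulr1.
  by rewrite iterS IH dE exprSr mulrA.
have mE m : monomial_deriv m (fun y => expR (ip y xi)) =
    (fun y => (\prod_i coord B i xi ^+ mpoly.fun_of_multinom m i) *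
              expR (ip y xi)).
  rewrite /monomial_deriv -big_enum /=.
  elim: (enum 'I_N) => [|i s IH] /=.
    by rewrite big_nil; apply/funext => y; rewrite mul1r.
  by rewrite IH big_cons iterE ip_coord; apply/funext => y; rewrite mulrC
    [_ * (coord _ _ _ ^+ _)]mulrC mulrC.
have := xgetPex (0 : mpoly.mpoly N R) Pp; rewrite -/(mpoly_of P) => ->.
rewrite mpoly.mevalE mulr_suml; apply: eq_bigr => m _.
by rewrite mE mulrA.
Qed.

End Basis.

End DiffOp.

Section Jordan.
Context (R : realType) (V : vectType R) (mul : V -> V -> V) (e : V).

Record euclidean_jordan_algebra : Prop := EuclideanJordanAlgebra {
  jmulC : forall x y, mul x y = mul y x;
  jmulP : forall a x y z, mul (a *: x + y) z = a *: mul x z + mul y z;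
  jmul1 : forall x, mul e x = x;
  jordan_identity : forall x y,
    mul (mul x x) (mul x y) = mul x (mul (mul x x) y);
  jform : exists form : V -> V -> R,
    [/\ forall a x y z, form (a *: x + y) z = a * form x z + form y z,
        forall x y, form x y = form y x,
        forall x, x != 0 -> 0 < form x x &
        forall x y z, form (mul x y) z = form y (mul x z)]
}.

Definition simple_jordan : Prop :=
  e != 0 /\
  forall U : {vspace V}, (forall x u, u \in U -> mul x u \in U) ->
    U = 0%VS \/ U = fullv.

Definition jpow (x : V) (k : nat) : V := iter k (mul x) e.

Definition jhorner (p : {poly R}) (x : V) : V :=
  \sum_(i < size p) p`_i *: jpow x i.

Definition is_minpoly (x : V) (p : {poly R}) : Prop :=
  [/\ p \is monic, jhorner p x = 0 &
      forall q : {poly R}, q != 0 -> jhorner q x = 0 -> (size p <= size q)%N].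

Definition jordan_rank (r : nat) : Prop :=
  (forall x p, is_minpoly x p -> ((size p).-1 <= r)%N) /\
  (exists x p, is_minpoly x p /\ (size p).-1 = r).

(* The minimal polynomial of a regular element x (one for which it has degree
   r) is T^r - tr(x) T^(r-1) + ... + (-1)^r det(x); the regular elements are
   dense, so tr and det are determined everywhere as polynomial functions. *)
Definition jordan_trace (r : nat) (tr : V -> R) : Prop :=
  polynomial_fun tr /\
  forall x p, is_minpoly x p -> (size p).-1 = r -> tr x = - p`_r.-1.

Definition jordan_det (r : nat) (det : V -> R) : Prop :=
  polynomial_fun det /\
  forall x p, is_minpoly x p -> (size p).-1 = r -> det x = (-1) ^+ r * p`_0.

Definition idempotent (c : V) : Prop := mul c c = c.

Definition primitive_idempotent (c : V) : Prop :=
  [/\ idempotent c, c != 0 &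
      forall c1 c2, idempotent c1 -> idempotent c2 -> c = c1 + c2 ->
        c1 = 0 \/ c2 = 0].

Definition jordan_frame (m : nat) (c : 'I_m -> V) : Prop :=
  [/\ forall i, primitive_idempotent (c i),
      forall i j, i != j -> mul (c i) (c j) = 0 &
      \sum_i c i = e].

(* {x | c x = x / 2} *)
Definition half_space (c : V) : {vspace V} :=
  lker (linfun (mul c) - 2^-1 *: \1%VF)%VF.

(* d is the common dimension of the Peirce spaces V_ij, i <> j; for r = 1 there
   are none and d is arbitrary. *)
Definition characteristic_number (d : nat) : Prop :=
  forall m (c : 'I_m -> V), jordan_frame c -> forall i j, i != j ->
    \dim (half_space (c i) :&: half_space (c j)) = d.

Section TraceForm.
Variable tr : V -> R.

Definition jinner (x y : V) : R := tr (mul x y).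

Definition orthonormal_basis n (b : n.-tuple V) : Prop :=
  basis_of {:V} b /\
  forall i j, jinner (tnth b i) (tnth b j) = (i == j)%:R.

(* The interior, for the norm of [jinner], of the set of squares. *)
Definition symmetric_cone : set V :=
  [set x | exists2 eps : R, 0 < eps &
    forall y, jinner (y - x) (y - x) < eps -> exists z, y = mul z z].

Definition cone_interval : set V :=
  [set v | symmetric_cone (e + v) /\ symmetric_cone (e - v)].

End TraceForm.

Section Coordinates.
Variables (n : nat) (b : n.-tuple V).

Definition of_coord (t : n.-tuple (measurableTypeR R)) : V :=
  \sum_(i < n) (tnth t i : R) *: tnth b i.

(* The Lebesgue integral on V for which the cube spanned by [b] has volume 1. *)
Definition integral_over (D : set V) (f : V -> R) : \bar R :=
  (\int[lebesgue_tuple R n]_(t in of_coord @^-1` D) (f (of_coord t))%:E)%E.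

Definition in_weighted_L2 (D : set V) (w f : V -> R) : Prop :=
  measurable_fun (of_coord @^-1` D) (fun t => f (of_coord t)) /\
  (lebesgue_tuple R n).-integrable (of_coord @^-1` D)
    (fun t => (f (of_coord t) ^+ 2 * w (of_coord t))%:E).

Definition prod_basis : (n + n).-tuple (V * V)%type :=
  [tuple of [seq (v, 0) | v <- b] ++ [seq (0, v) | v <- b]].

Lemma tnth_prod_basis (i : 'I_(n + n)) : tnth prod_basis i =
  match fintype.split i with
  | inl j => (tnth b j, 0)
  | inr j => (0, tnth b j)
  end.
Proof.
rewrite (tnth_nth 0) /= nth_cat size_map size_tuple.
by case: split_ordP => j -> /=; rewrite ?ltn_ord ?ltnNge ?leq_addr /= ?addKn
  (nth_map 0) ?size_tuple// -tnth_nth.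
Qed.

Lemma prod_basisP : basis_of {:V} b -> basis_of {:(V * V)%type} prod_basis.
Proof.
move=> bb; rewrite basisEdim; apply/andP; split; last first.
  have nE : dim V = n by rewrite -dimvf (size_basis bb).
  by rewrite size_tuple dimvf; apply: (@eq_leq _ (dim V + dim V)); rewrite nE.
apply/subvP => -[x y] _.
have -> : (x, y) = \sum_(i < n) coord b i x *: (tnth b i, 0 : V) +
                   \sum_(i < n) coord b i y *: (0 : V, tnth b i).
  have l (f g : 'I_n -> V) (a : 'I_n -> R) :
      \sum_i a i *: (f i, g i) = (\sum_i a i *: f i, \sum_i a i *: g i).
    by elim/big_ind3: _ => // ? ? ? ? ? ? -> ->.
  rewrite (l (tnth b) (fun=> 0)) (l (fun=> 0) (tnth b)).
  rewrite [\sum_i _ *: 0]big1 => [|i _]; last by rewrite scaler0.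
  rewrite [X in (_, _) + (X, _)]big1 => [|i _]; last by rewrite scaler0.
  rewrite {1}(coord_basis bb (memvf x)) {1}(coord_basis bb (memvf y)).
  congr pair; rewrite ?addr0 ?add0r; apply: eq_bigr => i _;
    by rewrite -tnth_nth.
apply: memvD; apply: memv_suml => i _; apply: memvZ; apply: memv_span.
  rewrite mem_cat; apply/orP; left.
  by apply/mapP; exists (tnth b i) => //; exact: mem_tnth.
rewrite mem_cat; apply/orP; right.
by apply/mapP; exists (tnth b i) => //; exact: mem_tnth.
Qed.

(* P(d/dx, d/dy) e^{(x,xi)+(y,zeta)} = P(xi, zeta) e^{(x,xi)+(y,zeta)} *)
Lemma diff_op_prod_expR (tr : V -> R) (P : V * V -> R) :
  (forall a x y z, jinner tr (a *: x + y) z =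
    a * jinner tr x z + jinner tr y z) ->
  (forall x y, jinner tr x y = jinner tr y x) ->
  orthonormal_basis tr b -> polynomial_fun P ->
  forall xi zeta x y,
    diff_op prod_basis P
      (fun z => expR (jinner tr z.1 xi + jinner tr z.2 zeta)) (x, y) =
    P (xi, zeta) * expR (jinner tr x xi + jinner tr y zeta).
Proof.
move=> ipP ipC [bb bo] PP xi zeta x y.
have ipl0 z : jinner tr 0 z = 0.
  have := ipP 1 0 0 z; rewrite scale1r addr0 mul1r => /eqP.
  by rewrite -subr_eq0 opprD addrA subrr sub0r oppr_eq0 => /eqP.
pose ip (z w : V * V) := jinner tr z.1 w.1 + jinner tr z.2 w.2.
apply: (@diff_op_expR _ _ _ prod_basis ip P _ _ _ _ _ (xi, zeta) (x, y)).
- by move=> a u v w; rewrite /ip /= !ipP mulrDr addrACA.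
- by move=> u v; rewrite /ip !(ipC u.1) !(ipC u.2).
- exact: prod_basisP.
- move=> i j; rewrite !tnth_prod_basis /ip.
  case: (split_ordP i) => i' ->; case: (split_ordP j) => j' -> /=;
    rewrite ?bo ?ipl0 ?(ipC _ 0) ?ipl0 ?addr0 ?add0r.
  + by rewrite (inj_eq (@lshift_inj _ _)).
  + by rewrite eq_lrshift.
  + by rewrite eq_rlshift.
  + by rewrite (inj_eq (@rshift_inj _ _)).
- by apply: polynomial_fun_basis => //; exact: prod_basisP.
Qed.

Variable det : V -> R.

Definition c_fun (s t : R) (k : nat) (x y : V) : R :=
  det x `^ (- s) * det y `^ (- t) *
  diff_op prod_basis (fun z => det (z.1 - z.2) ^+ k)
    (fun z => det z.1 `^ (s + k%:R) * det z.2 `^ (t + k%:R)) (x, y).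

Definition polynomial_extension (tr : V -> R) (s t : R) (k : nat)
    (c : V * V -> R) : Prop :=
  polynomial_fun c /\
  forall x y, symmetric_cone tr x -> symmetric_cone tr y ->
    c (x, y) = c_fun s t k x y.

End Coordinates.

Definition C_pullback (c : V * V -> R) (v : V) : R :=
  c (2^-1 *: (e - v), 2^-1 *: (e + v)).

Definition jacobi_weight (det : V -> R) (lam mu : R) (v : V) : R :=
  det (e - v) `^ lam * det (e + v) `^ mu.

End Jordan.

(* Main.v *)
Require Import Defs.
From mathcomp Require Import all_boot all_order all_algebra.
From mathcomp Require Import all_classical all_reals all_analysis.
From mathcomp Require Import measurable_realfun.
From mathcomp Require Import ring lra zify.
From mathcomp Require Import complex.
From mathcomp Require mpoly ssrcomplements.
Import(canonicals,coercions) mpoly.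
Set Implicit Arguments.
Unset Strict Implicit.
Unset Printing Implicit Defensive.

Import Order.TTheory GRing.Theory Num.Theory.
Local Open Scope ring_scope.

(** Put P(v) = det((e - v)/2) and Q(v) = det((e + v)/2). Along the affine map v -> ((e - v)/2, (e +
    v)/2) the derivative d/dv is -1/2 times d/dx - d/dy, so the definition of C^(k) becomes a
    Rodrigues formula on I: det(d/dv)^k (P^(lam+k) Q^(mu+k)) = (-1/2)^(rk) P^lam Q^mu C^(k)
    ([rodrigues]). The weight is a constant multiple of P^lam Q^mu. Since C^(l) has degree at most
    rl ([pullback_degree]), integrating by parts rk times against it leaves zero when l < k,
    provided that no boundary terms appear.

    Boundary terms are avoided by truncation. For K > rk and eps > 0 the function P^(lam+k-K)
    Q^(mu+k-K) (PQ - eps)_+^K vanishes near the boundary of I and can be differentiated rk times, so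
    its image under det(d/dv)^k is exactly orthogonal to all polynomials of degree below rk
    ([cut_class_act_orthogonal]). At eps = 0 it is the Rodrigues function. The passage eps -> 0 is
    dominated convergence, and it needs the uniform estimate |det(d/dv)^k (truncated function)| <= C
    P^lam Q^mu ([truncation_diff_le]). This comes from a chart: for v in I and c^2 = e - v^2, the
    map h -> v + P(c) h multiplies both determinants by constants and turns them into determinants
    of affine functions equal to e at h = 0 ([interval_chart]). It also replaces eps by eps/(PQ),
    which lies in [0, 1] wherever the truncated function is nonzero. The derivative at v is
    therefore an explicit power of P and Q times a derivative at 0 of a member of a bounded family.

    All higher derivatives are computed algebraically: functions P^a Q^b (S_+)^m p, with polynomials
    P, Q, S, p, are stable under differentiation, and only the polynomial p has to be tracked
    ([class_step], [class_diff]).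

    The Jordan algebra enters through three facts. The spectral theorem holds because a sum of two
    squares vanishes only trivially ([sum_squares_eq0], [spectral_theorem]). For an idempotent c,
    det(P(tc + e - c) x) = t^(2 tr c) det x, by solving an Euler differential equation ([ddet_mul],
    [det_peirce_scale]). The symmetric cone consists of the x that pair nonnegatively with all
    squares and have nonzero determinant ([coneP]). *)

Section LinearFunctionals.
Context (R : realType) (V : vectType R).

Definition linfunctional (f : V -> R) := forall a x y, f (a *: x + y) = a * f x + f y.

Lemma linfunctional_coord n (b : n.-tuple V) i : linfunctional (coord b i).
Proof. by move=> a x y; rewrite linearP. Qed.

(** Reduces identities between vectors to scalar ones, where the arithmetic tactics apply. *)
Lemma linfunctional_ext (u v : V) :
  (forall f : V -> R, linfunctional f -> f u = f v) -> u = v.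
Proof.
move=> h; rewrite (coord_vbasis (memvf u)) (coord_vbasis (memvf v)).
by apply: eq_bigr => i _; rewrite (h _ (@linfunctional_coord _ _ i)).
Qed.

Variable f : V -> R.
Hypothesis fP : linfunctional f.

Lemma linfunctionalD x y : f (x + y) = f x + f y.
Proof. by rewrite -[x]scale1r fP mul1r scale1r. Qed.
Lemma linfunctional0 : f 0 = 0.
Proof. by have := linfunctionalD 0 0; rewrite addr0; lra. Qed.
Lemma linfunctionalZ a x : f (a *: x) = a * f x.
Proof. by rewrite -[_ *: _]addr0 fP linfunctional0 addr0. Qed.
Lemma linfunctionalN x : f (- x) = - f x.
Proof. by rewrite -scaleN1r linfunctionalZ mulN1r. Qed.

Definition linfunctionalE :=
  (linfunctionalD, linfunctionalN, linfunctionalZ, linfunctional0).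

End LinearFunctionals.

(* Linear arithmetic in a vector space: every functional sends the goal and the
   hypotheses to scalar equations. *)
Ltac vlra :=
  apply: linfunctional_ext; let f := fresh "f" in let fP := fresh "fP" in
  move=> f fP;
  repeat match goal with H : @eq _ _ _ |- _ =>
    apply (congr1 f) in H; rewrite ?(linfunctionalE fP) /= in H end;
  rewrite ?(linfunctionalE fP) /=; lra.

(** * Linearized Jordan identities, power associativity and formal reality *)

Section JordanIdentities.
Context (R : realType) (V : vectType R) (mul : V -> V -> V) (e : V).
Hypothesis EJA : euclidean_jordan_algebra mul e.
Local Notation "x ** y" := (mul x y) (at level 40, left associativity).

Lemma jC x y : x ** y = y ** x. Proof. exact: jmulC EJA x y. Qed.
Lemma jDl x y z : (x + y) ** z = x ** z + y ** z.
Proof. by rewrite -[x in LHS]scale1r (jmulP EJA) scale1r. Qed.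
Lemma j0l z : 0 ** z = 0.
Proof. by have := jDl 0 0 z; rewrite addr0 => H; vlra. Qed.
Lemma jZl a x z : (a *: x) ** z = a *: (x ** z).
Proof. by rewrite -[a *: x]addr0 (jmulP EJA) j0l addr0. Qed.
Lemma jNl x z : (- x) ** z = - (x ** z).
Proof. by rewrite -scaleN1r jZl scaleN1r. Qed.
Lemma jDr x y z : z ** (x + y) = z ** x + z ** y.
Proof. by rewrite jC jDl !(jC z). Qed.
Lemma j0r z : z ** 0 = 0. Proof. by rewrite jC j0l. Qed.
Lemma jZr a x z : z ** (a *: x) = a *: (z ** x).
Proof. by rewrite jC jZl (jC z). Qed.
Lemma jNr x z : z ** (- x) = - (z ** x).
Proof. by rewrite jC jNl (jC z). Qed.
Definition jE := (jDl, jDr, jNl, jNr, jZl, jZr, j0l, j0r).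
Lemma j_sumr I (s : seq I) (P : pred I) (F : I -> V) z :
  z ** (\sum_(i <- s | P i) F i) = \sum_(i <- s | P i) z ** F i.
Proof.
by apply: (big_morph (mul z)); [move=> x y; rewrite jDr | rewrite j0r].
Qed.
Lemma j_suml I (s : seq I) (P : pred I) (F : I -> V) z :
  (\sum_(i <- s | P i) F i) ** z = \sum_(i <- s | P i) F i ** z.
Proof. by rewrite jC j_sumr; apply: eq_bigr => i _; rewrite jC. Qed.
Lemma j1l x : e ** x = x. Proof. exact: jmul1 EJA x. Qed.
Lemma j1r x : x ** e = x. Proof. by rewrite jC j1l. Qed.

(** The Jordan identity is cubic in [x]. Its values at [x + z], [x - z] and [z] isolate the part
    that is linear in [z]; [jordan_lin] then polarizes fully. *)
Lemma jordan_lin1 x z y :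
  2 *: ((x ** z) ** (x ** y)) + (x ** x) ** (z ** y) =
  z ** ((x ** x) ** y) + 2 *: (x ** ((x ** z) ** y)).
Proof.
have H1 := jordan_identity EJA (x + z) y.
have H2 := jordan_identity EJA (x - z) y.
have H3 := jordan_identity EJA x y.
have H4 := jordan_identity EJA z y.
rewrite !jE (jC z x) in H1; rewrite !jE (jC z x) in H2.
by vlra.
Qed.

Lemma jordan_lin x z w y :
  (x ** z) ** (w ** y) + (w ** z) ** (x ** y) + (x ** w) ** (z ** y) =
  z ** ((x ** w) ** y) + x ** ((w ** z) ** y) + w ** ((x ** z) ** y).
Proof.
have H1 := jordan_lin1 (x + w) z y.
have H2 := jordan_lin1 x z y.
have H3 := jordan_lin1 w z y.
rewrite !jE (jC w x) in H1.
by vlra.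
Qed.

(** Read as an identity of operators on [w], this writes multiplication by a triple product through
    multiplications by its factors and by their pairwise products. *)
Lemma jordan_mul3 x z y w :
  ((x ** z) ** y) ** w =
  (x ** z) ** (y ** w) + (x ** y) ** (z ** w) + (z ** y) ** (x ** w)
  - x ** (y ** (z ** w)) - z ** (y ** (x ** w)).
Proof.
have H := jordan_lin x z w y.
rewrite (jC w y) (jC w z) (jC (z ** w) (x ** y)) (jC (x ** w) (z ** y)) in H.
rewrite (jC (x ** w) y) (jC (z ** w) y) (jC w ((x ** z) ** y)) in H.
by vlra.
Qed.

Definition jcomm x y := forall u, x ** (y ** u) = y ** (x ** u).

Section Powers.
Variable x : V.
Local Notation "x ^^ k" := (jpow mul e x k) (at level 30).

Lemma jpowS k : x ^^ k.+1 = x ** x ^^ k. Proof. by []. Qed.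

(** By [jordan_mul3], multiplication by x^(k+2) is a polynomial in the multiplications by x, x^2,
    x^k and x^(k+1), so commuting with the multiplications by x and x^2 propagates by induction to
    all powers. *)
Lemma jpow_commute (T : V -> V) :
  (forall a y z, T (a *: y + z) = a *: T y + T z) ->
  (forall u, T (x ** u) = x ** T u) ->
  (forall u, T ((x ** x) ** u) = (x ** x) ** T u) ->
  forall k u, T (x ^^ k ** u) = x ^^ k ** T u.
Proof.
move=> TP Tx Txx.
have TD y z : T (y + z) = T y + T z by rewrite -[y]scale1r TP !scale1r.
have T0 : T 0 = 0 by have H := TD 0 0; rewrite addr0 in H; vlra.
have TZ a y : T (a *: y) = a *: T y by rewrite -[_ *: _]addr0 TP T0 addr0.
have TN y : T (- y) = - T y by rewrite -scaleN1r TZ scaleN1r.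
elim/ltn_ind=> -[|[|k]] IH u; first by rewrite /= !j1l.
  by rewrite /= !j1r Tx.
have IH0 v : T (x ^^ k ** v) = x ^^ k ** T v by apply: IH.
have IH1 v : T (x ^^ k.+1 ** v) = x ^^ k.+1 ** T v by apply: IH.
have E v : x ^^ k.+2 ** v = 2 *: (x ^^ k.+1 ** (x ** v))
    + (x ** x) ** (x ^^ k ** v) - x ^^ k ** (x ** (x ** v))
    - x ** (x ** (x ^^ k ** v)).
  rewrite jpowS (jC x) [in LHS]jpowS (jC x (x ^^ k)) jordan_mul3.
  rewrite (jC (x ^^ k) x) -jpowS.
  by vlra.
by rewrite !E !(TD, TN, TZ) !(IH0, IH1, Tx, Txx).
Qed.

Lemma jpow_comm i j : jcomm (x ^^ i) (x ^^ j).
Proof.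
have lin y a u v : y ** (a *: u + v) = a *: (y ** u) + y ** v.
  by rewrite jDr jZr.
have c1 k u : x ** (x ^^ k ** u) = x ^^ k ** (x ** u).
  by apply: (jpow_commute (lin x)) => // v; rewrite (jordan_identity EJA).
have c2 k u : (x ** x) ** (x ^^ k ** u) = x ^^ k ** ((x ** x) ** u).
  by apply: (jpow_commute (lin (x ** x))) => // v; rewrite (jordan_identity EJA).
by move=> u; apply: (jpow_commute (lin (x ^^ i))) => // v; rewrite ?c1 ?c2.
Qed.

Lemma jpowD i j : x ^^ (i + j) = x ^^ i ** x ^^ j.
Proof.
elim: i => [|i IH]; first by rewrite /= j1l.
have H := jpow_comm j 1 (x ^^ i); rewrite /= j1r in H.
by rewrite addSn !jpowS IH (jC (x ** x ^^ i)) H (jC (x ^^ j)).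
Qed.

Local Notation ev p := (jhorner mul e p x).

Lemma jhorner_widen (p : {poly R}) k : (size p <= k)%N ->
  ev p = \sum_(i < k) p`_i *: x ^^ i.
Proof.
move=> pk; rewrite /jhorner (big_ord_widen k (fun i => p`_i *: x ^^ i)) //.
rewrite [RHS](bigID (fun i : 'I_k => (i < size p)%N)) /= [X in _ + X]big1 ?addr0//.
by move=> i; rewrite -leqNgt => /leq_sizeP -> //; rewrite scale0r.
Qed.

Lemma jhornerP a (p q : {poly R}) : ev (a *: p + q) = a *: ev p + ev q.
Proof.
pose k := maxn (size (a *: p + q)) (maxn (size p) (size q)).
rewrite !(@jhorner_widen _ k) ?leq_max ?leqnn ?orbT//.
rewrite scaler_sumr -big_split /=; apply: eq_bigr => i _.
by rewrite coefD coefZ scalerDl scalerA.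
Qed.
Lemma jhornerD p q : ev (p + q) = ev p + ev q.
Proof. by rewrite -[p]scale1r jhornerP !scale1r. Qed.
Lemma jhorner0 : ev 0 = 0.
Proof. by have H := jhornerD 0 0; rewrite addr0 in H; vlra. Qed.
Lemma jhornerZ a p : ev (a *: p) = a *: ev p.
Proof. by rewrite -[a *: p]addr0 jhornerP jhorner0 addr0. Qed.
Lemma jhornerN p : ev (- p) = - ev p.
Proof. by rewrite -scaleN1r jhornerZ scaleN1r. Qed.
Lemma jhornerB p q : ev (p - q) = ev p - ev q.
Proof. by rewrite jhornerD jhornerN. Qed.
Lemma jhornerXn k : ev 'X^k = x ^^ k.
Proof.
rewrite (@jhorner_widen _ k.+1) ?size_polyXn// big_ord_recr /= coefXn eqxx scale1r.
by rewrite big1 ?add0r// => i _; rewrite coefXn ltn_eqF ?scale0r.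
Qed.
Lemma jhornerX : ev 'X = x. Proof. by have := jhornerXn 1; rewrite expr1 /= j1r. Qed.
Lemma jhorner1 : ev 1 = e. Proof. by have := jhornerXn 0; rewrite expr0. Qed.
Lemma jhorner_sum I (s : seq I) (P : pred I) (F : I -> {poly R}) :
  ev (\sum_(i <- s | P i) F i) = \sum_(i <- s | P i) ev (F i).
Proof. exact: (big_morph (fun p => ev p) jhornerD jhorner0). Qed.

Lemma jhornerM (p q : {poly R}) : ev (p * q) = ev p ** ev q.
Proof.
rewrite -{1}[p]coefK -{1}[q]coefK !poly_def mulr_suml jhorner_sum /jhorner j_suml.
apply: eq_bigr => i _; rewrite -/(jhorner _ _ _ _) mulr_sumr jhorner_sum j_sumr.
apply: eq_bigr => j _.
by rewrite -scalerAl -scalerAr !jhornerZ -exprD jhornerXn jpowD !jE.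
Qed.

Lemma exists_annihilator : exists2 q : {poly R}, q != 0 & ev q = 0.
Proof.
pose m := \dim {:V}.
pose A := \matrix_(i < m.+1, j < m) coord (vbasis {:V}) j (x ^^ i).
have : kermx A != 0.
  rewrite kermx_eq0 /row_free neq_ltn.
  by apply/orP; left; rewrite ltnS rank_leq_col.
move/rowV0Pn => [u /sub_kermxP uA u0].
pose q := \poly_(i < m.+1) u 0 (inord i).
have qi (i : 'I_m.+1) : q`_i = u 0 i.
  by rewrite coef_poly ltn_ord inord_val.
exists q.
  apply: contra_neq u0 => q0; apply/rowP => i.
  by rewrite -qi q0 coef0 mxE.
rewrite (@jhorner_widen _ m.+1) ?size_poly//.
rewrite [LHS](coord_vbasis (memvf _)); apply: big1 => j _.
suff -> : coord (vbasis {:V}) j (\sum_(i < m.+1) q`_i *: x ^^ i) = 0 by rewrite scale0r.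
move/rowP/(_ j): uA; rewrite !mxE => uA; rewrite linear_sum -[RHS]uA.
by apply: eq_bigr => i _; rewrite linearZ /= qi mxE.
Qed.

Lemma exists_minpoly : exists p, is_minpoly mul e x p.
Proof.
have [q q0 qx] := exists_annihilator.
pose P k := `[< exists q : {poly R}, [/\ q != 0, ev q = 0 & size q = k] >].
have exP : exists k, P k by exists (size q); apply/asboolP; exists q.
have [k /asboolP[p [p0 px pk]] kmin] := ex_minnP exP.
have lp : lead_coef p != 0 by rewrite lead_coef_eq0.
exists ((lead_coef p)^-1 *: p); split.
- by rewrite monicE lead_coefZ mulVf.
- by rewrite jhornerZ px scaler0.
- move=> s s0 sx; rewrite size_scale ?invr_eq0// pk.
  by apply: kmin; apply/asboolP; exists s.
Qed.

Section MinimalPolynomial.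
Variable p : {poly R}.
Hypothesis px : is_minpoly mul e x p.

Lemma minpoly_neq0 : p != 0. Proof. by have [/monic_neq0] := px. Qed.

Lemma minpoly_dvdp (q : {poly R}) : ev q = 0 -> p %| q.
Proof.
have [pm p0 pmin] := px => qx.
rewrite /dvdp; apply: contraT => r0.
have := pmin _ r0; rewrite leqNgt ltn_modp minpoly_neq0 /= => -> //.
have := divp_eq q p => /(congr1 (fun q => ev q)).
by rewrite qx jhornerD jhornerM p0 j0r add0r.
Qed.

Lemma dvdp_minpoly (q : {poly R}) : p %| q -> ev q = 0.
Proof.
have [_ p0 _] := px.
by move=> /dvdpP[s ->]; rewrite jhornerM p0 j0r.
Qed.

Lemma minpoly_lt (q : {poly R}) : q != 0 -> (size q < size p)%N -> ev q != 0.
Proof.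
have [_ _ pmin] := px => q0; rewrite ltnNge; apply: contraNneq; exact: pmin.
Qed.

End MinimalPolynomial.

End Powers.

(** Formal reality: pairing the sum with [e] under the associative form gives [form u u + form v v],
    and the form is positive definite. *)
Lemma sum_squares_eq0 u v : u ** u + v ** v = 0 -> u = 0 /\ v = 0.
Proof.
have [form [fl fC fpos fA]] := jform EJA.
have fD y z w : form (y + z) w = form y w + form z w.
  by rewrite -[y]scale1r fl mul1r scale1r.
have f0 w : form 0 w = 0 by have := fD 0 0 w; rewrite addr0; lra.
have ge0 y : 0 <= form y y.
  by have [->|/fpos/ltW//] := eqVneq y 0; rewrite f0.
move=> /(congr1 (form ^~ e)); rewrite fD !fA !j1r f0 => H.
have := ge0 u; have := ge0 v => v0 u0.
split; apply/eqP; apply: contraT => /fpos; lra.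
Qed.

(** * Minimal polynomials split over the reals with simple roots *)

Section Spectral.
Variables (x : V) (p : {poly R}).
Hypothesis px : is_minpoly mul e x p.
Local Notation ev p := (jhorner mul e p x).

(** Take a complex root a + ib of [q]. If b is nonzero, the real quadratic d = (X - a)^2 + b^2
    divides [p], say p = s d. The squares of ((X - a) s)(x) and (b s)(x) then add up to (s p)(x) =
    0, so s(x) = 0 by formal reality, against the minimality of [p]. *)
Lemma minpoly_factor_root (q : {poly R}) : q %| p -> (1 < size q)%N -> exists z, root q z.
Proof.
move=> qp q1.
pose f := real_complex R.
have sq : size (map_poly f q) != 1%N by rewrite size_map_poly; case: size q1 => [|[]].
have [[a b] rw] := closed_rootP (map_poly f q) sq.
have [b0|b0] := eqVneq b 0.
  exists a; rewrite b0 in rw.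
  by rewrite -(fmorph_root f).
pose d : {poly R} := ('X - a%:P) ^+ 2 + (b ^+ 2)%:P.
have dw : root (map_poly f d) (a +i* b)%C.
  rewrite rootE /d rmorphD rmorphXn rmorphB /= map_polyX !map_polyC /= !hornerE.
  apply/eqP; rewrite /f /=; apply/eqP; rewrite eq_complex /=.
  by apply/andP; split; apply/eqP; ring.
have sd : size d = 3%N.
  by rewrite /d size_polyDl size_exp_XsubC// (leq_ltn_trans (size_polyC_leq1 _)).
have d0 : d != 0 by rewrite -size_poly_eq0 sd.
have dq : d %| q.
  rewrite /dvdp; set t : {poly R} := q %% d.
  have st : (size t <= 2)%N by rewrite -ltnS -sd ltn_modp.
  have tw : root (map_poly f t) (a +i* b)%C.
    move: rw dw; rewrite (divp_eq q d) -/t !rootE rmorphD rmorphM !hornerE /=.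
    by move=> /[swap] /eqP ->; rewrite mulr0 add0r.
  have te : t = (t`_1)%:P * 'X + (t`_0)%:P.
    apply/polyP => i; rewrite coefD coefCM coefX coefC.
    case: i => [|[|i]] /=; rewrite ?mulr0 ?mulr1 ?add0r ?addr0 //.
    by move/leq_sizeP: st => ->.
  move: tw; rewrite te rootE rmorphD rmorphM /= map_polyX !map_polyC /= !hornerE /=.
  rewrite eq_complex /= => /andP[/eqP E1 /eqP E2].
  have t1 : t`_1 = 0.
    by apply: (mulIf b0); lra.
  have t0 : t`_0 = 0 by rewrite t1 in E1; lra.
  by rewrite t1 t0 polyC0 mul0r addr0.
have /dvdpP[s ps] := dvdp_trans dq qp.
have p0 := minpoly_neq0 px.
have s0 : s != 0 by apply: contra_neq p0; rewrite ps => ->; rewrite mul0r.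
have ys : ev s != 0.
  by apply: (minpoly_lt px s0); rewrite ps size_mul// sd !addnS addn0.
have [_] : ev (('X - a%:P) * s) = 0 /\ ev (b *: s) = 0.
  apply: sum_squares_eq0; rewrite -!jhornerM -jhornerD.
  apply: (dvdp_minpoly px); rewrite ps.
  have -> : ('X - a%:P) * s * (('X - a%:P) * s) + b *: s * (b *: s) = s * (s * d).
    by rewrite /d -!mul_polyC rmorphXn /=; ring.
  by rewrite dvdp_mull.
rewrite jhornerZ => /eqP; rewrite scaler_eq0 (negbTE b0) /=.
by rewrite (negbTE ys).
Qed.

Lemma minpoly_factor_split (q : {poly R}) : q \is monic -> q %| p ->
  exists rs, q = \prod_(z <- rs) ('X - z%:P).
Proof.
move: {2}(size q) (leqnn (size q)) => k.
elim: k q => [|k IH] q sq qm qp.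
  by move: (monic_neq0 qm); rewrite -size_poly_eq0 -leqn0 sq.
have [q1|q1] := leqP (size q) 1.
  exists [::]; rewrite big_nil.
  have : size q == 1%N by rewrite eqn_leq q1 size_poly_gt0 monic_neq0.
  case/size_poly1P => c _ qc; move: qm; rewrite qc monicE lead_coefC.
  by move=> /eqP ->.
have [z] := minpoly_factor_root qp q1.
rewrite -dvdp_XsubCl => /dvdpP[s qs].
have sm : s \is monic by rewrite qs monicMr ?monicXsubC in qm.
have [|//||rs srs] := IH s.
- rewrite -ltnS (leq_trans _ sq)// qs size_Mmonic ?monic_neq0 ?monicXsubC//.
  by rewrite size_XsubC addn2.
- by rewrite (dvdp_trans _ qp)// qs dvdp_mulr.
by exists (z :: rs); rewrite big_cons qs mulrC srs.
Qed.

(** A repeated root gives p = (X - z)^2 s, so that ((X - z) s)(x) has square zero and hence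
    vanishes, although (X - z) s has smaller degree than [p]. *)
Lemma minpoly_split : exists2 rs, uniq rs & p = \prod_(z <- rs) ('X - z%:P).
Proof.
have [pm pe _] := px.
have [rs prs] := minpoly_factor_split pm (dvdpp p).
exists rs => //; apply: contraT => /(uniqPn 0)[i [j [ij js zij]]].
have irs : (i < size rs)%N by apply: ltn_trans js.
pose z := rs`_i; rewrite -/z in zij.
pose rs' := rem z rs.
have zrs : z \in rs by rewrite mem_nth.
have zrs' : z \in rs'.
  rewrite -has_pred1 has_count count_rem zrs /= eqxx subn_gt0.
  have -> : count_mem z rs = (count_mem z (take j rs) + count_mem z (drop j rs))%N.
    by rewrite -count_cat cat_take_drop.
  have h1 : (0 < count_mem z (take j rs))%N.
    rewrite -has_count has_pred1 /z -[X in X \in _](nth_take 0 ij).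
    by rewrite mem_nth// size_take js.
  have h2 : (0 < count_mem z (drop j rs))%N.
    by rewrite -has_count has_pred1 zij (drop_nth 0 js) inE eqxx.
  by rewrite -addn1 leq_add.
have pz : p = ('X - z%:P) * (('X - z%:P) * \prod_(z <- rem z rs') ('X - z%:P)).
  rewrite prs (perm_big _ (perm_to_rem zrs)) big_cons.
  by rewrite (perm_big _ (perm_to_rem zrs')) big_cons.
set s := (X in _ = _ * (_ * X)) in pz.
have s0 : ('X - z%:P) * s != 0.
  by apply: contra_neq (minpoly_neq0 px) => H; rewrite pz H mulr0.
have : ev (('X - z%:P) * s) != 0.
  have sp : size p = (size (('X - z%:P) * s)).+1.
    by rewrite {1}pz mulrC (size_Mmonic s0 (monicXsubC z)) size_XsubC addn2.
  by apply: (minpoly_lt px s0); rewrite sp.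
have [-> //] : ev (('X - z%:P) * s) = 0 /\ (0 : V) = 0.
  apply: sum_squares_eq0; rewrite j0l addr0 -jhornerM.
  apply: (dvdp_minpoly px); rewrite {1}pz.
  by rewrite mulrAC !mulrA -mulrA dvdp_mulr.
by rewrite eqxx.
Qed.

End Spectral.
End JordanIdentities.

(** * Complete systems of orthogonal idempotents and the spectral theorem *)

Section OrthogonalIdempotents.
Context (R : realType) (V : vectType R) (mul : V -> V -> V) (e : V).
Hypothesis EJA : euclidean_jordan_algebra mul e.
Local Notation "x ** y" := (mul x y) (at level 40, left associativity).
Let jC := jC EJA.
Let jE := jE EJA.

(** The idempotents need not be primitive; primitivity is automatic when their number is the rank,
    see [system_primitive]. *)
Definition idempotent_system m (c : 'I_m -> V) :=
  [/\ forall i, c i != 0, forall i j, c i ** c j = (i == j)%:R *: c i &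
      \sum_i c i = e].

Section System.
Variables (m : nat) (c : 'I_m -> V).
Hypothesis cP : idempotent_system c.

Lemma idem_system_idem i : c i ** c i = c i.
Proof. by have [_ -> _] := cP; rewrite eqxx scale1r. Qed.

Lemma idem_system_orth i j : i != j -> c i ** c j = 0.
Proof. by have [_ -> _] := cP => /negbTE->; rewrite scale0r. Qed.

Lemma idem_system_mul z i : (\sum_j z j *: c j) ** c i = z i *: c i.
Proof.
rewrite (j_suml EJA) (bigD1 i)//= big1 ?addr0 => [|j ji].
  by rewrite jE idem_system_idem.
by rewrite jE idem_system_orth// scaler0.
Qed.

Lemma idem_system_inj z z' :
  \sum_j z j *: c j = \sum_j z' j *: c j -> z =1 z'.
Proof.
move=> /(congr1 (mul^~ _)) zz i.
have := zz (c i); rewrite !idem_system_mul => /eqP.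
rewrite -subr_eq0 -scalerBl scaler_eq0 subr_eq0; have [/(_ i)/negbTE-> _ _] := cP.
by rewrite orbF => /eqP.
Qed.

Lemma idem_system_prod z z' :
  (\sum_j z j *: c j) ** (\sum_j z' j *: c j) = \sum_j (z j * z' j) *: c j.
Proof.
rewrite (j_sumr EJA); apply: eq_bigr => j _.
by rewrite jE idem_system_mul scalerA mulrC.
Qed.

Lemma jpow_idem_system z k :
  jpow mul e (\sum_j z j *: c j) k = \sum_j (z j ^+ k) *: c j.
Proof.
elim: k => [|k IH].
  by have [_ _ <-] := cP; apply: eq_bigr => i _; rewrite expr0 scale1r.
by rewrite /jpow iterS -/(jpow _ _ _ _) IH idem_system_prod; apply: eq_bigr => i _; rewrite exprS.
Qed.

Lemma jhorner_idem_system z (q : {poly R}) :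
  jhorner mul e q (\sum_j z j *: c j) = \sum_j q.[z j] *: c j.
Proof.
rewrite /jhorner; under eq_bigr do rewrite jpow_idem_system scaler_sumr.
rewrite exchange_big /=; apply: eq_bigr => j _.
by rewrite horner_coef scaler_suml; apply: eq_bigr => i _; rewrite scalerA.
Qed.

Lemma minpoly_idem_system (z : 'I_m -> R) : injective z ->
  is_minpoly mul e (\sum_j z j *: c j) (\prod_j ('X - (z j)%:P)).
Proof.
move=> zI; split; first exact: monic_prod_XsubC.
  rewrite jhorner_idem_system big1// => i _.
  by rewrite horner_prod (bigD1 i)//= !hornerE subrr mul0r scale0r.
move=> q q0; rewrite jhorner_idem_system => qc.
have qz i : q.[z i] = 0.
  apply: (@idem_system_inj (fun j => q.[z j]) (fun=> 0)).
  by rewrite qc big1// => j _; rewrite scale0r.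
rewrite -(big_map z xpredT (fun y => 'X - y%:P)).
apply: dvdp_leq => //; apply: uniq_roots_dvdp.
  by apply/allP => _ /mapP[i _ ->]; rewrite rootE qz.
by rewrite uniq_rootsE map_inj_uniq// /index_enum -enumT enum_uniq.
Qed.

Lemma size_minpoly_idem_system (z : 'I_m -> R) :
  (size (\prod_j ('X - (z j)%:P))).-1 = m.
Proof.
by rewrite size_prod_XsubC /= /index_enum -enumT size_enum_ord.
Qed.

(** With the distinct coefficients 0, ..., m - 1 the system produces an element whose minimal
    polynomial has degree m. *)
Lemma idem_system_rank r : jordan_rank mul e r -> (m <= r)%N.
Proof.
move=> [rmax _]; pose z (j : 'I_m) : R := (j : nat)%:R.
have zI : injective z by move=> i j /eqP; rewrite eqr_nat => /eqP/val_inj.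
by have := rmax _ _ (minpoly_idem_system zI); rewrite size_minpoly_idem_system.
Qed.

End System.

Lemma lagrange_basis m (z : 'I_m -> R) : injective z ->
  exists ell : 'I_m -> {poly R}, forall i j, (ell i).[z j] = (i == j)%:R.
Proof.
move=> zI; exists (fun i => \prod_(j | j != i) ((z i - z j)^-1 *: ('X - (z j)%:P))).
move=> i j; rewrite horner_prod; have [<-|ij] := eqVneq i j.
  rewrite big1// => k ki; rewrite !hornerE mulVf// subr_eq0.
  by apply: contra_neq ki => /zI.
by rewrite (bigD1 j) ?(eq_sym j)//= !hornerE subrr mulr0 mul0r.
Qed.

(** The idempotents are the values at [x] of the Lagrange polynomials for the roots of [p]. As [p]
    is a product of distinct linear factors, polynomials that agree on the roots take the same value
    at [x], and all the relations become pointwise identities on the roots. *)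
Lemma spectral_theorem x p : is_minpoly mul e x p ->
  exists z : 'I_(size p).-1 -> R, exists2 c : 'I_(size p).-1 -> V,
    idempotent_system c & injective z /\ x = \sum_i z i *: c i.
Proof.
move=> px; have [rs urs prs] := minpoly_split EJA px.
have srs : (size p).-1 = size rs by rewrite prs size_prod_XsubC.
rewrite srs; pose z (i : 'I_(size rs)) := rs`_i.
have zI : injective z.
  by move=> i j /eqP; rewrite /z nth_uniq// => /eqP/val_inj.
have ev_ext (q1 q2 : {poly R}) : (forall i, q1.[z i] = q2.[z i]) ->
    jhorner mul e q1 x = jhorner mul e q2 x.
  move=> q12; apply/eqP; rewrite -subr_eq0 -jhornerB; apply/eqP.
  apply: (dvdp_minpoly EJA px); rewrite prs; apply: uniq_roots_dvdp.
    apply/allP => y /(nthP 0)[i irs <-].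
    by have := q12 (Ordinal irs); rewrite /z /= rootE !hornerE => ->; rewrite subrr.
  by rewrite uniq_rootsE.
have [ell ellE] := lagrange_basis zI.
exists z; exists (fun i => jhorner mul e (ell i) x).
  split.
  - move=> i; apply/eqP => /(minpoly_dvdp EJA px); rewrite prs => /dvdpP[s es].
    have := ellE i i; rewrite es eqxx hornerM horner_prod.
    have zin : z i \in rs by rewrite mem_nth.
    rewrite (big_rem _ zin) /= hornerXsubC subrr. rewrite mul0r mulr0 => /esym/eqP.
    by rewrite oner_eq0.
  - move=> i j; rewrite -(jhornerM EJA) -jhornerZ; apply: ev_ext => k.
    rewrite !hornerE !ellE; have [<-|ij] := eqVneq i j.
      by rewrite -natrM mulnb andbb mul1r.
    have [<-|_] := eqVneq i k; last by rewrite !mulr0n ?mul0r.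
    by rewrite eq_sym (negbTE ij) mulr0n mulr0 mul0r.
  - rewrite -jhorner_sum -[RHS](jhorner1 mul e x); apply: ev_ext => k.
    rewrite horner_sum (bigD1 k)//= ellE eqxx big1 ?addr0 ?hornerE//.
    by move=> i ik; rewrite ellE (negbTE ik).
split=> //.
under eq_bigr do rewrite -jhornerZ.
rewrite -jhorner_sum -[LHS](jhornerX EJA x); apply: ev_ext => k.
rewrite horner_sum (bigD1 k)//= !hornerE ellE eqxx mulr1 big1 ?addr0//.
by move=> i ik; rewrite !hornerE ellE (negbTE ik) mulr0.
Qed.

Corollary spectral_decomposition x : exists m (z : 'I_m -> R) (c : 'I_m -> V),
  [/\ idempotent_system c, injective z & x = \sum_i z i *: c i].
Proof.
have [p px] := exists_minpoly mul e x.
have [z [c cP [zI xE]]] := spectral_theorem px.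
by exists (size p).-1, z, c.
Qed.

End OrthogonalIdempotents.

(** * Peirce decomposition and Peirce reflections *)

Section Peirce.
Context (R : realType) (V : vectType R) (mul : V -> V -> V) (e : V).
Hypothesis EJA : euclidean_jordan_algebra mul e.
Local Notation "x ** y" := (mul x y) (at level 40, left associativity).
Let jC := jC EJA.
Let jE := jE EJA.

Section Idempotent.
Variable c : V.
Hypothesis cI : c ** c = c.

(** The operator L(c) satisfies 2 L^3 - 3 L^2 + L = 0, so its eigenvalues are among 0, 1/2 and 1;
    this is [jordan_mul3] with three factors equal to [c]. *)
Lemma peirce_cubic y : 2 *: (c ** (c ** (c ** y))) = 3 *: (c ** (c ** y)) - c ** y.
Proof.
have H := jordan_mul3 EJA c c c y; rewrite !cI in H.
by vlra.
Qed.

(* The component of [y] in the Peirce space [V_(1/2)(c)]; what is left lies in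
   [V_0(c) + V_1(c)], the kernel of [L(c)^2 - L(c)]. *)
Definition peirce_half y := 4 *: (c ** y - c ** (c ** y)).
Local Notation H := peirce_half.
Definition peirce_even y := c ** (c ** y) = c ** y.

Lemma peirce_halfP a x y : H (a *: x + y) = a *: H x + H y.
Proof. by rewrite /H !jE; vlra. Qed.

Lemma mul_peirce_half y : c ** H y = 2^-1 *: H y.
Proof. by have K := peirce_cubic y; rewrite /H !jE; vlra. Qed.

Lemma peirce_evenB y : peirce_even (y - H y).
Proof.
rewrite /peirce_even; have K := mul_peirce_half y.
have D : H y = 4 *: (c ** y - c ** (c ** y)) by [].
by move: (H y) K D => h K D; rewrite !jE K !jE K; vlra.
Qed.

Lemma peirce_decomposition y :
  exists y0 y1, [/\ y = y0 + y1, peirce_even y0 & c ** y1 = 2^-1 *: y1].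
Proof.
exists (y - H y), (H y).
by rewrite subrK mul_peirce_half; split => //; exact: peirce_evenB.
Qed.

Lemma peirce_half_even y : peirce_even y -> H y = 0.
Proof. by move=> ye; rewrite /H ye subrr scaler0. Qed.

Lemma peirce_half_id y : c ** y = 2^-1 *: y -> H y = y.
Proof. by move=> yh; rewrite /H yh jE yh; vlra. Qed.

(** Combine the linearized identity at [u] with the one at [c ** u], on which [c] acts as the
    identity. *)
Lemma peirce_even_comm u v : peirce_even u -> c ** (u ** v) = u ** (c ** v).
Proof.
move=> ue.
have K w := jordan_lin EJA c w c v.
have K1 := K u; have K2 := K (c ** u).
by rewrite !cI in K1; rewrite !cI ue in K2; vlra.
Qed.

Lemma peirce_half_mul u v : c ** u = 2^-1 *: u -> c ** v = 2^-1 *: v ->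
  peirce_even (u ** v).
Proof.
move=> uh vh; rewrite /peirce_even.
have K := jordan_lin EJA u v c c.
rewrite cI (jC u c) (jC v c) uh vh !jE (jC u c) (jC v c) uh vh !jE in K.
rewrite (jC v u) !(jC (u ** v) c) in K.
by vlra.
Qed.

Lemma peirce_even_half u v : peirce_even u -> c ** v = 2^-1 *: v ->
  c ** (u ** v) = 2^-1 *: (u ** v).
Proof. by move=> ue vh; rewrite peirce_even_comm// vh jE. Qed.

Lemma peirce_even_mul u v : peirce_even u -> peirce_even v -> peirce_even (u ** v).
Proof. by move=> ue ve; rewrite /peirce_even !peirce_even_comm// ve. Qed.

(* The Peirce reflection [P(e - 2c)]. *)
Definition peirce_refl y := y - 2 *: H y.
Local Notation S := peirce_refl.

Lemma peirce_reflP a x y : S (a *: x + y) = a *: S x + S y.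
Proof. by rewrite /S peirce_halfP; vlra. Qed.

Lemma peirce_refl_even y : peirce_even y -> S y = y.
Proof. by move=> ye; rewrite /S peirce_half_even// scaler0 subr0. Qed.

Lemma peirce_refl_half y : c ** y = 2^-1 *: y -> S y = - y.
Proof. by move=> yh; rewrite /S peirce_half_id//; vlra. Qed.

Lemma peirce_reflD x y : S (x + y) = S x + S y.
Proof. by rewrite -[x]scale1r peirce_reflP !scale1r. Qed.

Lemma peirce_refl_sum x0 x1 : peirce_even x0 -> c ** x1 = 2^-1 *: x1 ->
  S (x0 + x1) = x0 - x1.
Proof.
by move=> xe xh; rewrite peirce_reflD (peirce_refl_even xe) (peirce_refl_half xh).
Qed.

Lemma peirce_reflK y : S (S y) = y.
Proof.
have [y0 [y1 [-> y0e y1h]]] := peirce_decomposition y.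
rewrite peirce_refl_sum// peirce_reflD (peirce_refl_even y0e) peirce_refl_half ?opprK//.
by rewrite !jE y1h scalerN.
Qed.

Lemma peirce_refl1 : S e = e.
Proof. by apply: peirce_refl_even; rewrite /peirce_even (j1r EJA) cI. Qed.

(** The splitting of V into V_0 + V_1 (even) and V_(1/2) (odd) is a grading by Z/2, and the
    reflection is the sign of this grading, hence an automorphism. *)
Lemma peirce_refl_mul x y : S (x ** y) = S x ** S y.
Proof.
have [x0 [x1 [-> xe xh]]] := peirce_decomposition x.
have [y0 [y1 [-> ye yh]]] := peirce_decomposition y.
rewrite (peirce_refl_sum xe xh) (peirce_refl_sum ye yh).
have -> : (x0 + x1) ** (y0 + y1) = (x0 ** y0 + x1 ** y1) + (x0 ** y1 + y0 ** x1).
  by rewrite !jE (jC x1 y0); vlra.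
rewrite peirce_refl_sum.
- by rewrite !jE (jC x1 y0); vlra.
- by rewrite /peirce_even !jE peirce_even_mul// peirce_half_mul.
- by rewrite !jE !peirce_even_half// scalerDr.
Qed.

Lemma jpow_refl x k : jpow mul e (S x) k = S (jpow mul e x k).
Proof.
elim: k => [|k IH]; first by rewrite /= peirce_refl1.
by rewrite /jpow !iterS -!/(jpow _ _ _ _) IH peirce_refl_mul.
Qed.

Lemma jhorner_refl (p : {poly R}) x : jhorner mul e p (S x) = S (jhorner mul e p x).
Proof.
have S0 : S 0 = 0 by rewrite peirce_refl_even// /peirce_even !jE.
have SZ a y : S (a *: y) = a *: S y by rewrite -[_ *: y]addr0 peirce_reflP S0 addr0.
rewrite /jhorner (big_morph S peirce_reflD S0); apply: eq_bigr => i _.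
by rewrite jpow_refl SZ.
Qed.

Lemma is_minpoly_refl x p : is_minpoly mul e x p -> is_minpoly mul e (S x) p.
Proof.
have S0 : S 0 = 0 by rewrite peirce_refl_even// /peirce_even !jE.
case=> pm px pmin; split=> //; first by rewrite jhorner_refl px.
move=> q q0; rewrite jhorner_refl => /(congr1 S).
by rewrite peirce_reflK S0; exact: pmin.
Qed.

End Idempotent.

Section TwoIdempotents.
Variables c d : V.
Hypotheses (cI : c ** c = c) (cd : c ** d = 0).

Lemma orth_idem_comm y : c ** (d ** y) = d ** (c ** y).
Proof.
have K := jordan_lin EJA c c d y.
rewrite cI (jC d c) cd !jE in K.
by vlra.
Qed.

(** L(c) L(d) maps into the Peirce space V_(1/2)(c). It follows that [d] annihilates V_1(c), see
    [orth_idem_peirce1]. *)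
Lemma orth_idem_mul2 y : c ** (c ** (d ** y)) = 2^-1 *: (c ** (d ** y)).
Proof.
have K := jordan_mul3 EJA c c d y.
rewrite cI cd !jE in K.
rewrite -(orth_idem_comm y) in K.
by vlra.
Qed.

Lemma orth_idem_peirce1 y : c ** y = y -> d ** y = 0.
Proof.
move=> cy; have K := orth_idem_mul2 y.
rewrite orth_idem_comm cy orth_idem_comm cy in K.
by vlra.
Qed.
End TwoIdempotents.

End Peirce.

(** * Polynomials on a vector space: evaluation, directional derivatives, restriction to lines *)

Section PolynomialEvaluation.
Context (R : realType).

Lemma poly_eq0_horner (h : {poly R}) : (forall t, h.[t] = 0) -> h = 0.
Proof.
move=> h0; apply: contraTeq (leqnn (size h)) => hn0; rewrite -ltnNge.
pose s := [seq (i%:R : R) | i <- iota 0 (size h)].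
have ss : size s = size h by rewrite size_map size_iota.
have := @max_poly_roots _ h s hn0; rewrite ss; apply.
  by apply/allP => y _; rewrite rootE h0.
rewrite map_inj_uniq ?iota_uniq// => i j /eqP.
by rewrite eqr_nat => /eqP.
Qed.

Lemma poly_eq_horner_generic (D h g : {poly R}) : D != 0 ->
  (forall t, D.[t] != 0 -> h.[t] = g.[t]) -> h = g.
Proof.
move=> D0 hg; apply/eqP; rewrite -subr_eq0; apply/eqP.
apply: (mulfI D0); rewrite mulr0; apply: poly_eq0_horner => t.
rewrite !hornerE; have [->|/hg->] := eqVneq D.[t] 0; first by rewrite mul0r.
by rewrite subrr mulr0.
Qed.

Lemma mpoly_ring_ind N (P : mpoly.mpoly N R -> Prop) :
  (forall a, P (mpoly.mpolyC N a)) ->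
  (forall i, P (mpoly.mpolyX R (mpoly.mnm1 i))) ->
  (forall p q, P p -> P q -> P (p + q)) ->
  (forall p q, P p -> P q -> P (p * q)) -> forall p, P p.
Proof.
move=> PC PX PD PM p; rewrite (mpoly.mpolyE p).
elim/big_rec: _ => [|m q _ Pq]; first by rewrite -mpoly.mpolyC0; exact: PC.
apply: (PD _ _ _ Pq); rewrite -mpoly.mul_mpolyC; apply: (PM _ _ (PC _)).
rewrite mpoly.mpolyXE_id; elim/big_rec: _ => [|i s _ Ps].
  by rewrite -mpoly.mpolyC1; exact: PC.
apply: (PM _ _ _ Ps); elim: (mpoly.fun_of_multinom m i) => [|k IH].
  by rewrite expr0 -mpoly.mpolyC1; exact: PC.
by rewrite exprS; apply: PM.
Qed.

Context (W : vectType R) (N : nat) (B : N.-tuple W).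
Implicit Types (p q : mpoly.mpoly N R) (x w : W).

Definition peval q x : R := mpoly.meval (fun i => coord B i x) q.

Definition pderiv w q : mpoly.mpoly N R := \sum_i coord B i w *: mpoly.mderiv i q.

Lemma pevalD p q x : peval (p + q) x = peval p x + peval q x.
Proof. exact: mpoly.mevalD. Qed.
Lemma pevalN p x : peval (- p) x = - peval p x.
Proof. exact: mpoly.mevalN. Qed.
Lemma pevalM p q x : peval (p * q) x = peval p x * peval q x.
Proof. exact: mpoly.mevalM. Qed.
Lemma pevalZ a q x : peval (a *: q) x = a * peval q x.
Proof. exact: mpoly.mevalZ. Qed.
Lemma pevalC a x : peval (mpoly.mpolyC N a) x = a.
Proof. exact: mpoly.mevalC. Qed.
Lemma peval0 x : peval 0 x = 0. Proof. exact: mpoly.meval0. Qed.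
Lemma peval1 x : peval 1 x = 1. Proof. exact: mpoly.meval1. Qed.
Lemma pevalX i x : peval (mpoly.mpolyX R (mpoly.mnm1 i)) x = coord B i x.
Proof. exact: mpoly.mevalXU. Qed.
Lemma pevalXn q k x : peval (q ^+ k) x = peval q x ^+ k.
Proof. by elim: k => [|k IH]; rewrite ?expr0 ?peval1// !exprS pevalM IH. Qed.
Lemma peval_sum I (s : seq I) (P : pred I) (F : I -> mpoly.mpoly N R) x :
  peval (\sum_(i <- s | P i) F i) x = \sum_(i <- s | P i) peval (F i) x.
Proof. by apply: (big_morph (peval^~ x)) => [? ?|]; rewrite ?pevalD ?peval0. Qed.
Definition pevalE := (pevalD, pevalN, pevalM, pevalZ, pevalC, peval0, peval1, pevalX, pevalXn).

Lemma pderivD w p q : pderiv w (p + q) = pderiv w p + pderiv w q.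
Proof.
by rewrite /pderiv -big_split; apply: eq_bigr => i _; rewrite mpoly.mderivD scalerDr.
Qed.
Lemma pderivZ w a q : pderiv w (a *: q) = a *: pderiv w q.
Proof.
rewrite /pderiv scaler_sumr; apply: eq_bigr => i _.
by rewrite mpoly.mderivZ !scalerA mulrC.
Qed.
Lemma pderivC w a : pderiv w (mpoly.mpolyC N a) = 0.
Proof. by rewrite /pderiv big1// => i _; rewrite mpoly.mderivC scaler0. Qed.
Lemma pderivM w p q : pderiv w (p * q) = pderiv w p * q + p * pderiv w q.
Proof.
rewrite /pderiv mulr_suml mulr_sumr -big_split; apply: eq_bigr => i _.
by rewrite mpoly.mderivM scalerDr scalerAl scalerAr.
Qed.
Lemma pderiv_comm v w q : pderiv v (pderiv w q) = pderiv w (pderiv v q).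
Proof.
have lin i u : mpoly.mderiv i (pderiv u q) = \sum_j coord B j u *: mpoly.mderiv i (mpoly.mderiv j q).
  by rewrite /pderiv linear_sum; apply: eq_bigr => j _; rewrite linearZ.
rewrite [LHS]/pderiv [RHS]/pderiv.
under eq_bigr do rewrite lin scaler_sumr.
under [RHS]eq_bigr do rewrite lin scaler_sumr.
rewrite exchange_big /=; apply: eq_bigr => i _; apply: eq_bigr => j _.
by rewrite !scalerA mulrC mpoly.mderiv_comm.
Qed.
Lemma pderiv_linear a v w q : pderiv (a *: v + w) q = a *: pderiv v q + pderiv w q.
Proof.
rewrite /pderiv scaler_sumr -big_split; apply: eq_bigr => i _.
by rewrite linearP scalerDl scalerA.
Qed.

Lemma deriv_mmap q (g : 'I_N -> {poly R}) :
  (mpoly.mmap (@polyC R) g q)^`() =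
  \sum_i mpoly.mmap (@polyC R) g (mpoly.mderiv i q) * (g i)^`().
Proof.
have ED := rmorphD (mpoly.mmap (@polyC R) g).
have EM := rmorphM (mpoly.mmap (@polyC R) g).
have EC := mpoly.mmapC g (@polyC R).
elim/mpoly_ring_ind: q => [a|i|p q Hp Hq|p q Hp Hq].
- rewrite EC derivC big1// => i _.
  by rewrite mpoly.mderivC -(mpoly.mpolyC0 N) EC mul0r.
- rewrite (bigD1 i)//= big1 => [|j ji].
    rewrite addr0 mpoly.mderivX mpoly.mnm1E eqxx scale1r.
    rewrite -{2}[mpoly.mnm1 i]mpoly.add0m mpoly.addmK mpoly.mpolyX0.
    by rewrite -(mpoly.mpolyC1 N) EC mul1r mpoly.mmapX mpoly.mmap1U.
  rewrite mpoly.mderivX mpoly.mnm1E eq_sym (negbTE ji) scale0r.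
  by rewrite -(mpoly.mpolyC0 N) EC mul0r.
- rewrite ED derivD Hp Hq -big_split; apply: eq_bigr => i _.
  by rewrite mpoly.mderivD ED mulrDl.
- rewrite EM derivM Hp Hq mulr_suml mulr_sumr -big_split; apply: eq_bigr => i _.
  by rewrite mpoly.mderivM ED !EM /=; ring.
Qed.

Lemma horner_mmap q (g : 'I_N -> {poly R}) t :
  (mpoly.mmap (@polyC R) g q).[t] = mpoly.meval (fun i => (g i).[t]) q.
Proof.
elim/mpoly_ring_ind: q => [a|i|p q Hp Hq|p q Hp Hq].
- by rewrite mpoly.mmapC mpoly.mevalC hornerC.
- by rewrite mpoly.mmapX mpoly.mmap1U mpoly.mevalXU.
- by rewrite (rmorphD (mpoly.mmap _ _)) mpoly.mevalD hornerD Hp Hq.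
- by rewrite (rmorphM (mpoly.mmap _ _)) mpoly.mevalM hornerM Hp Hq.
Qed.

Definition pline q x w : {poly R} :=
  mpoly.mmap (@polyC R) (fun i => (coord B i x)%:P + (coord B i w)%:P * 'X) q.

Lemma horner_pline q x w t : (pline q x w).[t] = peval q (x + t *: w).
Proof.
rewrite horner_mmap; apply: mpoly.meval_eq => i.
by rewrite !hornerE linearD linearZ /= mulrC.
Qed.

Lemma deriv_pline q x w : (pline q x w)^`() = pline (pderiv w q) x w.
Proof.
rewrite deriv_mmap /pderiv /pline raddf_sum; apply: eq_bigr => i _.
by rewrite /= mpoly.mmapZ derivD derivC add0r deriv_mulC derivX mulr1 mulrC.
Qed.

Lemma is_derive_peval q x w (t : R) :
  is_derive t 1 (fun t => peval q (x + t *: w)) (peval (pderiv w q) (x + t *: w)).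
Proof.
have -> : (fun t => peval q (x + t *: w)) = horner (pline q x w).
  by apply/funext => s; rewrite horner_pline.
apply: DeriveDef; first exact: derivable_horner.
by rewrite -derive1E -derivE deriv_pline horner_pline.
Qed.

Section Basis.
Hypothesis Bb : basis_of {:W} B.

Lemma pderiv_basis i q : pderiv (tnth B i) q = mpoly.mderiv i q.
Proof.
rewrite /pderiv (bigD1 i)//= big1 => [|j ji].
  by rewrite addr0 (tnth_nth 0) coord_free ?(basis_free Bb)// eqxx scale1r.
by rewrite (tnth_nth 0) coord_free ?(basis_free Bb)// eq_sym (negbTE ji) scale0r.
Qed.

(** A vanishing polynomial function has vanishing derivatives of all orders, and the coefficients
    are, up to factorials, the derivatives at 0. *)
Lemma peval_eq0 q : (forall x, peval q x = 0) -> q = 0.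
Proof.
move=> q0; apply/mpoly.mpolyP => m; rewrite mpoly.mcoeff0.
have d0 s p : (forall x, peval p x = 0) ->
    forall x, peval (foldr (@mpoly.mderiv N R) p s) x = 0.
  move=> p0; elim: s => //= i s IH x.
  rewrite -pderiv_basis -[x]addr0 -(scale0r (tnth B i)) -horner_pline -deriv_pline.
  rewrite (_ : pline _ _ _ = 0) ?deriv0 ?horner0//.
  by apply: poly_eq0_horner => t; rewrite horner_pline IH.
have : peval (mpoly.mderivm m q) 0 = 0 by rewrite mpoly.mderivm_foldr d0.
have -> p : peval p 0 = mpoly.mcoeff (mpoly.mnm0 (n := N)) p.
  elim/mpoly_ring_ind: p => [a|i|p1 q1 Hp Hq|p1 q1 Hp Hq].
  - by rewrite pevalC mpoly.mcoeffC eqxx mulr1.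
  - by rewrite pevalX linear0 mpoly.mcoeffX mpoly.mnm1_eq0.
  - by rewrite pevalD mpoly.mcoeffD Hp Hq.
  - by rewrite pevalM Hp Hq rmorphM.
rewrite mpoly.mcoeff_mderivm mpoly.addm0 => /eqP.
rewrite mulrn_eq0 => /orP[|/eqP//].
by rewrite -leqn0 leqNgt prodn_gt0// => j; rewrite ffact_gt0.
Qed.

End Basis.
End PolynomialEvaluation.

(** * Regular elements and the density principle *)

Section RegularElements.
Context (R : realType) (V : vectType R) (mul : V -> V -> V) (e : V).
Hypothesis EJA : euclidean_jordan_algebra mul e.
Local Notation "x ** y" := (mul x y) (at level 40, left associativity).
Let jC := jC EJA.
Let jE := jE EJA.
Variable r : nat.
Hypothesis hr : jordan_rank mul e r.

Definition regular x := exists2 p, is_minpoly mul e x p & (size p).-1 = r.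

Lemma regular_system x : regular x -> exists (z : 'I_r -> R) (c : 'I_r -> V),
  [/\ idempotent_system mul e c, injective z & x = \sum_i z i *: c i].
Proof.
move=> [p px pr]; have [z [c cP [zI xE]]] := spectral_theorem EJA px.
by move: z c cP zI xE; rewrite pr => z c cP zI xE; exists z, c.
Qed.

(** Polynomiality along every line is all that the density argument uses, and it is easier to check
    for products and compositions than membership in [polynomial_fun]. *)
Definition line_poly (f : V -> R) :=
  forall x w, exists h : {poly R}, forall t, f (x + t *: w) = h.[t].

Lemma line_polyM f g : line_poly f -> line_poly g -> line_poly (fun x => f x * g x).
Proof.
move=> fp gp x w; have [h hE] := fp x w; have [k kE] := gp x w.
by exists (h * k) => t; rewrite hornerM hE kE.
Qed.

Lemma line_poly_sum I (s : seq I) (F : I -> V -> R) :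
  (forall i, line_poly (F i)) -> line_poly (fun x => \sum_(i <- s) F i x).
Proof.
move=> Fp x w; elim: s => [|i s [h hE]].
  by exists 0 => t; rewrite big_nil horner0.
have [k kE] := Fp i x w.
by exists (k + h) => t; rewrite big_cons hornerD kE hE.
Qed.

Lemma line_poly_cst a : line_poly (fun=> a).
Proof. by move=> x w; exists a%:P => t; rewrite hornerC. Qed.

Lemma line_poly_linear (f : V -> R) : linfunctional f -> line_poly f.
Proof.
move=> fP x w; exists ((f x)%:P + (f w)%:P * 'X) => t.
by rewrite !hornerE (linfunctionalD fP) (linfunctionalZ fP) mulrC.
Qed.

Lemma line_poly_comp f (g : V -> V) : line_poly f ->
  (forall a x y, g (a *: x + y) = a *: g x + g y) -> line_poly (f \o g).
Proof.
move=> fp gP x w; have [h hE] := fp (g x) (g w).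
by exists h => t; rewrite /= addrC gP addrC hE.
Qed.

Lemma polynomial_fun_line f : polynomial_fun f -> line_poly f.
Proof.
move=> [p pE] x w; exists (pline (vbasis {:V}) p x w) => t.
by rewrite pE horner_pline.
Qed.

Let vb := vbasis {:V}.

Lemma coord_mul j u v : coord vb j (u ** v) =
  \sum_i \sum_l coord vb i u * coord vb l v * coord vb j (vb`_i ** vb`_l).
Proof.
rewrite {1}(coord_vbasis (memvf u)) {1}(coord_vbasis (memvf v)).
rewrite (j_suml EJA) linear_sum; apply: eq_bigr => i _.
rewrite (j_sumr EJA) linear_sum; apply: eq_bigr => l _.
by rewrite !jE !linearZ /= mulrCA mulrA [X in X * _]mulrC.
Qed.

Lemma line_poly_jpow j k : line_poly (fun x => coord vb j (jpow mul e x k)).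
Proof.
elim: k j => [|k IH] j; first exact: (line_poly_cst (coord vb j e)).
have -> : (fun x => coord vb j (jpow mul e x k.+1)) = (fun x =>
  \sum_i \sum_l coord vb i x * coord vb l (jpow mul e x k) * coord vb j (vb`_i ** vb`_l)).
  by apply/funext => x; rewrite /jpow iterS coord_mul.
apply: line_poly_sum => i; apply: line_poly_sum => l.
apply: line_polyM; last exact: line_poly_cst.
apply: line_polyM; last exact: IH.
by apply: line_poly_linear => a x y; rewrite linearP.
Qed.

Definition power_matrix x := \matrix_(i < r, j < \dim {:V}) coord vb j (jpow mul e x i).

Lemma power_matrix_mul x (u : 'rV[R]_r) :
  (u *m power_matrix x == 0) =
  (jhorner mul e (\poly_(i < r) (if insub i is Some i' then u 0 i' else 0)) x == 0).
Proof.
set q := \poly_(i < r) _.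
have qx : jhorner mul e q x = \sum_(i < r) u 0 i *: jpow mul e x i.
  rewrite (@jhorner_widen _ _ _ _ _ _ r) ?size_poly//; apply: eq_bigr => i _.
  by rewrite coef_poly ltn_ord valK.
have cE j : (u *m power_matrix x) 0 j = coord vb j (jhorner mul e q x).
  rewrite qx linear_sum mxE; apply: eq_bigr => i _.
  by rewrite linearZ /= mxE.
apply/eqP/eqP => [/rowP h|h]; last by apply/rowP => j; rewrite cE h linear0 mxE.
rewrite [LHS](coord_vbasis (memvf _)) big1// => j _.
by rewrite -cE h mxE scale0r.
Qed.

(** Regularity is linear independence of e, x, ..., x^(r-1): a dependence is a nonzero polynomial of
    degree below r that annihilates [x]. *)
Lemma regular_power_matrix x : regular x <-> row_free (power_matrix x).
Proof.
split=> [[p px pr]|xf].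
  rewrite -kermx_eq0; apply/rowV0P => u /sub_kermxP/eqP.
  rewrite power_matrix_mul => /eqP q0.
  have [pm _ pmin] := px.
  set q := \poly_(i < r) _ in q0.
  have : q == 0.
    apply: contraT => qn0; have := pmin _ qn0 q0.
    rewrite leqNgt => /negP[]; apply: (leq_ltn_trans (size_poly _ _)).
    by rewrite -pr prednK// size_poly_gt0 monic_neq0.
  move=> /eqP qE; apply/rowP => i; rewrite mxE.
  by move/polyP/(_ i): qE; rewrite coef_poly ltn_ord valK coef0.
have [p px] := exists_minpoly mul e x; exists p => //.
have [rmax _] := hr; apply/eqP; rewrite eqn_leq (rmax _ _ px) leqNgt /=.
apply/negP => pr.
have spr : (size p <= r)%N by rewrite (leq_trans (leqSpred _)).
have pn0 := minpoly_neq0 px.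
have [_ p0 _] := px.
have := kermx_eq0 (power_matrix x); rewrite xf => /rowV0P/(_ (\row_(i < r) p`_i)) H.
have : \row_(i < r) p`_i = 0.
  apply: H; apply/sub_kermxP/eqP; rewrite power_matrix_mul.
  rewrite [X in jhorner _ _ X](_ : _ = p) ?p0//.
  apply/polyP => i; rewrite coef_poly; case: insubP => [i' _ <-|].
    by rewrite mxE ltn_ord.
  by rewrite -leqNgt => ri; rewrite ltnNge ri /= nth_default// (leq_trans spr).
move=> /rowP pi0; move/eqP: pn0; apply; apply/polyP => i; rewrite coef0.
have [ir|ri] := ltnP i r.
  by have := pi0 (Ordinal ir); rewrite !mxE.
by rewrite nth_default// (leq_trans spr).
Qed.

Lemma regular_generic x w : regular x -> exists2 D : {poly R}, D != 0 &
  forall t, D.[t] != 0 -> regular (x + t *: w).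
Proof.
move=> /regular_power_matrix xf.
pose B := pinvmx (power_matrix x).
have xB : power_matrix x *m B = 1%:M.
  by rewrite /B -{1}[power_matrix x]mul1mx mulmxKp.
have PP (i : 'I_r) (j : 'I_(\dim {:V})) : {h : {poly R} |
    forall t, coord vb j (jpow mul e (x + t *: w) i) = h.[t]}.
  exact/cid/line_poly_jpow.
pose P := \matrix_(i < r, j < \dim {:V}) sval (PP i j).
(* [B] is a right inverse of the power matrix at t = 0, so this polynomial in t equals 1 at t = 0
   and its nonvanishing forces independence of the powers. *)
pose D := \det (P *m map_mx (@polyC R) B).
have DE t : D.[t] = \det (power_matrix (x + t *: w) *m B).
  rewrite /D -horner_evalE -det_map_mx map_mxM; congr (\det (_ *m _)).
    by apply/matrixP => i j; rewrite !mxE /= horner_evalE; case: (PP i j) => h /= ->.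
  by apply/matrixP => i j; rewrite !mxE /= horner_evalE hornerC.
exists D.
  apply: contraTneq isT => D0; have := DE 0.
  by rewrite D0 horner0 scale0r addr0 xB det1 => /eqP; rewrite eq_sym oner_eq0.
move=> t; rewrite DE => dn0; apply/regular_power_matrix.
have U : power_matrix (x + t *: w) *m B \in unitmx by rewrite unitmxE unitfE.
rewrite -kermx_eq0; apply/rowV0P => u /sub_kermxP u0.
by rewrite -(mulmxK U u) mulmxA u0 !mul0mx.
Qed.

(** On the line from a regular element to [y] the two functions are polynomials that agree off the
    zeros of a nonzero polynomial, hence everywhere. *)
Lemma regular_dense f g : line_poly f -> line_poly g ->
  (forall x, regular x -> f x = g x) -> f =1 g.
Proof.
move=> fp gp fg y; have [_ [x [p [px pr]]]] := hr.
have xr : regular x by exists p.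
have [D D0 DP] := regular_generic (y - x) xr.
have [h hE] := fp x (y - x); have [k kE] := gp x (y - x).
have hk : h = k.
  by apply: (poly_eq_horner_generic D0) => t /DP/fg; rewrite hE kE.
by have := hE 1; rewrite hk -kE scale1r addrC subrK.
Qed.

End RegularElements.

(** * Trace and determinant in terms of eigenvalues; invariance under reflections *)

Section TraceDeterminant.
Context (R : realType) (V : vectType R) (mul : V -> V -> V) (e : V).
Hypothesis EJA : euclidean_jordan_algebra mul e.
Local Notation "x ** y" := (mul x y) (at level 40, left associativity).
Let jC := jC EJA.
Let jE := jE EJA.
Variables (r : nat) (tr det : V -> R).
Hypothesis hr : jordan_rank mul e r.
Hypothesis htr : jordan_trace mul e r tr.
Hypothesis hdet : jordan_det mul e r det.
Hypothesis r_gt0 : (0 < r)%N.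

Let tr_line : line_poly tr. Proof. by apply: polynomial_fun_line; have [] := htr. Qed.
Let det_line : line_poly det. Proof. by apply: polynomial_fun_line; have [] := hdet. Qed.

Lemma tr_system_inj (c : 'I_r -> V) z : idempotent_system mul e c -> injective z ->
  tr (\sum_i z i *: c i) = \sum_i z i.
Proof.
move=> cP zI; have [_ trE] := htr.
rewrite (trE _ _ (minpoly_idem_system EJA cP zI)) ?size_minpoly_idem_system//.
rewrite -(big_map z xpredT (fun y => 'X - y%:P)).
have sz : size (map z (index_enum 'I_r)) = r.
  by rewrite size_map /index_enum -enumT size_enum_ord.
rewrite -[in X in _`_X]sz coefPn_prod_XsubC ?sz ?lt0n_neq0// opprK big_map//.
Qed.

Lemma det_system_inj (c : 'I_r -> V) z : idempotent_system mul e c -> injective z ->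
  det (\sum_i z i *: c i) = \prod_i z i.
Proof.
move=> cP zI; have [_ detE] := hdet.
rewrite (detE _ _ (minpoly_idem_system EJA cP zI)) ?size_minpoly_idem_system//.
rewrite -(big_map z xpredT (fun y => 'X - y%:P)) coef0_prod_XsubC.
have sz : size (index_enum 'I_r) = r by rewrite /index_enum -enumT size_enum_ord.
rewrite size_map sz big_map.
by rewrite mulrA -expr2 sqrr_sign mul1r.
Qed.

Lemma exists_regular_system : exists c : 'I_r -> V, idempotent_system mul e c.
Proof.
have [_ [x [p [px pr]]]] := hr.
have xr : regular mul e r x by exists p.
by have [z [c [cP _ _]]] := regular_system EJA xr; exists c.
Qed.

(* A polynomial identity in the eigenvalues need only be checked when they are
   distinct. *)
Lemma system_ext (c : 'I_r -> V) (f : V -> R) (G : ('I_r -> R) -> R) :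
  line_poly f ->
  (forall z w, exists h : {poly R}, forall t, G (fun i => z i + t * w i) = h.[t]) ->
  (forall z, injective z -> f (\sum_i z i *: c i) = G z) ->
  forall z, f (\sum_i z i *: c i) = G z.
Proof.
move=> fp Gp fG z; pose w (i : 'I_r) : R := (i : nat)%:R.
have [h hE] := fp (\sum_i z i *: c i) (\sum_i w i *: c i).
have [k kE] := Gp z w.
pose D : {poly R} := \prod_(ij : 'I_r * 'I_r | ij.1 != ij.2)
  ((z ij.1 - z ij.2)%:P + (w ij.1 - w ij.2)%:P * 'X).
have D0 : D != 0.
  apply/prodf_neq0 => -[i j] /= ij; apply/eqP => /polyP/(_ 1%N).
  rewrite coefD coefC coefCM coefX /= add0r mulr1 coef0 => /eqP.
  by rewrite subr_eq0 /w eqr_nat (inj_eq val_inj) (negbTE ij).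
have hk : h = k.
  apply: (poly_eq_horner_generic D0) => t Dt; rewrite -hE -kE.
  rewrite scaler_sumr -big_split /=.
  under eq_bigr do rewrite scalerA -scalerDl.
  apply: fG => i j zij; apply/eqP; apply: contraNT Dt => ij.
  rewrite horner_prod (bigD1 (i, j))//= !hornerE.
  have -> : z i - z j + (w i - w j) * t = 0 by lra.
  by rewrite mul0r.
have := hE 0; rewrite scale0r addr0 => ->; rewrite hk -kE.
have [l lE] := Gp z (fun=> 0).
have := lE 0; have := kE 0.
have -> : (fun i => z i + 0 * w i) = z by apply/funext => i; rewrite mul0r addr0.
by [].
Qed.

Lemma tr_scale a x : tr (a *: x) = a * tr x.
Proof.
have h1 b : b != 0 -> forall y, tr (b *: y) = b * tr y.
  move=> b0; apply: (regular_dense EJA hr).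
  - move=> u w; have [h hE] := tr_line (b *: u) (b *: w).
    by exists h => t; rewrite -hE scalerDr !scalerA mulrC.
  - by apply: line_polyM => //; exact: line_poly_cst.
  move=> y /(regular_system EJA)[z [c [cP zI ->]]].
  rewrite tr_system_inj// scaler_sumr.
  under eq_bigr do rewrite scalerA.
  by rewrite tr_system_inj ?mulr_sumr// => i j /(mulfI b0)/zI.
have [h hE] := tr_line 0 x.
have hX : h = (tr x)%:P * 'X.
  apply: (poly_eq_horner_generic (D := 'X)); first by rewrite polyX_eq0.
  by move=> t; rewrite hornerX => t0; rewrite -hE add0r h1// !hornerE mulrC.
by rewrite -[a *: x]add0r hE hX !hornerE mulrC.
Qed.

(** A polynomial function that is homogeneous of degree 1 equals its own differential at 0. *)
Lemma tr_linear : linfunctional tr.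
Proof.
have [[q qE] _] := htr.
have trE x : tr x = peval (vbasis {:V}) (pderiv (vbasis {:V}) x q) 0.
  have {1}-> : (0 : V) = 0 + 0 *: x by rewrite scale0r addr0.
  rewrite -horner_pline -deriv_pline.
  have -> : pline (vbasis {:V}) q 0 x = (tr x)%:P * 'X.
    apply/eqP; rewrite -subr_eq0; apply/eqP/poly_eq0_horner => t.
    rewrite !hornerE horner_pline -[peval _ _ _]qE add0r tr_scale mulrC subrr//.
  by rewrite deriv_mulC derivX mulr1 hornerC.
by move=> a x y; rewrite !trE pderiv_linear pevalD pevalZ.
Qed.
Let trL := linfunctionalE tr_linear.

Lemma tr_system (c : 'I_r -> V) z : idempotent_system mul e c ->
  tr (\sum_i z i *: c i) = \sum_i z i.
Proof.
move=> cP; apply: (@system_ext c tr (fun z => \sum_i z i)) => // [{}z w|z']; last exact: tr_system_inj.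
exists (\sum_i ((z i)%:P + (w i)%:P * 'X)) => t.
by rewrite horner_sum; apply: eq_bigr => i _; rewrite !hornerE mulrC.
Qed.

Lemma det_system (c : 'I_r -> V) z : idempotent_system mul e c ->
  det (\sum_i z i *: c i) = \prod_i z i.
Proof.
move=> cP; apply: (@system_ext c det (fun z => \prod_i z i)) => // [{}z w|z']; last exact: det_system_inj.
exists (\prod_i ((z i)%:P + (w i)%:P * 'X)) => t.
by rewrite horner_prod; apply: eq_bigr => i _; rewrite !hornerE mulrC.
Qed.

Lemma det1 : det e = 1.
Proof.
have [c cP] := exists_regular_system; have [_ _ ce] := cP.
have -> : e = \sum_i 1 *: c i by rewrite -ce; apply: eq_bigr => i _; rewrite scale1r.
by rewrite det_system// big1.
Qed.

Lemma det_scale a x : det (a *: x) = a ^+ r * det x.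
Proof.
apply: (regular_dense EJA hr (f := fun x => det (a *: x)) (g := fun x => a ^+ r * det x)).
- move=> u w; have [h hE] := det_line (a *: u) (a *: w).
  by exists h => t; rewrite -hE scalerDr !scalerA mulrC.
- by apply: line_polyM => //; exact: line_poly_cst.
move=> y /(regular_system EJA)[z [c [cP zI ->]]].
have -> : a *: (\sum_i z i *: c i) = \sum_i (a * z i) *: c i.
  by rewrite scaler_sumr; apply: eq_bigr => i _; rewrite scalerA.
by rewrite !det_system// big_split prodr_const card_ord.
Qed.

Section Reflection.
Variable c : V.
Hypothesis cI : c ** c = c.
Local Notation S := (peirce_refl mul c).

(** An automorphism preserves minimal polynomials, hence the determinant of regular elements, which
    are dense. *)
Lemma det_refl x : det (S x) = det x.
Proof.
apply: (regular_dense EJA hr (f := det \o S) (g := det)) => //.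
  by apply: line_poly_comp => // a u v; exact: (peirce_reflP EJA).
move=> y [p px pr]; have [_ detE] := hdet.
by rewrite /= (detE _ _ px pr) (detE _ _ (is_minpoly_refl EJA cI px) pr).
Qed.

Lemma tr_refl x : tr (S x) = tr x.
Proof.
apply: (regular_dense EJA hr (f := tr \o S) (g := tr)) => //.
  by apply: line_poly_comp => // a u v; exact: (peirce_reflP EJA).
move=> y [p px pr]; have [_ trE] := htr.
by rewrite /= (trE _ _ px pr) (trE _ _ (is_minpoly_refl EJA cI px) pr).
Qed.

Lemma tr_peirce_half x : c ** x = 2^-1 *: x -> tr x = 0.
Proof.
move=> xh; have := tr_refl x; rewrite (peirce_refl_half EJA)// trL; lra.
Qed.

End Reflection.

(** Split both arguments into even and half components. Mixed products lie in V_(1/2)(c), where the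
    trace vanishes because the reflection changes the sign; on even elements L(c) commutes with
    multiplication, and on V_(1/2)(c) it is a scalar. *)
Lemma tr_idem_sym c y z : c ** c = c -> tr ((c ** y) ** z) = tr (y ** (c ** z)).
Proof.
move=> cI.
have [y0 [y1 [-> ye yh]]] := peirce_decomposition EJA cI y.
have [z0 [z1 [-> ze zh]]] := peirce_decomposition EJA cI z.
have cye : peirce_even mul c (c ** y0) by rewrite /peirce_even ye.
have cze : peirce_even mul c (c ** z0) by rewrite /peirce_even ze.
have t1 := tr_peirce_half cI (peirce_even_half EJA cI ye zh).
have t2 := tr_peirce_half cI (peirce_even_half EJA cI cye zh).
have t3 := tr_peirce_half cI (peirce_even_half EJA cI ze yh).
have t4 := tr_peirce_half cI (peirce_even_half EJA cI cze yh).
rewrite !jE yh zh !jE !trL.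
rewrite (jC y1 z0) (jC y1 (c ** z0)) t1 t2 t3 t4.
have -> : c ** y0 ** z0 = y0 ** (c ** z0).
  by rewrite -(peirce_even_comm EJA cI _ ye) (jC y0) (peirce_even_comm EJA cI _ ze) jC.
by lra.
Qed.

(** Every spectral idempotent of [z] with nonzero eigenvalue lies in V_1(c_i). If one of them
    differed from [c i], it would split [c i] in two and give r + 1 orthogonal idempotents, more
    than the rank allows. *)
Lemma system_primitive (c : 'I_r -> V) i z : idempotent_system mul e c ->
  c i ** z = z -> exists a, z = a *: c i.
Proof.
move=> cP cz; have [m [zeta [d [dP zI zE]]]] := spectral_decomposition EJA z.
have ci := idem_system_idem cP i.
have zev : peirce_even mul (c i) z by rewrite /peirce_even !cz.
have [ell ellE] := lagrange_basis zI.
have dpow k : c i ** jpow mul e z k.+1 = jpow mul e z k.+1.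
  elim: k => [|k IH]; first by rewrite /= (j1r EJA) cz.
  by rewrite /jpow iterS -/(jpow _ _ _ _) (peirce_even_comm EJA ci _ zev) IH.
have dc j : zeta j != 0 -> c i ** d j = d j.
  move=> zj.
  (* For a nonzero eigenvalue the idempotent is a polynomial in [z] without constant term, and [c i]
     fixes all positive powers of [z]. *)
  have dE : d j = (zeta j)^-1 *: jhorner mul e ('X * ell j) z.
    rewrite zE (jhorner_idem_system EJA dP) (bigD1 j)//= big1 => [|k kj].
      by rewrite hornerM ellE eqxx hornerX mulr1 addr0 scalerA mulVf// scale1r.
    by rewrite hornerM ellE eq_sym (negbTE kj) mulr0 scale0r.
  rewrite dE jE; congr (_ *: _).
  rewrite /jhorner (j_sumr EJA); apply: eq_bigr => -[[|k] kl] _ /=.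
    by rewrite coefXM scale0r jE.
  by rewrite jE dpow.
have [/existsP[j /andP[zj dcj]]|] := boolP [exists j, (zeta j != 0) && (d j != c i)].
  have dj := dc _ zj; have djI := idem_system_idem dP j.
  have ck k : k != i -> c k ** d j = 0.
    move=> ki; apply: (orth_idem_peirce1 EJA ci _ dj).
    by rewrite (idem_system_orth cP)// eq_sym.
  (* The enlarged system: [d j] in position 0, [c i - d j] in place of [c i], the other idempotents
     unchanged. *)
  pose c' (k : 'I_r.+1) := if unlift ord0 k is Some k'
    then (if k' == i then c i - d j else c k') else d j.
  have : idempotent_system mul e c'.
    have [cn0 cc ce] := cP; have [dn0 _ _] := dP.
    split.
    - move=> k; rewrite /c'; case: unliftP => [k' _|_] //.
      by case: (eqVneq k' i) => // _; rewrite subr_eq0 eq_sym.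
    - have c'0 k : c' (lift ord0 k) ** d j = 0.
        rewrite /c' liftK; case: (eqVneq k i) => [_|ki]; last exact: ck.
        by rewrite !jE dj djI subrr.
      have c'd : c' ord0 = d j by rewrite /c' unlift_none.
      move=> k l; case: (unliftP ord0 k) => [k'|] ->; case: (unliftP ord0 l) => [l'|] ->.
      + rewrite (inj_eq lift_inj) /c' !liftK.
        have [->|ki] := eqVneq k' i; have [lE|li] := eqVneq l' i; subst.
        * by rewrite scale1r !jE ci dj (jC (d j)) dj djI subrr ?oppr0 ?addr0 ?subr0.
        * rewrite scale0r !jE (idem_system_orth cP) 1?eq_sym//.
          by rewrite (jC (d j)) ck// subr0.
        * by rewrite (negbTE ki) scale0r !jE (idem_system_orth cP)// ck// subr0.
        * exact: cc.
      + by rewrite c'd c'0 (_ : lift _ _ == _ = false) ?scale0r//; apply/negbTE; rewrite eq_sym neq_lift.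
      + by rewrite c'd jC c'0 (_ : _ == lift _ _ = false) ?scale0r//; apply/negbTE; rewrite neq_lift.
      + by rewrite eqxx scale1r c'd djI.
    - rewrite big_ord_recl {1}/c' unlift_none -ce (bigD1 i)//= [in RHS](bigD1 i)//=.
      rewrite /c' liftK eqxx addrA addrCA subrr addr0; congr (_ + _).
      by apply: eq_bigr => k ki; rewrite liftK (negbTE ki).
  by move=> c'P; have := idem_system_rank EJA c'P hr; rewrite ltnn.
rewrite negb_exists => /forallP dall.
exists (\sum_j zeta j); rewrite scaler_suml {1}zE; apply: eq_bigr => j _.
have := dall j; rewrite negb_and !negbK => /orP[/eqP->|/eqP->//].
by rewrite !scale0r.
Qed.

End TraceDeterminant.

(** * The logarithmic derivative of det and its behaviour under P(tc + e - c) *)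

Section DeterminantLaw.
Context (R : realType) (V : vectType R) (mul : V -> V -> V) (e : V).
Hypothesis EJA : euclidean_jordan_algebra mul e.
Local Notation "x ** y" := (mul x y) (at level 40, left associativity).
Let jC := jC EJA.
Let jE := jE EJA.

(* [P(tc + (e - c))], acting as [t^2], [t], [1] on the Peirce spaces
   [V_1(c)], [V_(1/2)(c)], [V_0(c)]. *)
Definition peirce_scale c t y :=
  y + (4 * t - t ^+ 2 - 3) *: (c ** y) + (2 * (1 - t) ^+ 2) *: (c ** (c ** y)).
Local Notation G := peirce_scale.

Lemma peirce_scaleP c t a x y : G c t (a *: x + y) = a *: G c t x + G c t y.
Proof. by rewrite /G !jE; apply: linfunctional_ext => f fP; rewrite !(linfunctionalE fP); ring. Qed.

Lemma peirce_scale_1 c x : G c 1 x = x.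
Proof. by rewrite /G; apply: linfunctional_ext => f fP; rewrite !(linfunctionalE fP); ring. Qed.

Lemma peirce_scaleM c s t x : c ** c = c -> G c s (G c t x) = G c (s * t) x.
Proof.
move=> cI; have K := peirce_cubic EJA cI x; have K2 := peirce_cubic EJA cI (c ** x).
rewrite /G !jE; apply: linfunctional_ext => f fP.
move: K K2 => /(congr1 f) K /(congr1 f) K2.
rewrite !(linfunctionalE fP) in K K2.
have {}K : f (c ** (c ** (c ** x))) = (3 * f (c ** (c ** x)) - f (c ** x)) / 2 by lra.
have {}K2 : f (c ** (c ** (c ** (c ** x)))) = (3 * f (c ** (c ** (c ** x))) - f (c ** (c ** x))) / 2 by lra.
by rewrite !(linfunctionalE fP) K2 K; field.
Qed.

Lemma peirce_scale_orth c t d : c ** d = 0 -> G c t d = d.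
Proof. by move=> cd; rewrite /G cd !jE !scaler0 !addr0. Qed.

Lemma peirce_scale_idem c t : c ** c = c -> G c t c = t ^+ 2 *: c.
Proof.
move=> cI; rewrite /G !cI; apply: linfunctional_ext => f fP.
by rewrite !(linfunctionalE fP); ring.
Qed.

Lemma peirce_scale_comm c d s t x : c ** c = c -> c ** d = 0 ->
  G c s (G d t x) = G d t (G c s x).
Proof.
move=> cI cd; have K y := orth_idem_comm EJA cI cd y.
rewrite /G !jE !K.
by apply: linfunctional_ext => f fP; rewrite !(linfunctionalE fP); ring.
Qed.

Variables (r : nat) (tr det : V -> R).
Hypothesis hr : jordan_rank mul e r.
Hypothesis htr : jordan_trace mul e r tr.
Hypothesis hdet : jordan_det mul e r det.
Hypothesis r_gt0 : (0 < r)%N.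
Let trL := linfunctionalE (tr_linear EJA hr htr r_gt0).
Let trP := (tr_linear EJA hr htr r_gt0).

Section Differential.
Variable q : mpoly.mpoly (\dim {:V}) R.
Local Notation vb := (vbasis {:V}).
Hypothesis qE : forall x, det x = peval vb q x.

Local Notation dd x z := (peval vb (pderiv vb z q) x).

Lemma ddet_line x z (h : {poly R}) : (forall t, det (x + t *: z) = h.[t]) ->
  dd x z = h^`().[0].
Proof.
move=> hE; have -> : h = pline vb q x z.
  apply/eqP; rewrite -subr_eq0; apply/eqP/poly_eq0_horner => t.
  by rewrite !hornerE horner_pline -qE hE subrr.
by rewrite deriv_pline horner_pline scale0r addr0.
Qed.

Lemma ddet_linear x : linfunctional (fun z => dd x z).
Proof. by move=> a u v; rewrite pderiv_linear pevalD pevalZ. Qed.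

Lemma ddet_refl c x w : c ** c = c ->
  dd (peirce_refl mul c x) (peirce_refl mul c w) = dd x w.
Proof.
move=> cI; rewrite [RHS](@ddet_line _ _ (pline vb q x w)); last first.
  by move=> t; rewrite horner_pline qE.
apply: ddet_line => t; rewrite horner_pline -qE -[RHS](det_refl EJA hr hdet cI).
by rewrite addrC -(peirce_reflP EJA) addrC.
Qed.

(** On the span of the system det is the product of the eigenvalues, so the line in question gives
    the product of the z_i (1 + t y_i), whose derivative at t = 0 is read off. *)
Lemma ddet_system (c : 'I_r -> V) z y : idempotent_system mul e c ->
  dd (\sum_i z i *: c i) ((\sum_i z i *: c i) ** (\sum_i y i *: c i)) =
  tr (\sum_i y i *: c i) * det (\sum_i z i *: c i).
Proof.
move=> cP; rewrite (idem_system_prod EJA cP).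
rewrite (tr_system EJA htr r_gt0)// (det_system EJA hdet)//.
rewrite (@ddet_line _ _ (\prod_i (z i)%:P * \prod_i (1 + (y i)%:P * 'X))); last first.
  move=> t; rewrite scaler_sumr -big_split /=.
  under eq_bigr do rewrite scalerA -scalerDl.
  rewrite (det_system EJA hdet)// hornerM !horner_prod -big_split; apply: eq_bigr => i _.
  by rewrite !hornerE /=; ring.
pose K (k : {poly R}) s := k.[0] = 1 /\ k^`().[0] = s.
have [K1 K2] : K (\prod_i (1 + (y i)%:P * 'X)) (\sum_i y i).
  elim/big_rec2: _ => [|i s k _ [k1 k2]]; first by rewrite /K hornerC -polyC1 derivC hornerC.
  by split; rewrite ?derivM ?derivD ?derivC ?deriv_mulC ?derivX ?hornerE ?k1 ?k2; lra.
rewrite -rmorph_prod derivM derivC mul0r add0r hornerM K2 hornerC.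
by rewrite mulrC.
Qed.

Lemma line_poly_ddet y : line_poly (fun x => dd x (x ** y)).
Proof.
have -> : (fun x => dd x (x ** y)) =
    (fun x => \sum_i coord vb i (x ** y) * peval vb (mpoly.mderiv i q) x).
  apply/funext => x; rewrite /pderiv peval_sum; apply: eq_bigr => i _.
  by rewrite pevalZ.
apply: line_poly_sum => i; apply: line_polyM.
  by apply: line_poly_linear => a u v; rewrite !jE linearP.
by move=> u w; exists (pline vb (mpoly.mderiv i q) u w) => t; rewrite horner_pline.
Qed.

(* [grad det x = det x * x^-1] *)
Lemma ddet_mul x y : dd x (x ** y) = tr y * det x.
Proof.
pose f x := dd x (x ** y); pose g x := tr y * det x.
apply: (regular_dense EJA hr (f := f) (g := g)).
- exact: line_poly_ddet.
- apply: line_polyM; first exact: line_poly_cst.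
  by apply: polynomial_fun_line; have [] := hdet.
rewrite {}/f {}/g => {}x /(regular_system EJA)[z [c [cP zI xE]]].
pose l y := dd x (x ** y) - tr y * det x.
have lP : linfunctional l.
  move=> a u v; rewrite /l !jE (ddet_linear x) trP; ring.
suff l0 u : l u = 0 by apply/eqP; rewrite -subr_eq0 -/(l y) l0.
have cI i := idem_system_idem cP i.
have cx i : c i ** x = z i *: c i by rewrite jC xE (idem_system_mul EJA cP).
have xev i : peirce_even mul (c i) x by rewrite /peirce_even cx jE cI.
(* The defect [l] is linear in y. The reflection at [c i] fixes [x] and preserves products, det and
   tr, so it preserves [l], which therefore kills V_(1/2)(c_i). *)
have lS i v : l (peirce_refl mul (c i) v) = l v.
  rewrite /l (tr_refl EJA hr htr (cI i)); congr (_ - _).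
  rewrite -(ddet_refl _ _ (cI i)) (peirce_refl_even (xev i)) (peirce_refl_mul EJA (cI i)).
  by rewrite (peirce_refl_even (xev i)) (peirce_reflK EJA (cI i)).
have lH i v : l (v - peirce_half mul (c i) v) = l v.
  have := lS i v; rewrite /peirce_refl !(linfunctionalE lP); lra.
(* Removing the half components for all [c i] in turn leaves an element that is even for every
   [c i], hence by [system_primitive] a combination of the [c i], where [ddet_system] applies. *)
pose E s v := foldr (fun i v => v - peirce_half mul (c i) v) v s.
have lE s v : l (E s v) = l v by elim: s => //= i s IH; rewrite lH.
have Eev s v i : i \in s -> peirce_even mul (c i) (E s v).
  elim: s => //= j s IH; rewrite inE; have [->|ij] /= := eqVneq i j.
    by move=> _; exact: (peirce_evenB EJA).
  move=> /IH; rewrite /peirce_even /peirce_half; set w := E s v => wev.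
  have K y' := orth_idem_comm EJA (cI i) (idem_system_orth cP ij) y'.
  by rewrite !jE !K wev.
rewrite -(lE (enum 'I_r)); set w := E _ _.
have wev i : peirce_even mul (c i) w by apply: Eev; rewrite mem_enum.
have [_ _ ce] := cP.
have wE : w = \sum_i c i ** w by rewrite -(j_suml EJA) ce (j1l EJA).
have /choice[y' y'E] i : exists a, c i ** w = a *: c i.
  exact: (system_primitive EJA hr cP (wev i)).
have -> : w = \sum_i y' i *: c i by rewrite wE; apply: eq_bigr.
by rewrite /l xE ddet_system// subrr.
Qed.

End Differential.

(** The polynomial phi(t) = det(G c t x) satisfies t phi' = 2 tr(c) phi by [ddet_mul], because t
    times the derivative of G c t x in t is its product with 2c. So phi is a monomial of degree 2
    tr(c); the case x = e, where phi(1) = 1, shows that 2 tr(c) is a natural number. *)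
Lemma det_peirce_scale c : c ** c = c ->
  exists2 k : nat, 2 * tr c = k%:R & forall t x, det (G c t x) = t ^+ k * det x.
Proof.
move=> cI; have [[q qE] _] := hdet.
pose vb := vbasis {:V}.
pose g x i : {poly R} := (coord vb i x)%:P
  + (coord vb i (c ** x))%:P * (4%:R%:P * 'X - 'X^2 - 3%:R%:P)
  + (coord vb i (c ** (c ** x)))%:P * (2%:R%:P * (1 - 'X) ^+ 2).
pose phi x := mpoly.mmap (@polyC R) (g x) q.
have gE x t i : (g x i).[t] = coord vb i (G c t x).
  by rewrite /g /G !hornerE !linearD !linearZ /=; ring.
have phiE x t : (phi x).[t] = det (G c t x).
  by rewrite /phi horner_mmap qE; apply: mpoly.meval_eq => i; rewrite gE.
have tg x t i : t * (g x i)^`().[t] = coord vb i (G c t x ** (2 *: c)).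
  have K := peirce_cubic EJA cI x.
  rewrite jC jE /G !jE.
  have {}K : coord vb i (c ** (c ** (c ** x))) =
     (3 * coord vb i (c ** (c ** x)) - coord vb i (c ** x)) / 2.
    have := congr1 (coord vb i) K; rewrite linearD linearN !linearZ /=; lra.
  rewrite !(linfunctionalE (@linfunctional_coord _ _ _ vb i)) K /g.
  rewrite !(derivD, derivM, derivC, derivN, derivX, derivXn, deriv_exp, derivB) !hornerE /=.
  by field.
have ode x t : t * (phi x)^`().[t] = 2 * tr c * (phi x).[t].
  rewrite phiE; have := ddet_mul qE (G c t x) (2 *: c); rewrite trL => <-.
  rewrite /phi deriv_mmap horner_sum mulr_sumr /pderiv peval_sum; apply: eq_bigr => i _.
  rewrite hornerM pevalZ mulrCA tg mulrC horner_mmap; congr (_ * _).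
  by apply: mpoly.meval_eq => j; rewrite gE.
have coefE x k : (k%:R - 2 * tr c) * (phi x)`_k = 0.
  have : 'X * (phi x)^`() - (2 * tr c)%:P * phi x = 0.
    by apply: poly_eq0_horner => t; rewrite !hornerE ode subrr.
  move=> /polyP/(_ k); rewrite coefB coefXM coefCM coef0 coef_deriv.
  case: k => [|k] /= H; first by move: H; rewrite !sub0r mulNr.
  by move: H; rewrite mulrBl (mulr_natl _ k.+1).
have [k kE] : exists k : nat, 2 * tr c = k%:R.
  apply: contrapT => /forallNP nk.
  have phi0 : phi e = 0.
    apply/polyP => k; rewrite coef0; have /eqP := coefE e k.
    rewrite mulf_eq0 => /orP[|/eqP//]; rewrite subr_eq0 => /eqP/esym kE.
    by have := nk k.
  have := phiE e 1; rewrite phi0 horner0 peirce_scale_1 (det1 EJA hr hdet) => /eqP.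
  by rewrite eq_sym oner_eq0.
exists k => // t x.
have phiX : phi x = (phi x)`_k *: 'X^k.
  apply/polyP => j; rewrite coefZ coefXn; have /eqP := coefE x j.
  rewrite kE mulf_eq0 subr_eq0 eqr_nat; have [->|_ /= /eqP->] := eqVneq j k.
    by rewrite mulr1.
  by rewrite mulr0.
have phiH s : (phi x).[s] = s ^+ k * (phi x)`_k.
  by rewrite {1}phiX hornerZ hornerXn mulrC.
have := phiE x 1; rewrite peirce_scale_1 phiH expr1n mul1r => <-.
by rewrite -phiE phiH.
Qed.

End DeterminantLaw.

(** * Positivity of the trace form and description of the symmetric cone *)

Section Cone.
Context (R : realType) (V : vectType R) (mul : V -> V -> V) (e : V).
Hypothesis EJA : euclidean_jordan_algebra mul e.
Local Notation "x ** y" := (mul x y) (at level 40, left associativity).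
Let jC := jC EJA.
Let jE := jE EJA.
Variables (r : nat) (tr det : V -> R).
Hypothesis hr : jordan_rank mul e r.
Hypothesis htr : jordan_trace mul e r tr.
Hypothesis hdet : jordan_det mul e r det.
Hypothesis r_gt0 : (0 < r)%N.
Variables (n : nat) (b : n.-tuple V).
Hypothesis hb : orthonormal_basis mul tr b.
Let trP := tr_linear EJA hr htr r_gt0.
Let trL := linfunctionalE trP.
Local Notation ip := (jinner mul tr).
Local Notation G := (peirce_scale mul).

Lemma ipC x y : ip x y = ip y x. Proof. by rewrite /jinner jC. Qed.
Lemma ipDl x y z : ip (x + y) z = ip x z + ip y z.
Proof. by rewrite /jinner jE trL. Qed.
Lemma ipZl a x z : ip (a *: x) z = a * ip x z.
Proof. by rewrite /jinner jE trL. Qed.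
Lemma ipNl x z : ip (- x) z = - ip x z.
Proof. by rewrite /jinner jE trL. Qed.
Lemma ip0l z : ip 0 z = 0.
Proof. by rewrite /jinner jE trL. Qed.
Lemma ipDr x y z : ip z (x + y) = ip z x + ip z y.
Proof. by rewrite /jinner jE trL. Qed.
Lemma ipZr a x z : ip z (a *: x) = a * ip z x.
Proof. by rewrite /jinner jE trL. Qed.
Lemma ipNr x z : ip z (- x) = - ip z x.
Proof. by rewrite /jinner jE trL. Qed.
Lemma ip0r z : ip z 0 = 0.
Proof. by rewrite /jinner jE trL. Qed.
Definition ipE := (ipDl, ipDr, ipNl, ipNr, ipZl, ipZr, ip0l, ip0r).

Lemma ip_suml I (s : seq I) (P : pred I) (F : I -> V) z :
  ip (\sum_(i <- s | P i) F i) z = \sum_(i <- s | P i) ip (F i) z.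
Proof. by apply: (big_morph (ip^~ z)) => [x y|]; rewrite ipE. Qed.

Lemma ip_coord x i : ip x (tnth b i) = coord b i x.
Proof.
have [bb bo] := hb.
rewrite {1}(coord_basis bb (memvf x)) ip_suml (bigD1 i)//= big1 => [|j ji].
  by rewrite -tnth_nth ipE bo eqxx mulr1 addr0.
by rewrite -tnth_nth ipE bo (negbTE ji) mulr0.
Qed.

Lemma ip_norm x : ip x x = \sum_i coord b i x ^+ 2.
Proof.
have [bb bo] := hb.
rewrite {1}(coord_basis bb (memvf x)) ip_suml; apply: eq_bigr => i _.
by rewrite -tnth_nth ipE ipC ip_coord expr2.
Qed.

Lemma ip_ge0 x : 0 <= ip x x.
Proof. by rewrite ip_norm; apply: sumr_ge0 => i _; exact: sqr_ge0. Qed.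

Lemma ip_gt0 x : x != 0 -> 0 < ip x x.
Proof.
move=> x0; rewrite lt_def ip_ge0 andbT; apply: contra_neq x0 => /eqP.
have [bb _] := hb.
rewrite ip_norm psumr_eq0 => [/allP xi|i _]; last exact: sqr_ge0.
rewrite (coord_basis bb (memvf x)) big1// => i _.
have := xi i (mem_index_enum _); rewrite /= expf_eq0 /= => /eqP->.
by rewrite scale0r.
Qed.

Lemma coord_sqr_le x i : coord b i x ^+ 2 <= ip x x.
Proof. by rewrite ip_norm (bigD1 i)//= lerDl sumr_ge0// => j _; exact: sqr_ge0. Qed.

(** Linear in [x], so the spectral decomposition reduces it to idempotents, which is
    [tr_idem_sym]. *)
Lemma ip_mul x y z : ip (x ** y) z = ip y (x ** z).
Proof.
have [m [zeta [c [cP _ ->]]]] := spectral_decomposition EJA x.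
rewrite !(j_suml EJA) ip_suml [in RHS]ipC ip_suml; apply: eq_bigr => i _.
rewrite !jE !ipE; congr (_ * _).
by rewrite /jinner (tr_idem_sym EJA hr htr r_gt0 _ _ (idem_system_idem cP i)) jC.
Qed.

Lemma ip_square c y : ip c (y ** y) = ip (c ** y) y.
Proof. by rewrite ipC ip_mul ipC jC. Qed.

Section Idempotent.
Variable c : V.
Hypothesis cI : c ** c = c.

(** On the eigenvalues 0, 1/2, 1 of L(c) one has s = s^2 + 4 (s - s^2)^2. This exhibits L(c) as a
    sum of squares of symmetric operators, hence as positive semidefinite. *)
Lemma ip_idem_mul y :
  ip (c ** y) y = ip (c ** y) (c ** y) + 4 * ip (c ** y - c ** (c ** y)) (c ** y - c ** (c ** y)).
Proof.
have K1 := peirce_cubic EJA cI y; have K2 := peirce_cubic EJA cI (c ** y).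
pose f z := ip z y.
have fP : linfunctional f by move=> a u v; rewrite /f !ipE.
move: K1 K2 => /(congr1 f) K1 /(congr1 f) K2.
rewrite !(linfunctionalE fP) /f in K1 K2.
have S u v : ip u (c ** v) = ip (c ** u) v by rewrite ip_mul.
by rewrite !ipE !S; lra.
Qed.

Lemma ip_idem_ge0 y : 0 <= ip c (y ** y).
Proof.
rewrite ip_square ip_idem_mul; have := ip_ge0 (c ** y).
have := ip_ge0 (c ** y - c ** (c ** y)); lra.
Qed.

Lemma ip_idem_le y : ip (c ** y) (c ** y) <= ip y y.
Proof.
have H1 := ip_idem_mul y; have H2 := ip_ge0 (c ** y - c ** (c ** y)).
by have := ip_ge0 (c ** y - y); rewrite !ipE (ipC y (c ** y)); lra.
Qed.

(** (c, c) = tr c is positive and 2 tr c is a natural number. *)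
Lemma ip_idem_lb : c != 0 -> 1 / 2 <= ip c c.
Proof.
move=> c0; have [k kE _] := det_peirce_scale EJA hr htr hdet r_gt0 cI.
have := ip_gt0 c0; rewrite /jinner cI => trc.
have : (0 : R) < k%:R by rewrite -kE; lra.
rewrite ltr0n => k0; have : (1 : R) <= k%:R by rewrite ler1n.
rewrite -kE; lra.
Qed.

Lemma ip_peirce_scale t x y : ip (G c t x) y = ip x (G c t y).
Proof. by rewrite /peirce_scale !ipE !ip_mul. Qed.

(** A crude bound: L(c) is a contraction, the squares of the two coefficients are at most 81 and 4,
    and 258 = 3 (1 + 81 + 4). *)
Lemma ip_peirce_scale_le t y : 0 <= t <= 2 -> ip (G c t y) (G c t y) <= 258 * ip y y.
Proof.
move=> /andP[t0 t2]; rewrite /peirce_scale.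
set A := 4 * t - t ^+ 2 - 3; set B := 2 * (1 - t) ^+ 2.
have A81 : A ^+ 2 <= 81 by rewrite /A; nra.
have B4 : B ^+ 2 <= 4.
  have h1 : 0 <= (1 - t) ^+ 2 by exact: sqr_ge0.
  have h2 : (1 - t) ^+ 2 <= 1.
    by have := mulr_ge0 t0 (_ : 0 <= 2 - t); rewrite subr_ge0 => /(_ t2); lra.
  by rewrite /B exprMn; move: ((1 - t) ^+ 2) h1 h2 => s h1 h2; nra.
have sq3 x1 x2 x3 : ip (x1 + x2 + x3) (x1 + x2 + x3) <= 3 * (ip x1 x1 + ip x2 x2 + ip x3 x3).
  have H1 := ip_ge0 (x1 - x2); have H2 := ip_ge0 (x1 - x3); have H3 := ip_ge0 (x2 - x3).
  move: H1 H2 H3; rewrite !ipE (ipC x2 x1) (ipC x3 x1) (ipC x3 x2); lra.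
apply: (le_trans (sq3 _ _ _)); rewrite !ipE.
have N1 := ip_idem_le y; have N2 := ip_idem_le (c ** y).
have N0 := ip_ge0 y; have M1 := ip_ge0 (c ** y); have M2 := ip_ge0 (c ** (c ** y)).
have E1 : A * (A * ip (c ** y) (c ** y)) <= 81 * ip y y.
  by rewrite mulrA -expr2; apply: ler_pM => //; exact: sqr_ge0.
have E2 : B * (B * ip (c ** (c ** y)) (c ** (c ** y))) <= 4 * ip y y.
  by rewrite mulrA -expr2; apply: ler_pM => //; [exact: sqr_ge0|exact: le_trans N2 N1].
lra.
Qed.

End Idempotent.

(** The dual cone of the squares; the symmetric cone will be its part with nonzero determinant. *)
Definition psd x := forall y, 0 <= ip x (y ** y).

Section System.
Variables (m : nat) (c : 'I_m -> V).
Hypothesis cP : idempotent_system mul e c.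
Let cI i := idem_system_idem cP i.

Lemma psd_system z : (forall i, 0 <= z i) -> psd (\sum_i z i *: c i).
Proof.
move=> z0 y; rewrite ip_suml; apply: sumr_ge0 => i _.
by rewrite ipE mulr_ge0// ip_idem_ge0.
Qed.

Lemma system_psd z i : psd (\sum_i z i *: c i) -> 0 <= z i.
Proof.
move=> /(_ (c i)); rewrite ip_square (idem_system_mul EJA cP) ipE.
by rewrite pmulr_lge0// ip_gt0//; have [] := cP.
Qed.

(** The quadratic representation P(a_1 c_1 + ... + a_m c_m), written as a product of commuting
    factors P(a_i c_i + e - c_i). *)
Definition system_scale (a : 'I_m -> R) y :=
  foldr (fun i y => G (c i) (a i) y) y (enum 'I_m).
Local Notation M := system_scale.

Lemma system_scaleP a u x y : M a (u *: x + y) = u *: M a x + M a y.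
Proof. by rewrite /M; elim: (enum _) => //= i s ->; rewrite (peirce_scaleP EJA). Qed.

Let scale_through i t a s y : i \notin s ->
  foldr (fun j y => G (c j) (a j) y) (G (c i) t y) s =
  G (c i) t (foldr (fun j y => G (c j) (a j) y) y s).
Proof.
elim: s => //= j s IH; rewrite inE negb_or => /andP[ij /IH ->].
by rewrite (peirce_scale_comm EJA)// (idem_system_orth cP)// eq_sym.
Qed.

Lemma system_scale_mul a a' y : M a (M a' y) = M (fun i => a i * a' i) y.
Proof.
rewrite /M; have : uniq (enum 'I_m) by rewrite enum_uniq.
elim: (enum _) => //= i s IH /andP[si us]; rewrite -IH//.
by rewrite -(peirce_scaleM EJA)// scale_through.
Qed.

Lemma system_scale_system a z :
  M a (\sum_i z i *: c i) = \sum_i (a i ^+ 2 * z i) *: c i.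
Proof.
have lin t i (s : seq 'I_m) (F : 'I_m -> V) : G (c i) t (\sum_(j <- s) F j) = \sum_(j <- s) G (c i) t (F j).
  apply: (big_morph (G (c i) t)) => [x y|].
    by rewrite -[x in LHS]scale1r (peirce_scaleP EJA) scale1r.
  by have := peirce_scaleP EJA (c i) t (-1) 0 0; rewrite scaler0 addr0 scaleN1r addNr.
have linZ t i u x : G (c i) t (u *: x) = u *: G (c i) t x.
  rewrite -[_ *: x]addr0 (peirce_scaleP EJA).
  by have := lin t i [::] (fun=> 0); rewrite !big_nil => ->; rewrite addr0.
have -> : M a (\sum_i z i *: c i) =
    \sum_i ((if i \in enum 'I_m then a i ^+ 2 else 1) * z i) *: c i.
  rewrite /M; have : uniq (enum 'I_m) by rewrite enum_uniq.
  elim: (enum _) => [_|i s IH /= /andP[si us]].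
    by apply: eq_bigr => i _; rewrite mul1r.
  rewrite IH// lin; apply: eq_bigr => j _; rewrite linZ inE.
  have [->|ji] /= := eqVneq j i.
    by rewrite (negbTE si) mul1r peirce_scale_idem// scalerA mulrC.
  by rewrite (peirce_scale_orth EJA)// (idem_system_orth cP)// eq_sym.
by apply: eq_bigr => i _; rewrite mem_enum.
Qed.

Lemma ip_system_scale a x y : ip (M a x) y = ip x (M a y).
Proof.
rewrite /M; have : uniq (enum 'I_m) by rewrite enum_uniq.
elim: (enum _) x y => //= i s IH x y /andP[si us].
by rewrite ip_peirce_scale// IH// scale_through.
Qed.

Lemma ip_system_scale_le a y : (forall i, 0 <= a i <= 2) ->
  ip (M a y) (M a y) <= 258 ^+ r * ip y y.
Proof.
move=> a2; have mr := idem_system_rank EJA cP hr.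
apply: (@le_trans _ _ (258 ^+ m * ip y y)); last first.
  by rewrite ler_wpM2r ?ip_ge0// ler_weXn2l//; lra.
have -> : 258 ^+ m = 258 ^+ size (enum 'I_m) :> R by rewrite size_enum_ord.
rewrite /M; elim: (enum _) => /= [|i s IH]; first by rewrite expr0 mul1r.
apply: (le_trans (ip_peirce_scale_le (cI i) _ (a2 i))).
by rewrite exprS -mulrA ler_pM2l//; lra.
Qed.

Lemma det_system_scale a : exists2 k : 'I_m -> nat,
  forall i, (0 < k i)%N & forall x, det (M a x) = (\prod_i a i ^+ k i) * det x.
Proof.
have kP i : exists k : nat, (0 < k)%N /\ forall t x, det (G (c i) t x) = t ^+ k * det x.
  have [k kE kP] := det_peirce_scale EJA hr htr hdet r_gt0 (cI i); exists k; split=> //.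
  have ci0 : c i != 0 by have [] := cP.
  have := ip_gt0 ci0; rewrite /jinner cI => trc.
  have : (0 : R) < k%:R by rewrite -kE; lra.
  by rewrite ltr0n.
have /choice[k kE] := kP.
exists k => [i|x]; first by have [] := kE i.
rewrite -big_enum /= /M; elim: (enum _) => /= [|i s IH]; first by rewrite big_nil mul1r.
by rewrite big_cons; have [_ ->] := kE i; rewrite IH mulrA.
Qed.

(** The element is the image of [e] under [system_scale] with the square roots of the z_i. The
    exponents are multiplicities of the idempotents, which need not be primitive; only their
    positivity matters for deciding when det vanishes. *)
Lemma det_system_nonneg z : (forall i, 0 <= z i) -> exists2 k : 'I_m -> nat,
  forall i, (0 < k i)%N & det (\sum_i z i *: c i) = \prod_i Num.sqrt (z i) ^+ k i.
Proof.
move=> z0; have [k k0 kP] := det_system_scale (fun i => Num.sqrt (z i)).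
exists k => //; have := kP e; rewrite (det1 EJA hr hdet) mulr1 => <-.
have [_ _ ce] := cP; have -> : e = \sum_i 1 *: c i.
  by rewrite -ce; apply: eq_bigr => i _; rewrite scale1r.
rewrite system_scale_system; congr (det _); apply: eq_bigr => i _.
by rewrite sqr_sqrtr// mulr1.
Qed.

Lemma det_system_gt0 z : (forall i, 0 < z i) -> 0 < det (\sum_i z i *: c i).
Proof.
move=> z0; have [i|k _ ->] := @det_system_nonneg z; first exact: ltW.
by apply: prodr_gt0 => i _; rewrite exprn_gt0// sqrtr_gt0.
Qed.

Lemma system_psd_gt0 z : psd (\sum_i z i *: c i) -> det (\sum_i z i *: c i) != 0 ->
  forall i, 0 < z i.
Proof.
move=> xp d0 i; rewrite lt_def (system_psd _ xp) andbT.
have [j|k k0 dE] := @det_system_nonneg z; first exact: system_psd xp.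
apply: contra_neq d0 => zi; rewrite dE (bigD1 i)//= zi sqrtr0.
by rewrite expr0n gtn_eqF ?k0// mul0r.
Qed.

End System.

(** An interior point stays a square after subtracting a small multiple of [e], so its eigenvalues
    have the form zeta^2 + delta with delta > 0. *)
Lemma cone_psd_det x : symmetric_cone mul tr x -> psd x /\ 0 < det x.
Proof.
move=> [eps eps0 xeps].
pose K := ip e e; have K0 : 0 <= K by exact: ip_ge0.
(* Chosen so that delta < 1 and delta K < eps, which gives delta^2 (e, e) < eps. *)
pose delta := eps / ((K + 1) * (eps + 1)).
have D0 : 0 < (K + 1) * (eps + 1) by apply: mulr_gt0; lra.
have d0 : 0 < delta by rewrite divr_gt0.
have dE : delta * ((K + 1) * (eps + 1)) = eps by rewrite divfK// gt_eqF.
have dK : delta ^+ 2 * K < eps.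
  have P1 : 0 <= K * eps by rewrite mulr_ge0// ltW.
  have P2 : 0 < delta * (K * eps + eps + 1) by apply: mulr_gt0 => //; lra.
  have P3 : delta * K < eps by lra.
  have P4 : delta < 1.
    rewrite ltNge; apply/negP => d1.
    have : 0 <= (delta - 1) * ((K + 1) * (eps + 1)) by rewrite mulr_ge0// ?subr_ge0// ltW.
    lra.
  have : 0 <= (1 - delta) * (delta * K).
    by apply: mulr_ge0; [lra | apply: mulr_ge0 => //; exact: ltW].
  by rewrite expr2; lra.
have [|z zE] := xeps (x - delta *: e).
  have -> : x - delta *: e - x = - (delta *: e) by rewrite addrC addKr.
  by rewrite !ipE ?mulrN ?opprK mulrA -expr2.
have [m [zeta [c [cP _ zc]]]] := spectral_decomposition EJA z.
have [_ _ ce] := cP.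
have xE : x = \sum_i (zeta i ^+ 2 + delta) *: c i.
  under eq_bigr do rewrite scalerDl.
  rewrite big_split /= -scaler_sumr ce -[LHS](subrK (delta *: e)) zE zc.
  by rewrite (idem_system_prod EJA cP).
have z0 i : 0 < zeta i ^+ 2 + delta by have := sqr_ge0 (zeta i); lra.
rewrite xE; split; first by apply: (psd_system cP) => i; exact: ltW.
exact: det_system_gt0.
Qed.

(** The eigenvalues of [x] are bounded below by some mu > 0. For y close to x the pairing of y with
    each of its own spectral idempotents stays positive, so the eigenvalues of y are positive and y
    is a square. *)
Lemma psd_det_cone x : psd x -> det x != 0 -> symmetric_cone mul tr x.
Proof.
have [m [z [c [cP _ xE]]]] := spectral_decomposition EJA x.
move=> xp xd.
have z0 i : 0 < z i by rewrite xE in xp xd; exact: (system_psd_gt0 cP).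
have [mu mu0 muz] : exists2 mu, 0 < mu & forall i, mu <= z i.
  have S0 : 0 <= \sum_j (z j)^-1 by apply: sumr_ge0 => j _; rewrite invr_ge0 ltW.
  (* A positive lower bound for all eigenvalues that avoids taking a minimum over a possibly empty
     index set. *)
  exists (1 + \sum_j (z j)^-1)^-1 => [|i]; first by rewrite invr_gt0; lra.
  rewrite -[leRHS]invrK lef_pV2 ?posrE ?invr_gt0//; last by lra.
  rewrite (bigD1 i)//= addrCA lerDl addr_ge0//.
  by apply: sumr_ge0 => j _; rewrite invr_ge0 ltW.
(* Expanding the norm of y - x + mu d_j bounds the eigenvalue from below; the radius works because
   (d_j, d_j) >= 1/2. *)
exists (mu ^+ 2 / 2); first by rewrite divr_gt0// exprn_gt0.
move=> y yx.
have [p [eta [d [dP _ yE]]]] := spectral_decomposition EJA y.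
have eta0 j : 0 < eta j.
  have dI := idem_system_idem dP j; have dn0 : d j != 0 by have [] := dP.
  have dd := ip_idem_lb dI dn0.
  have xdj : mu * ip (d j) (d j) <= ip x (d j).
    have := @psd_system _ _ cP (fun i => z i - mu) _ (d j).
    under eq_bigr do rewrite scalerBl.
    have [_ _ ce] := cP; rewrite sumrB -xE -scaler_sumr ce dI !ipE.
    have -> : ip e (d j) = ip (d j) (d j) by rewrite /jinner dI (j1l EJA).
    by move=> H; rewrite -subr_ge0; apply: H => i; rewrite subr_ge0.
  have := ip_ge0 (y - x + mu *: d j).
  have yd : ip y (d j) = eta j * ip (d j) (d j).
    by rewrite yE -{1}dI ip_square (idem_system_mul EJA dP) ipE.
  move: yx; rewrite !ipE (ipC (d j) y) (ipC (d j) x) yd => yx H.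
  have {}H : 0 < mu * (eta j * ip (d j) (d j)) by nra.
  by move: H; rewrite pmulr_rgt0// pmulr_lgt0//; lra.
exists (\sum_j Num.sqrt (eta j) *: d j).
rewrite (idem_system_prod EJA dP) yE; apply: eq_bigr => j _.
by rewrite -expr2 sqr_sqrtr// ltW.
Qed.

End Cone.

Import numFieldNormedType.Exports.

(** * The interval: openness, boundary, boundedness, affine charts *)

Section Interval.
Context (R : realType) (V : vectType R) (mul : V -> V -> V) (e : V).
Hypothesis EJA : euclidean_jordan_algebra mul e.
Local Notation "x ** y" := (mul x y) (at level 40, left associativity).
Let jC := jC EJA.
Let jE := jE EJA.
Variables (r : nat) (tr det : V -> R).
Hypothesis hr : jordan_rank mul e r.
Hypothesis htr : jordan_trace mul e r tr.
Hypothesis hdet : jordan_det mul e r det.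
Hypothesis r_gt0 : (0 < r)%N.
Variables (n : nat) (b : n.-tuple V).
Hypothesis hb : orthonormal_basis mul tr b.
Local Notation ip := (jinner mul tr).
Let ipE := ipE EJA hr htr r_gt0.
Let ip_ge0 := ip_ge0 EJA hr htr r_gt0 hb.
Let ipC := ipC EJA tr.
Local Notation psd := (psd mul tr).
Local Notation I := (cone_interval mul e tr).

Lemma cone_gt0 x : symmetric_cone mul tr x -> 0 < det x.
Proof. by case/(cone_psd_det EJA hr htr hdet r_gt0 hb). Qed.

Lemma coneP x : symmetric_cone mul tr x <-> psd x /\ det x != 0.
Proof.
split=> [/(cone_psd_det EJA hr htr hdet r_gt0 hb)[xp xd]|[xp xd]].
  by rewrite gt_eqF.
exact: (psd_det_cone EJA hr htr hdet r_gt0 hb).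
Qed.

Lemma cone_open x : symmetric_cone mul tr x -> exists2 eps, 0 < eps &
  forall y, ip (y - x) (y - x) < eps -> symmetric_cone mul tr y.
Proof.
move=> [eps eps0 xeps]; exists (eps / 4); first by lra.
move=> y yx; exists (eps / 4); first by lra.
move=> z zy; apply: xeps.
have := ip_ge0 ((z - y) - (y - x)).
have -> : z - x = (z - y) + (y - x) by rewrite addrA subrK.
move: zy yx; move: (z - y) (y - x) => u w; rewrite !ipE (ipC w u); lra.
Qed.

Lemma interval_open v w : I v -> exists2 delta, 0 < delta &
  forall t, `|t| < delta -> I (v + t *: w).
Proof.
move=> [/cone_open[e1 e10 H1] /cone_open[e2 e20 H2]].
pose K := ip w w; have K0 : 0 <= K by exact: ip_ge0.
pose ee := Num.min e1 e2; have ee0 : 0 < ee by rewrite lt_min e10.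
pose delta := Num.min 1 (ee / (K + 1)).
have d0 : 0 < delta by rewrite lt_min ltr01 divr_gt0//; lra.
exists delta => // t; rewrite lt_min => /andP[t1 t2].
have tK : t ^+ 2 * K < ee.
  have t2' : `|t| * (K + 1) < ee by rewrite -ltr_pdivlMr//; lra.
  have : `|t| ^+ 2 * K <= `|t| * (K + 1).
    have t0 := normr_ge0 t.
    have P : 0 <= `|t| * (1 - `|t|) * K by rewrite !mulr_ge0// subr_ge0 ltW.
    by rewrite expr2; lra.
  by rewrite real_normK ?num_real//; lra.
have tw : ip (t *: w) (t *: w) < ee by rewrite !ipE mulrA -expr2.
split.
  apply: H1; have -> : e + (v + t *: w) - (e + v) = t *: w by vlra.
  by apply: (lt_le_trans tw); rewrite ge_min lexx.
apply: H2; have -> : e - (v + t *: w) - (e - v) = - (t *: w).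
  by vlra.
have -> : ip (- (t *: w)) (- (t *: w)) = ip (t *: w) (t *: w) by rewrite !ipE; lra.
by apply: (lt_le_trans tw); rewrite ge_min lexx orbT.
Qed.

(** If e + v or e - v pairs negatively with some square, so do the nearby points of the line, which
    then avoid the interval. Otherwise both are in the closed cone and v is outside only because a
    determinant vanishes there; then f(v) = 0 and continuity along the line concludes. *)
Lemma interval_boundary (f : V -> R) v w eps : line_poly f ->
  (forall u, det (e + u) = 0 \/ det (e - u) = 0 -> f u = 0) ->
  ~ I v -> 0 < eps -> exists2 delta, 0 < delta &
  forall t, `|t| < delta -> I (v + t *: w) -> f (v + t *: w) < eps.
Proof.
move=> fp f0 nI eps0.
have near_lt (h : {poly R}) c : h.[0] < c ->
    exists2 delta, 0 < delta & forall t, `|t| < delta -> h.[t] < c.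
  move=> hc; have := @continuous_horner _ h 0 => /cvgrPdist_lt/(_ (c - h.[0])).
  rewrite subr_gt0 => /(_ hc)/nbhs_ballP[delta /= d0 H]; exists delta => // t td.
  have := H t; rewrite /ball /= sub0r normrN => /(_ td).
  by rewrite distrC => /(le_lt_trans (ler_norm _)); lra.
have psd_near u x y : ip u (y ** y) < 0 -> exists2 delta, 0 < delta &
    forall t, `|t| < delta -> ~ psd (u + t *: x).
  move=> uy; pose h : {poly R} := (ip u (y ** y))%:P + (ip x (y ** y))%:P * 'X.
  have [|delta d0 H] := near_lt h 0; first by rewrite /h !hornerE.
  exists delta => // t /H ht /(_ y); rewrite !ipE; move: ht; rewrite /h !hornerE.
  by rewrite mulrC => ht /(lt_le_trans ht); rewrite ltxx.
have [p1|] := pselect (psd (e + v)); last first.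
  move=> /existsNP[y /negP]; rewrite -ltNge => yn.
  have [delta d0 H] := psd_near _ w _ yn.
  exists delta => // t td [/coneP[]]; rewrite addrA => pt.
  by have := H t td.
have [p2|] := pselect (psd (e - v)); last first.
  move=> /existsNP[y /negP]; rewrite -ltNge => yn.
  have [delta d0 H] := psd_near _ (- w) _ yn.
  exists delta => // t td [_ /coneP[]]; rewrite opprD addrA -scalerN => pt.
  by have := H t td.
have fv : f v = 0.
  apply: f0; apply: contrapT => /not_orP[/eqP d1 /eqP d2]; apply: nI.
  by split; apply/coneP.
have [h hE] := fp v w.
have [|delta d0 H] := near_lt h eps; first by rewrite -hE scale0r addr0 fv.
by exists delta => // t td _; rewrite hE; exact: H.
Qed.

Lemma interval_system v : I v -> exists m (c : 'I_m -> V) z,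
  [/\ idempotent_system mul e c, v = \sum_i z i *: c i & forall i, -1 < z i < 1].
Proof.
move=> [/coneP[p1 d1] /coneP[p2 d2]].
have [m [z [c [cP _ vE]]]] := spectral_decomposition EJA v.
have [_ _ ce] := cP.
exists m, c, z; split=> // i.
have E1 : e + v = \sum_i (1 + z i) *: c i.
  by under eq_bigr do rewrite scalerDl scale1r; rewrite big_split /= ce vE.
have E2 : e - v = \sum_i (1 - z i) *: c i.
  by under eq_bigr do rewrite scalerBl scale1r; rewrite sumrB /= ce vE.
rewrite E1 in p1 d1; rewrite E2 in p2 d2.
have := system_psd_gt0 EJA hr htr hdet r_gt0 hb cP p1 d1 i.
have := system_psd_gt0 EJA hr htr hdet r_gt0 hb cP p2 d2 i.
lra.
Qed.

Lemma interval_bounded v : I v -> ip v v <= ip e e.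
Proof.
move=> /interval_system[m [c [z [cP -> z1]]]].
have [cn0 cc ce] := cP.
have cI i : c i ** c i = c i by exact: idem_system_idem cP i.
have E y : ip (\sum_i y i *: c i) (\sum_i y i *: c i) = \sum_i y i ^+ 2 * ip (c i) (c i).
  rewrite (ip_suml EJA hr htr r_gt0); apply: eq_bigr => i _.
  rewrite ipE -{1}(cI i) ipC (ip_square EJA hr htr r_gt0) (idem_system_mul EJA cP).
  by rewrite ipE mulrA -expr2.
have eE : e = \sum_i 1 *: c i by rewrite -ce; apply: eq_bigr => i _; rewrite scale1r.
have -> : ip e e = ip (\sum_i 1 *: c i) (\sum_i 1 *: c i) by rewrite -eE.
rewrite !E; apply: ler_sum => i _; rewrite ler_wpM2r// expr1n.
by have /andP[] := z1 i; nra.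
Qed.

Lemma interval0 : I 0.
Proof.
have e_psd : psd e.
  by move=> y; rewrite (ip_square EJA hr htr r_gt0) (j1l EJA).
have e_det : det e != 0 by rewrite (det1 EJA hr hdet) oner_neq0.
by rewrite /cone_interval /= addr0 subr0; split; apply/coneP.
Qed.

Lemma cone_scale a x : 0 < a -> symmetric_cone mul tr x -> symmetric_cone mul tr (a *: x).
Proof.
move=> a0 /coneP[xp xd]; apply/coneP; split.
  by move=> y; rewrite ipE mulr_ge0// ltW.
by rewrite (det_scale EJA hr hdet) mulf_neq0// expf_neq0// gt_eqF.
Qed.

(* The chart [h |-> v + P(c) h] at [v], [c^2 = e - v^2], renormalizes both
   [e - v] and [e + v] to [e]; here [A = P((e - v)^(1/2))], [B = P((e + v)^(1/2))]
   and [P(c) = A B]. *)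
Lemma interval_chart : exists K, forall v, I v -> exists A B : V -> V,
  [/\ (forall a x y, A (a *: x + y) = a *: A x + A y) /\
      (forall a x y, B (a *: x + y) = a *: B x + B y),
      forall h, det (e - (v + A (B h))) = det (e - v) * det (e - B h),
      forall h, det (e + (v + A (B h))) = det (e + v) * det (e + A h),
      (forall x y, ip (A (B x)) y = ip x (A (B y))) /\
      (forall x, det (A (B x)) = det (e - v) * det (e + v) * det x) &
      forall i j, `|coord b i (A (tnth b j))| <= K /\ `|coord b i (B (tnth b j))| <= K].
Proof.
exists (258 ^+ r) => v /interval_system[m [c [z [cP vE z1]]]].
have [_ _ ce] := cP.
pose S := system_scale mul c.
have SP := system_scaleP EJA c.
have SM := system_scale_mul EJA cP.
have SS := system_scale_system EJA cP.
have SI := ip_system_scale EJA hr htr r_gt0 cP.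
have SL := ip_system_scale_le EJA hr htr r_gt0 hb cP.
have eE : e = \sum_i 1 *: c i by rewrite -ce; apply: eq_bigr => i _; rewrite scale1r.
have detS a x : det (S a x) = det (S a e) * det x.
  have [k _ kE] := det_system_scale EJA hr htr hdet r_gt0 hb cP a.
  by rewrite /S !kE (det1 EJA hr hdet) mulr1.
(* The eigenvalues of (e - v)^(1/2) and (e + v)^(1/2). The two scalings commute and send [e] to e -
   v and e + v, so e - (v + A B h) = A (e - B h) and e + (v + A B h) = B (e + A h). The roots lie in
   [0, 2], which makes the matrix bound uniform in v. *)
pose a i := Num.sqrt (1 - z i); pose a' i := Num.sqrt (1 + z i).
have aE : S a e = e - v.
  rewrite eE /S SS vE -sumrB; apply: eq_bigr => i _; rewrite mulr1 sqr_sqrtr ?scalerBl//.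
  by have := z1 i; lra.
have a'E : S a' e = e + v.
  rewrite eE /S SS vE -big_split; apply: eq_bigr => i _; rewrite mulr1 sqr_sqrtr ?scalerDl//.
  by have := z1 i; lra.
have aa' h : S a (S a' h) = S a' (S a h).
  by rewrite /S !SM; congr (system_scale _ _ _ _); apply/funext => i; rewrite mulrC.
have SD t x y : S t (x + y) = S t x + S t y.
  by rewrite -[x]scale1r /S SP !scale1r.
have SB t x y : S t (x - y) = S t x - S t y.
  by rewrite addrC -scaleN1r /S SP scaleN1r addrC.
have bound t : (forall i, 0 <= t i <= 2) -> forall i j,
    `|coord b i (S t (tnth b j))| <= 258 ^+ r.
  move=> t2 i j; have [_ bo] := hb.
  have H1 := coord_sqr_le EJA hr htr r_gt0 hb (S t (tnth b j)) i.
  have H2 := SL t (tnth b j) t2; rewrite bo eqxx mulr1 in H2.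
  have H3 : (1 : R) <= 258 ^+ r by rewrite exprn_ege1//; lra.
  rewrite ler_norml; move: H1 H2 H3; rewrite -/S.
  move: (coord b i _) (258 ^+ r) (ip (S _ _) _) => x y w H1 H2 H3.
  by apply/andP; split; nra.
have sqrt2 (s : R) : -1 < s < 1 -> 0 <= Num.sqrt (1 + s) <= 2.
  move=> s1; rewrite sqrtr_ge0 /=.
  have h : 0 <= 1 + s by lra.
  by have := sqr_sqrtr h; have := sqrtr_ge0 (1 + s); nra.
exists (S a), (S a'); split.
- by split=> *; exact: SP.
- by move=> h; rewrite opprD addrA -aE -SB detS.
- by move=> h; rewrite addrA aa' -a'E -SD detS.
- split=> [x y|x]; first by rewrite /S !SI -/S aa'.
  by rewrite detS aE detS a'E mulrA.
- move=> i j; split; apply: bound => k.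
    by apply: (sqrt2 (- z k) _); have := z1 k; lra.
  exact: sqrt2 (z1 k).
Qed.

Lemma poly_ge0_rat (h : {poly R}) : (forall q : rat, 0 <= h.[ratr q]) -> forall t, 0 <= h.[t].
Proof.
move=> hq t; rewrite leNgt; apply/negP => ht.
have := @continuous_horner _ h t => /cvgrPdist_lt/(_ (- h.[t])).
rewrite oppr_gt0 => /(_ ht)/nbhs_ballP[delta /= d0 H].
have td : t < t + delta by rewrite ltrDl.
have [q] := rat_in_itvoo td.
rewrite in_itv /= => /andP[q1 q2].
have := H (ratr q); rewrite /ball /= distrC ger0_norm ?subr_ge0 ?ltW// ltrBlDl q2.
move=> /(_ isT); rewrite distrC => /(le_lt_trans (ler_norm _)).
by have := hq q; lra.
Qed.

(** Makes the cone condition countable, for measurability. The coordinates are released from the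
    rationals one at a time: in one coordinate the pairing is a polynomial of degree at most 2 that
    is nonnegative at all rationals. *)
Lemma psd_rat x : psd x <-> forall q : n.-tuple rat,
  0 <= ip x ((\sum_i ratr (tnth q i) *: tnth b i) ** (\sum_i ratr (tnth q i) *: tnth b i)).
Proof.
split=> [xp q|xq y]; first exact: xp.
have [bb _] := hb.
suff H (s : seq 'I_n) (a : 'I_n -> R) : (forall i, i \notin s -> exists q : rat, a i = ratr q) ->
    0 <= ip x ((\sum_i a i *: tnth b i) ** (\sum_i a i *: tnth b i)).
  rewrite (coord_basis bb (memvf y)).
  under eq_bigr do rewrite -tnth_nth.
  by apply: (H (enum 'I_n)) => i; rewrite mem_enum.
elim: s a => [|j s IH] a aq.
  have /choice[q qE] : forall i, exists q : rat, a i = ratr q by move=> i; exact: aq.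
  have := xq [tuple q i | i < n].
  by under eq_bigr do rewrite tnth_mktuple -qE.
pose u := \sum_(i | i != j) a i *: tnth b i.
have uE (t : R) : \sum_i (if i == j then t else a i) *: tnth b i = u + t *: tnth b j.
  rewrite (bigD1 j)//= eqxx addrC; congr (_ + _).
  by apply: eq_bigr => i /negbTE->.
pose h : {poly R} := (ip x (u ** u))%:P + (2 * ip x (u ** tnth b j))%:P * 'X
  + (ip x (tnth b j ** tnth b j))%:P * 'X ^+ 2.
have hE t : h.[t] = ip x ((u + t *: tnth b j) ** (u + t *: tnth b j)).
  by rewrite /h !hornerE /= !jE !ipE (jC (tnth b j) u); ring.
have -> : \sum_i a i *: tnth b i = u + a j *: tnth b j.
  by rewrite -uE; apply: eq_bigr => i _; case: ifP => // /eqP ->.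
rewrite -hE; apply: poly_ge0_rat => q; rewrite hE -uE.
apply: IH => i si; have [_|ij] := eqVneq i j; first by exists q.
by apply: aq; rewrite inE negb_or ij.
Qed.

End Interval.

Local Open Scope classical_set_scope.

(** * Differentiability of powers of the positive part *)

Section PositivePart.
Context (R : realType).

(** Only the origin is delicate; there the difference quotient is the positive part to the power m +
    1, which is continuous and vanishes at 0. *)
Lemma is_derive_pospart_exp (m : nat) (y : R) :
  is_derive y 1 (fun s : R => Num.max s 0 ^+ m.+2) (m.+2%:R * Num.max y 0 ^+ m.+1).
Proof.
have [y0|y0|->] := ltgtP y 0.
- rewrite expr0n mulr0.
  apply: (@near_eq_is_derive _ _ _ (cst 0)).
  near=> s; rewrite /cst max_r ?expr0n//.
  by apply: ltW; near: s; exact: lt_nbhsl.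
- have H := @is_deriveX _ _ id m.+1.+1 y 1 1 (is_derive_id _ _).
  rewrite scaler1 in H; apply: (near_eq_is_derive _ H).
  near=> s; rewrite exprfctE max_l//.
  by apply: ltW; near: s; exact: lt_nbhsr.
- rewrite ?maxxx expr0n mulr0; apply/is_derive1_caratheodory.
  exists (fun s => Num.max s 0 ^+ m.+1); split.
  + move=> z; rewrite maxxx expr0n subr0 !subr0.
    have [z0|z0] := leP z 0; first by rewrite !expr0n mul0r.
    by rewrite -exprSr.
  + apply: (@continuous_comp _ _ _ (fun s : R => Num.max s 0) (fun s : R => s ^+ m.+1)).
      by apply: continuous_max => //; exact: cvg_cst.
    exact: exprn_continuous.
  + by rewrite maxxx expr0n.
Unshelve. all: by end_near. Qed.

End PositivePart.

(** * Polynomials acting through commuting linear operators *)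

Section PolynomialAction.
Context (R : comNzRingType) (X : lmodType R).

Section Directions.
Variables (n : nat) (d : 'I_n -> X -> X).
Hypothesis dP : forall i a x y, d i (a *: x + y) = a *: d i x + d i y.
Hypothesis dC : forall i j x, d i (d j x) = d j (d i x).
Local Notation MP := (mpoly.mpoly n R).

Definition act_monomial (m : mpoly.multinom n) x : X :=
  foldr (fun i y => iter (mpoly.fun_of_multinom m i) (d i) y) x (enum 'I_n).

(** The formula of [diff_op] with arbitrary operators [d i] in place of directional derivatives. For
    commuting linear operators it is the module action of the polynomial ring. *)
Definition act (q : MP) x : X :=
  \sum_(m <- mpoly.msupp q) mpoly.mcoeff m q *: act_monomial m x.

Let dD i x y : d i (x + y) = d i x + d i y.
Proof. by rewrite -[x in LHS]scale1r dP scale1r. Qed.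
Let d0 i : d i 0 = 0.
Proof. by apply: (addrI (d i 0)); rewrite -dD !addr0. Qed.
Let dZ i a x : d i (a *: x) = a *: d i x.
Proof. by rewrite -[_ *: x]addr0 dP d0 addr0. Qed.

Lemma act_monomialP m a x y :
  act_monomial m (a *: x + y) = a *: act_monomial m x + act_monomial m y.
Proof.
rewrite /act_monomial; elim: (enum _) => //= i s ->.
by elim: (mpoly.fun_of_multinom m i) => //= k ->; rewrite dP.
Qed.

Lemma act_monomial0 x : act_monomial (mpoly.mnm0 (n := n)) x = x.
Proof.
by rewrite /act_monomial; elim: (enum _) => //= i s ->; rewrite mpoly.mnm0E.
Qed.

Lemma act_monomialU i m x :
  act_monomial (mpoly.mnm_add (mpoly.mnm1 i) m) x = d i (act_monomial m x).
Proof.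
have thru j k y : iter k (d j) (d i y) = d i (iter k (d j) y).
  by elim: k => //= k ->; rewrite dC.
rewrite /act_monomial.
have fE j : mpoly.fun_of_multinom (mpoly.mnm_add (mpoly.mnm1 i) m) j =
    ((i == j) + mpoly.fun_of_multinom m j)%N by rewrite mpoly.mnmDE mpoly.mnm1E.
move: (mpoly.fun_of_multinom _) fE => f fE.
have notin s : i \notin s ->
    foldr (fun j y => iter (f j) (d j) y) x s =
    foldr (fun j y => iter (mpoly.fun_of_multinom m j) (d j) y) x s.
  elim: s => //= j s IH; rewrite inE negb_or => /andP[/negbTE ij /IH ->].
  by rewrite fE ij.
have : i \in enum 'I_n by rewrite mem_enum.
have : uniq (enum 'I_n) by rewrite enum_uniq.
elim: (enum _) => //= j s IH /andP[js us]; rewrite inE fE.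
have [ij _|ij /= si] := eqVneq i j; last by rewrite IH// thru.
by rewrite notin ij.
Qed.

Lemma actwE k q x : (mpoly.msize q <= k)%N ->
  act q x = \sum_(m : mpoly.bmultinom n k) mpoly.mcoeff m q *: act_monomial m x.
Proof.
move=> qk; rewrite /act (ssrcomplements.big_mksub (mpoly.bmultinom n k)) /=; first last.
  by move=> m /mpoly.msize_mdeg_lt /leq_trans; apply.
  by rewrite mpoly.msupp_uniq.
by rewrite big_rmcond //= => m /mpoly.memN_msupp_eq0 ->; rewrite scale0r.
Qed.

Lemma actP a p q x : act (a *: p + q) x = a *: act p x + act q x.
Proof.
pose k := maxn (mpoly.msize (a *: p + q)) (maxn (mpoly.msize p) (mpoly.msize q)).
rewrite !(@actwE k) ?leq_max ?leqnn ?orbT// scaler_sumr -big_split.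
by apply: eq_bigr => m _; rewrite mpoly.mcoeffD mpoly.mcoeffZ scalerDl scalerA.
Qed.
Lemma actD p q x : act (p + q) x = act p x + act q x.
Proof. by rewrite -[p in LHS]scale1r actP scale1r. Qed.
Lemma act0 x : act 0 x = 0.
Proof. by apply: (addrI (act 0 x)); rewrite -actD !addr0. Qed.
Lemma actZ a p x : act (a *: p) x = a *: act p x.
Proof. by rewrite -[_ *: p]addr0 actP act0 addr0. Qed.
Lemma act_sum I (s : seq I) (P : pred I) (F : I -> MP) x :
  act (\sum_(i <- s | P i) F i) x = \sum_(i <- s | P i) act (F i) x.
Proof. by apply: (big_morph (act^~ x)) => [? ?|]; rewrite ?actD ?act0. Qed.
Lemma actX m x : act (mpoly.mpolyX R m) x = act_monomial m x.
Proof. by rewrite /act mpoly.msuppX big_seq1 mpoly.mcoeffX eqxx scale1r. Qed.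

Lemma act_linear q a x y : act q (a *: x + y) = a *: act q x + act q y.
Proof.
rewrite /act scaler_sumr -big_split; apply: eq_bigr => m _.
by rewrite act_monomialP scalerDr !scalerA mulrC.
Qed.

Lemma act_mulX i q x : act (mpoly.mpolyX R (mpoly.mnm1 i) * q) x = d i (act q x).
Proof.
rewrite [q in LHS]mpoly.mpolyE mulr_sumr act_sum [in RHS]/act.
rewrite (big_morph (d i) (dD i) (d0 i)); apply: eq_bigr => m _.
by rewrite -scalerAr actZ -mpoly.mpolyXD actX act_monomialU dZ.
Qed.

End Directions.

(* Change of variables: [q(d')] is [(q o lin)(d)] if the [d'_j] are linear
   combinations of the [d_i]. *)
Lemma act_comp n N (d : 'I_N -> X -> X) (d' : 'I_n -> X -> X) (L : 'I_n -> 'I_N -> R) :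
  (forall i a x y, d i (a *: x + y) = a *: d i x + d i y) ->
  (forall i j x, d i (d j x) = d j (d i x)) ->
  (forall j x, d' j x = \sum_i L j i *: d i x) ->
  forall (q : mpoly.mpoly n R) x, act d' q x =
    act d (mpoly.comp_mpoly [tuple \sum_i L j i *: mpoly.mpolyX R (mpoly.mnm1 i) | j < n] q) x.
Proof.
move=> dP dC d'E.
have d'P j a x y : d' j (a *: x + y) = a *: d' j x + d' j y.
  rewrite !d'E scaler_sumr -big_split; apply: eq_bigr => i _.
  by rewrite dP scalerDr !scalerA mulrC.
set lq := [tuple _ | _ < _].
have step j p x : act d (tnth lq j * p) x = d' j (act d p x).
  rewrite tnth_mktuple mulr_suml act_sum d'E; apply: eq_bigr => i _.
  by rewrite -scalerAl actZ act_mulX.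
have stepk j k p x : act d (tnth lq j ^+ k * p) x = iter k (d' j) (act d p x).
  by elim: k => [|k IH]; rewrite ?expr0 ?mul1r// exprS -mulrA step IH.
move=> q x; rewrite [q in RHS]mpoly.mpolyE raddf_sum act_sum [in LHS]/act.
apply: eq_bigr => m _; rewrite /= mpoly.comp_mpolyZ actZ; congr (_ *: _).
rewrite mpoly.comp_mpolyX -big_enum /act_monomial /=.
elim: (enum _) => /= [|j s IH].
  by rewrite big_nil -mpoly.mpolyX0 actX act_monomial0.
by rewrite big_cons stepk IH.
Qed.

End PolynomialAction.

(** * A class of functions stable under differentiation *)

Section ClassFunctions.
Context (R : realType) (W : vectType R) (N : nat) (B : N.-tuple W).
Local Notation MP := (mpoly.mpoly N R).
Local Notation ev := (peval B).
Local Notation C := (mpoly.mpolyC N).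
Variables P Q S : MP.

(* [P^al Q^be (S_+)^m p]; [class_step] is the polynomial factor of its
   derivative [P^(al-1) Q^(be-1) (S_+)^(m-1) (class_step p)]. *)
Definition class_fun (al be : R) (m : nat) (p : MP) (x : W) : R :=
  ev P x `^ al * ev Q x `^ be * Num.max (ev S x) 0 ^+ m * ev p x.

Definition class_step (al be nu : R) w (p : MP) : MP :=
  (C al * pderiv B w P * Q * S + C be * P * pderiv B w Q * S +
   C nu * P * Q * pderiv B w S) * p + P * Q * S * pderiv B w p.

Lemma powR_sub1 (a al : R) : 0 < a -> a `^ al = a `^ (al - 1) * a.
Proof.
move=> a0; have := @powRD _ a (al - 1) 1.
by rewrite subrK powRr1 ?ltW// => -> //; rewrite (gt_eqF a0) /= implybT.
Qed.

Lemma is_derive_class_fun al be m p x w : 0 < ev P x -> 0 < ev Q x ->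
  is_derive (0 : R) 1 (fun t => class_fun al be m.+2 p (x + t *: w))
    (class_fun (al - 1) (be - 1) m.+1 (class_step al be m.+2%:R w p) x).
Proof.
move=> P0 Q0.
have x0 : x + (0 : R) *: w = x by rewrite scale0r addr0.
have dpe q : is_derive (0 : R) 1 (fun t => ev q (x + t *: w)) (ev (pderiv B w q) x).
  by have := is_derive_peval B q x w 0; rewrite x0.
have dP : is_derive (0 : R) 1 (fun t => ev P (x + t *: w) `^ al)
    (al * ev P x `^ (al - 1) * ev (pderiv B w P) x).
  have H : is_derive ((fun t : R => ev P (x + t *: w)) 0) 1 (fun y => y `^ al)
      (al * ev P x `^ (al - 1)) by rewrite /= x0; exact: is_derive1_powR.
  exact: (is_derive1_comp H (dpe P)).
have dQ : is_derive (0 : R) 1 (fun t => ev Q (x + t *: w) `^ be)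
    (be * ev Q x `^ (be - 1) * ev (pderiv B w Q) x).
  have H : is_derive ((fun t : R => ev Q (x + t *: w)) 0) 1 (fun y => y `^ be)
      (be * ev Q x `^ (be - 1)) by rewrite /= x0; exact: is_derive1_powR.
  exact: (is_derive1_comp H (dpe Q)).
have dS : is_derive (0 : R) 1 (fun t => Num.max (ev S (x + t *: w)) 0 ^+ m.+2)
    (m.+2%:R * Num.max (ev S x) 0 ^+ m.+1 * ev (pderiv B w S) x).
  have H : is_derive ((fun t : R => ev S (x + t *: w)) 0) 1 (fun y => Num.max y 0 ^+ m.+2)
      (m.+2%:R * Num.max (ev S x) 0 ^+ m.+1) by rewrite /= x0; exact: is_derive_pospart_exp.
  exact: (is_derive1_comp H (dpe S)).
have H := is_deriveM (is_deriveM (is_deriveM dP dQ) dS) (dpe p).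
apply: (is_derive_eq H); rewrite {H dP dQ dS dpe}.
rewrite /= !x0 /class_fun /class_step !pevalE !fctE /= !x0.
rewrite !(powR_sub1 al P0) !(powR_sub1 be Q0).
have SE : Num.max (ev S x) 0 ^+ m.+2 = Num.max (ev S x) 0 ^+ m.+1 * ev S x.
  have [s0|s0] := leP (ev S x) 0; last by rewrite exprSr.
  by rewrite !expr0n mul0r.
rewrite SE !scalerDr /GRing.scale /=; move: (_ `^ _) (_ `^ _) (_ ^+ _) => a b c.
by ring.
Qed.

Lemma class_step_linear al be nu w a p q :
  class_step al be nu w (a *: p + q) = a *: class_step al be nu w p + class_step al be nu w q.
Proof.
rewrite /class_step pderivD pderivZ -!mpoly.mul_mpolyC.
by move: (C _) (C _) (C _) (C _) => *; ring.
Qed.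

Lemma class_step_linear_dir al be nu a v w p :
  class_step al be nu (a *: v + w) p = a *: class_step al be nu v p + class_step al be nu w p.
Proof.
rewrite /class_step !pderiv_linear -!mpoly.mul_mpolyC.
by move: (C _) (C _) (C _) (C _) => *; ring.
Qed.

Lemma class_step_comm al be nu v w p :
  class_step (al - 1) (be - 1) (nu - 1) v (class_step al be nu w p) =
  class_step (al - 1) (be - 1) (nu - 1) w (class_step al be nu v p).
Proof.
rewrite /class_step !mpoly.mpolyCB !mpoly.mpolyC1 !(pderivD, pderivM, pderivC).
rewrite (pderiv_comm B v w P) (pderiv_comm B v w Q) (pderiv_comm B v w S) (pderiv_comm B v w p).
by move: (C _) (C _) (C _) => *; ring.
Qed.

Section Sequences.
Variables (al be : R) (K : nat).

(** Entry j is the polynomial factor that belongs to exponents lowered j times. Recording the order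
    of differentiation in the index lets the step depend on the current exponents while the
    derivations in different directions still commute. *)
Definition class_diff w (F : nat -> MP) : nat -> MP := fun j =>
  if j is i.+1 then class_step (al - i%:R) (be - i%:R) (K%:R - i%:R) w (F i) else 0.

Definition class_seq (p : MP) : nat -> MP := fun j => if j is 0 then p else 0.

Lemma class_diffP w a F G : class_diff w (a *: F + G) = a *: class_diff w F + class_diff w G.
Proof.
apply/funext => -[|j]; first by rewrite !fctE /= scaler0 addr0.
by rewrite !fctE /= class_step_linear.
Qed.

Lemma class_diff_dir a v w F :
  class_diff (a *: v + w) F = a *: class_diff v F + class_diff w F.
Proof.
apply/funext => -[|j]; first by rewrite !fctE /= scaler0 addr0.
by rewrite !fctE /= class_step_linear_dir.
Qed.

Lemma class_diffC v w F : class_diff v (class_diff w F) = class_diff w (class_diff v F).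
Proof.
have Z w' : class_step (al - 0) (be - 0) (K%:R - 0) w' 0 = 0.
  by have := class_step_linear (al - 0) (be - 0) (K%:R - 0) w' (-1) 0 0;
    rewrite scaler0 addr0 scaleN1r addNr.
apply/funext => -[|[|j]] //=; first by rewrite !Z.
by rewrite -natr1 !opprD !addrA class_step_comm.
Qed.

Variable U : set W.
Hypothesis Uopen : forall x w, U x -> \forall t \near (0 : R), U (x + t *: w).
Hypothesis UP : forall x, U x -> 0 < ev P x.
Hypothesis UQ : forall x, U x -> 0 < ev Q x.

Definition class_at (j : nat) (F : nat -> MP) (x : W) : R :=
  class_fun (al - j%:R) (be - j%:R) (K - j) (F j) x.

Lemma is_derive_class_at j F x w : (j.+2 <= K)%N -> U x ->
  is_derive (0 : R) 1 (fun t => class_at j F (x + t *: w)) (class_at j.+1 (class_diff w F) x).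
Proof.
move=> jK Ux; rewrite /class_at /=.
have -> : (K - j)%N = (K - j.+2).+2 by lia.
have -> : (K - j.+1)%N = (K - j.+2).+1 by lia.
have := is_derive_class_fun (al - j%:R) (be - j%:R) (K - j.+2) (F j) w (UP Ux) (UQ Ux).
have -> : (K - j.+2).+2%:R = K%:R - j%:R :> R.
  by rewrite -natrB; [congr (_%:R); lia | lia].
by rewrite -(natr1 j) !opprD !addrA.
Qed.

Lemma dir_deriv_class j F f w : (j.+2 <= K)%N -> (forall x, U x -> f x = class_at j F x) ->
  forall x, U x -> dir_deriv w f x = class_at j.+1 (class_diff w F) x.
Proof.
move=> jK fE x Ux; rewrite /dir_deriv derive1E.
have H := is_derive_class_at F w jK Ux.
have : is_derive (0 : R) 1 (fun h => f (x + h *: w)) (class_at j.+1 (class_diff w F) x).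
  apply: (near_eq_is_derive _ H); have := Uopen w Ux; apply: filterS => t Ut.
  by rewrite fE.
by move=> H'; rewrite derive_val.
Qed.

Lemma monomial_deriv_class n (b : n.-tuple W) (m : mpoly.multinom n) F f :
  (mpoly.mdeg m < K)%N -> (forall x, U x -> f x = class_at 0 F x) ->
  forall x, U x -> monomial_deriv b m f x =
    class_at (mpoly.mdeg m) (act_monomial (fun i => class_diff (tnth b i)) m F) x.
Proof.
rewrite mpoly.mdegE -big_enum /= /monomial_deriv /act_monomial => mK fE.
elim: (enum _) mK => [|i s IH] /=; first by rewrite big_nil.
rewrite big_cons; elim: (mpoly.fun_of_multinom m i) => [|k IHk] kK /=.
  exact: IH kK.
apply: dir_deriv_class; first exact: kK.
by apply: IHk; exact: ltnW kK.
Qed.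

(** Homogeneity of the symbol makes all monomials land at the same index [M], so a single set of
    exponents factors out of the sum. *)
Lemma diff_op_class n (b : n.-tuple W) Qf F f M :
  (M < K)%N ->
  (forall m, m \in mpoly.msupp (mpoly_of b Qf) -> mpoly.mdeg m = M) ->
  (forall x, U x -> f x = class_at 0 F x) ->
  forall x, U x -> diff_op b Qf f x =
    class_at M (act (fun i => class_diff (tnth b i)) (mpoly_of b Qf) F) x.
Proof.
move=> MK hom fE x Ux; rewrite /diff_op /act /class_at /class_fun.
have -> : ev ((\sum_(m <- mpoly.msupp (mpoly_of b Qf)) mpoly.mcoeff m (mpoly_of b Qf) *:
    act_monomial (fun i => class_diff (tnth b i)) m F) M) x =
  \sum_(m <- mpoly.msupp (mpoly_of b Qf)) mpoly.mcoeff m (mpoly_of b Qf) *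
    ev (act_monomial (fun i => class_diff (tnth b i)) m F M) x.
  rewrite fct_sumE peval_sum; apply: eq_bigr => m _.
  by rewrite fctE pevalZ.
rewrite mulr_sumr; apply: eq_big_seq => m mQ.
rewrite (monomial_deriv_class b _ fE)// ?hom// /class_at /class_fun.
by rewrite mulrCA.
Qed.

End Sequences.

End ClassFunctions.

(** * Coordinate polynomials and homogeneity *)

Section MpolyOf.
Context (R : realType) (W : vectType R) (N : nat) (B : N.-tuple W).
Hypothesis Bb : basis_of {:W} B.

Lemma mpoly_ofP f : polynomial_fun f -> forall x, f x = peval B (mpoly_of B f) x.
Proof.
move=> /(polynomial_fun_basis Bb) fp.
exact: (xgetPex (0 : mpoly.mpoly N R) (P := [set p | mpoly_represents B p f]) fp).
Qed.

Lemma polynomial_peval p : polynomial_fun (peval B p).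
Proof.
pose lq := [tuple \sum_(j < \dim {:W}) coord B i (tnth (vbasis {:W}) j) *:
  mpoly.mpolyX R (mpoly.mnm1 j) | i < N].
exists (mpoly.comp_mpoly lq p) => x; rewrite mpoly.comp_mpoly_meval.
apply: mpoly.meval_eq => i; rewrite tnth_mktuple.
rewrite {1}(coord_vbasis (memvf x)) !linear_sum /=.
apply: eq_bigr => j _.
by rewrite linearZ /= -tnth_nth mpoly.mevalZ mpoly.mevalXU mulrC.
Qed.

(** Substituting 2 x for x multiplies the coefficient of a monomial of degree d by 2^d and the whole
    polynomial by 2^M. *)
Lemma mpoly_of_homog f M : polynomial_fun f -> (forall a x, f (a *: x) = a ^+ M * f x) ->
  forall m, m \in mpoly.msupp (mpoly_of B f) -> mpoly.mdeg m = M.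
Proof.
move=> fp fh m; set q := mpoly_of B f => mq.
pose lq := [tuple (2 : R) *: mpoly.mpolyX R (mpoly.mnm1 i) | i < N].
have qE x : f x = peval B q x := mpoly_ofP fp x.
have E : mpoly.comp_mpoly lq q = 2 ^+ M *: q.
  apply/eqP; rewrite -subr_eq0; apply/eqP/(peval_eq0 Bb) => x.
  rewrite pevalD pevalN pevalZ -qE -fh qE /peval mpoly.comp_mpoly_meval.
  apply/eqP; rewrite subr_eq0; apply/eqP; apply: mpoly.meval_eq => i.
  by rewrite tnth_mktuple mpoly.mevalZ mpoly.mevalXU linearZ.
have E2 : mpoly.comp_mpoly lq q =
    \sum_(m <- mpoly.msupp q) (mpoly.mcoeff m q * 2 ^+ mpoly.mdeg m) *: mpoly.mpolyX R m.
  rewrite [q in LHS]mpoly.mpolyE raddf_sum; apply: eq_bigr => l _ /=.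
  rewrite mpoly.comp_mpolyZ mpoly.comp_mpolyX -scalerA; congr (_ *: _).
  rewrite mpoly.mdegE [in RHS]mpoly.mpolyXE_id -prodrXr.
  rewrite -scaler_prod; apply: eq_bigr => i _.
  by rewrite tnth_mktuple exprZn.
have := congr1 (mpoly.mcoeff m) E.
rewrite E2 raddf_sum /= (bigD1_seq m) ?mpoly.msupp_uniq//= big1 => [|l lm].
  rewrite addr0 !mpoly.mcoeffZ mpoly.mcoeffX eqxx mulr1 mulrC => /eqP.
  have q0 : mpoly.mcoeff m q != 0 by rewrite mpoly.mcoeff_eq0 mq.
  rewrite (inj_eq (mulIf q0)) -!natrX eqr_nat => /eqP/(expnI (isT : (1 < 2)%N)).
  by [].
by rewrite mpoly.mcoeffZ mpoly.mcoeffX (negbTE lm) mulr0.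
Qed.

End MpolyOf.

(** * Constant coefficient operators under affine maps *)

Section ChainRule.
Context (R : realType) (V W : vectType R) (n N : nat) (b : n.-tuple V) (B : N.-tuple W).
Hypotheses (bb : basis_of {:V} b) (Bb : basis_of {:W} B).
Variables (T : V -> W) (L : V -> W).
Hypothesis TL : forall x t v, T (x + t *: v) = T x + t *: L v.

Lemma monomial_deriv_comp m f :
  monomial_deriv b m (f \o T) = monomial_deriv [tuple L (tnth b i) | i < n] m f \o T.
Proof.
rewrite /monomial_deriv; elim: (enum _) => //= i s ->.
elim: (mpoly.fun_of_multinom m i) => //= k ->.
apply/funext => x; rewrite /dir_deriv /= tnth_mktuple; congr (derive1 _ _).
by apply/funext => t /=; rewrite TL.
Qed.

Variables (P Q S : mpoly.mpoly N R) (al be : R) (K : nat) (U : set W).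
Hypothesis Uopen : forall x w, U x -> \forall t \near (0 : R), U (x + t *: w).
Hypothesis UP : forall x, U x -> 0 < peval B P x.
Hypothesis UQ : forall x, U x -> 0 < peval B Q x.

(** The derivative of f o T along b_j is the derivative of f along L b_j, so the symbol gets
    composed with the transpose of L. Expanding L b_j in [B] requires the derivatives to commute;
    this is available because f belongs to the class, where they are [class_diff] operators and
    [act_comp] applies. *)
Lemma diff_op_comp_class Qf Qg s M F f : (M < K)%N ->
  polynomial_fun Qf -> polynomial_fun Qg ->
  (forall a x, Qf (a *: x) = a ^+ M * Qf x) -> (forall a x, Qg (a *: x) = a ^+ M * Qg x) ->
  (forall x, Qf (\sum_j (\sum_i coord B i (L (tnth b j)) * coord B i x) *: tnth b j) = s * Qg x) ->
  (forall x, U x -> f x = class_at B P Q S al be K 0 F x) ->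
  forall x, U (T x) -> diff_op b Qf (f \o T) x = s * diff_op B Qg f (T x).
Proof.
move=> MK pf pg hf hg fg fE x UTx.
have homf := mpoly_of_homog bb pf hf; have homg := mpoly_of_homog Bb pg hg.
rewrite (diff_op_class Uopen UP UQ MK homg fE UTx).
pose Lb := [tuple L (tnth b i) | i < n].
have -> : diff_op b Qf (f \o T) x = class_at B P Q S al be K M
    (act (fun i => class_diff B P Q S al be K (tnth Lb i)) (mpoly_of b Qf) F) (T x).
  rewrite /diff_op /act /class_at /class_fun fct_sumE peval_sum mulr_sumr.
  apply: eq_big_seq => m mQ; rewrite monomial_deriv_comp /=.
  rewrite (monomial_deriv_class Uopen UP UQ Lb _ fE)// ?homf// /class_at /class_fun.
  by rewrite fctE pevalZ mulrCA.
rewrite (@act_comp _ _ _ _ (fun i => class_diff B P Q S al be K (tnth B i)) _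
  (fun j i => coord B i (L (tnth b j)))).
- set lq := [tuple _ | _ < _].
  have -> : mpoly.comp_mpoly lq (mpoly_of b Qf) = s *: mpoly_of B Qg.
    apply/eqP; rewrite -subr_eq0; apply/eqP/(peval_eq0 Bb) => y.
    rewrite pevalD pevalN pevalZ -(mpoly_ofP Bb pg) -fg (mpoly_ofP bb pf).
    apply/eqP; rewrite subr_eq0; apply/eqP.
    rewrite /peval mpoly.comp_mpoly_meval; apply: mpoly.meval_eq => j.
    rewrite tnth_mktuple [LHS]peval_sum.
    under [X in coord b j X]eq_bigr do rewrite (tnth_nth 0).
    rewrite coord_sum_free ?(basis_free bb)//; apply: eq_bigr => i _.
    by rewrite pevalZ pevalX (tnth_nth 0).
  by rewrite actZ /class_at /class_fun fctE pevalZ mulrCA.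
- by move=> i a F1 F2; exact: class_diffP.
- by move=> i j F1; exact: class_diffC.
- move=> j F1; rewrite tnth_mktuple.
  have D0 : class_diff B P Q S al be K 0 F1 = 0.
    by have := class_diff_dir B P Q S al be K (-1) 0 0 F1; rewrite scaler0 addr0 scaleN1r addNr.
  have DD v w : class_diff B P Q S al be K (v + w) F1 =
      class_diff B P Q S al be K v F1 + class_diff B P Q S al be K w F1.
    by rewrite -[v in LHS]scale1r class_diff_dir scale1r.
  rewrite {1}(coord_basis Bb (memvf (L (tnth b j)))).
  rewrite (big_morph (fun v => class_diff B P Q S al be K v F1) DD D0).
  apply: eq_bigr => i _.
  by rewrite -[_ *: _`_i]addr0 class_diff_dir D0 addr0 -tnth_nth.
Qed.

End ChainRule.

(** * Families of polynomials with controlled coefficients *)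

Section Families.
Context (R : realType) (Theta : Type) (A : (Theta -> R) -> Prop).
Hypothesis Ac : forall a, A (fun=> a).
Hypothesis AD : forall f g, A f -> A g -> A (fun t => f t + g t).
Hypothesis AM : forall f g, A f -> A g -> A (fun t => f t * g t).
Context (W : vectType R) (N : nat) (B : N.-tuple W).
Local Notation MP := (mpoly.mpoly N R).

(* Families of polynomials whose coefficients belong to [A]. *)
Inductive mfam : (Theta -> MP) -> Prop :=
| mfam_base a q : A a -> mfam (fun t => a t *: q)
| mfam_add F G : mfam F -> mfam G -> mfam (fun t => F t + G t)
| mfam_mul F G : mfam F -> mfam G -> mfam (fun t => F t * G t).

Lemma mfam_cst q : mfam (fun=> q).
Proof.
have := mfam_base q (Ac 1).
by rewrite (_ : (fun _ => _) = (fun=> q))//; apply/funext => t; rewrite scale1r.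
Qed.

Lemma mfam_scale a F : A a -> mfam F -> mfam (fun t => a t *: F t).
Proof.
move=> Aa Fm; have := mfam_mul (mfam_base 1 Aa) Fm.
by rewrite (_ : (fun _ => _) = (fun t => a t *: F t))//; apply/funext => t;
  rewrite -scalerAl mul1r.
Qed.

Lemma mfam_sum I (s : seq I) (F : I -> Theta -> MP) :
  (forall i, mfam (F i)) -> mfam (fun t => \sum_(i <- s) F i t).
Proof.
move=> Fm; elim: s => [|i s IH].
  rewrite (_ : (fun _ => _) = (fun=> 0)); first exact: mfam_cst.
  by apply/funext => t; rewrite big_nil.
rewrite (_ : (fun _ => _) = (fun t => F i t + \sum_(j <- s) F j t)).
  exact: mfam_add.
by apply/funext => t; rewrite big_cons.
Qed.

Lemma mfam_pderiv w F : mfam F -> mfam (fun t => pderiv B w (F t)).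
Proof.
elim=> [a q Aa|{}F G _ IF _ IG|{}F G Fm IF Gm IG].
- rewrite (_ : (fun _ => _) = (fun t => a t *: pderiv B w q)); first exact: mfam_base.
  by apply/funext => t; rewrite pderivZ.
- rewrite (_ : (fun _ => _) = (fun t => pderiv B w (F t) + pderiv B w (G t))).
    exact: mfam_add.
  by apply/funext => t; rewrite pderivD.
- rewrite (_ : (fun _ => _) = (fun t => pderiv B w (F t) * G t + F t * pderiv B w (G t))).
    by apply: mfam_add; exact: mfam_mul.
  by apply/funext => t; rewrite pderivM.
Qed.

Lemma mfam_peval x F : mfam F -> A (fun t => peval B (F t) x).
Proof.
elim=> [a q Aa|{}F G _ IF _ IG|{}F G Fm IF Gm IG].
- rewrite (_ : (fun _ => _) = (fun t => a t * peval B q x)).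
    by apply: AM.
  by apply/funext => t; rewrite pevalZ.
- rewrite (_ : (fun _ => _) = (fun t => peval B (F t) x + peval B (G t) x)).
    exact: AD.
  by apply/funext => t; rewrite pevalD.
- rewrite (_ : (fun _ => _) = (fun t => peval B (F t) x * peval B (G t) x)).
    exact: AM.
  by apply/funext => t; rewrite pevalM.
Qed.

Lemma mfam_comp n (q : mpoly.mpoly n R) (l : Theta -> 'I_n -> MP) :
  (forall i, mfam (fun t => l t i)) ->
  mfam (fun t => mpoly.comp_mpoly [tuple l t i | i < n] q).
Proof.
move=> lm; elim/mpoly_ring_ind: q => [a|i|p q Hp Hq|p q Hp Hq].
- rewrite (_ : (fun _ => _) = (fun=> mpoly.mpolyC N a)); first exact: mfam_cst.
  by apply/funext => t; rewrite mpoly.comp_mpolyC.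
- rewrite (_ : (fun _ => _) = (fun t => l t i)); first exact: lm.
  by apply/funext => t; rewrite mpoly.comp_mpolyXU -tnth_nth tnth_mktuple.
- rewrite (_ : (fun _ => _) = (fun t => mpoly.comp_mpoly [tuple l t i | i < n] p +
    mpoly.comp_mpoly [tuple l t i | i < n] q)); first exact: mfam_add.
  by apply/funext => t; rewrite mpoly.comp_mpolyD.
- rewrite (_ : (fun _ => _) = (fun t => mpoly.comp_mpoly [tuple l t i | i < n] p *
    mpoly.comp_mpoly [tuple l t i | i < n] q)); first exact: mfam_mul.
  by apply/funext => t; rewrite rmorphM.
Qed.

Variables (P Q S : Theta -> MP) (al be : R) (K : nat).
Hypotheses (Pm : mfam P) (Qm : mfam Q) (Sm : mfam S).

Lemma mfam_class_step al' be' nu w F : mfam F ->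
  mfam (fun t => class_step B (P t) (Q t) (S t) al' be' nu w (F t)).
Proof.
move=> Fm; rewrite /class_step.
have Cm a : mfam (fun=> mpoly.mpolyC N a) by exact: mfam_cst.
have dP := mfam_pderiv w Pm; have dQ := mfam_pderiv w Qm; have dS := mfam_pderiv w Sm.
have dF := mfam_pderiv w Fm.
by do !(apply: mfam_add || apply: mfam_mul).
Qed.

Lemma mfam_class_diff w (F : Theta -> nat -> MP) : (forall j, mfam (F^~ j)) ->
  forall j, mfam (fun t => class_diff B (P t) (Q t) (S t) al be K w (F t) j).
Proof.
move=> Fm [|j]; first exact: mfam_cst.
exact: mfam_class_step.
Qed.

(** The iterated derivatives are built from P, Q, S and the initial polynomial by sums, products and
    derivatives, so their coefficients stay in any algebra [A] of parameter functions. It serves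
    both for bounded functions of a chart and for functions of eps continuous at 0. *)
Lemma mfam_act n (ws : 'I_n -> W) (q : mpoly.mpoly n R) (F : Theta -> nat -> MP) :
  (forall j, mfam (F^~ j)) -> forall j, mfam (fun t =>
    act (fun i => class_diff B (P t) (Q t) (S t) al be K (ws i)) q (F t) j).
Proof.
move=> Fm j.
have E t : act (fun i => class_diff B (P t) (Q t) (S t) al be K (ws i)) q (F t) j =
    \sum_(m <- mpoly.msupp q) mpoly.mcoeff m q *:
      act_monomial (fun i => class_diff B (P t) (Q t) (S t) al be K (ws i)) m (F t) j.
  by rewrite /act fct_sumE.
rewrite (_ : (fun _ => _) = (fun t => \sum_(m <- mpoly.msupp q) mpoly.mcoeff m q *:
      act_monomial (fun i => class_diff B (P t) (Q t) (S t) al be K (ws i)) m (F t) j)).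
  apply: mfam_sum => m; apply: (mfam_scale (a := fun=> mpoly.mcoeff m q)); first exact: Ac.
  clear E; rewrite /act_monomial; move: j.
  elim: (enum _) => //= i s IH.
  by elim: (mpoly.fun_of_multinom m i) => //= k IHk; apply: mfam_class_diff.
by apply/funext => t; rewrite E.
Qed.

End Families.

(** * Translation invariance of Lebesgue measure on tuples *)

Section Translation.
Context (R : realType).
Local Notation mR := (measurableTypeR R).

Lemma measurable_shift (a : R) : measurable_fun [set: mR] (fun x : mR => x + a : mR).
Proof. by apply: measurable_funD; [exact: measurable_id | exact: measurable_cst]. Qed.

Lemma lebesgue_measure_shift (a : R) (A : set mR) : measurable A ->
  lebesgue_measure ((fun x : mR => x + a : mR) @^-1` A) = lebesgue_measure A.
Proof.
move=> mA; pose s (x : mR) : mR := x + a.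
pose mu := measure_function_pushforward__canonical__measure_function_Measure
  (@lebesgue_measure R) (measurable_shift a).
have : lebesgue_measure A = mu A.
  apply: (@lebesgue_measure_unique R mu) => // X [[u v] _ /= <-].
  rewrite /mu /= /pushforward.
  have -> : (fun x : mR => x + a : mR) @^-1` `]u, v] = `]u - a, v - a].
    by apply/seteqP; split=> x /=; rewrite !in_itv /= ltrBlDr lerBrDr.
  rewrite !lebesgue_measure_itv /= !lte_fin ltrD2r.
  by case: ifP => // _; rewrite !EFinB; congr (_%:E); ring.
by move=> ->.
Qed.

Lemma ge0_integral_shift (a : R) (f : mR -> \bar R) : measurable_fun setT f ->
  (forall x, (0 <= f x)%E) ->
  (\int[lebesgue_measure]_x f (x + a)%R = \int[lebesgue_measure]_x f x)%E.
Proof.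
move=> mf f0.
have := @ge0_integral_pushforward _ _ _ _ _ _ (measurable_shift a) (@lebesgue_measure R) setT f
  measurableT mf (fun x _ => f0 x).
rewrite preimage_setT /= => <-.
apply: eq_measure_integral; first exact: measurable_shift.
by move=> ? A mA _; exact: lebesgue_measure_shift.
Qed.

Definition tuple_add n (s t : n.-tuple mR) : n.-tuple mR :=
  [tuple (tnth t i + tnth s i : R) | i < n].

Lemma measurable_tuple_add n (s : n.-tuple mR) : measurable_fun setT (tuple_add s).
Proof.
apply/measurable_fun_tnthP => i.
have -> : (tnth (T:=mR))^~ i \o tuple_add s = (fun t => tnth t i + tnth s i).
  by apply/funext => t /=; rewrite tnth_mktuple.
by apply: measurable_funD; [exact: measurable_tnth | exact: measurable_cst].
Qed.

Lemma lebesgue_tuple_shift n (s : n.-tuple mR) (A : set (n.-tuple mR)) : measurable A ->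
  lebesgue_tuple R n (tuple_add s @^-1` A) = lebesgue_tuple R n A.
Proof.
elim: n s A => [|n IH] s A mA.
  have -> // : tuple_add s @^-1` A = A.
  by congr (_ @^-1` A); apply/funext => t; rewrite (tuple0 t) (tuple0 (tuple_add s _)).
rewrite /= /measure_tcons /pushforward /product_measure1.
set A' := @tcons _ mR n @^-1` A.
have mA' : measurable A'.
  by rewrite -[A']setTI; exact: measurable_tcons.
pose s' : n.-tuple mR := [tuple of behead s].
have E x : xsection (@tcons _ mR n @^-1` (tuple_add s @^-1` A)) x =
    tuple_add s' @^-1` (xsection A' (x + thead s)).
  have K t : tuple_add s (tcons (x, t)) = tcons ((x + thead s)%R, tuple_add s' t).
    apply: eq_from_tnth => i; rewrite tnth_mktuple.
    case: (unliftP ord0 i) => [j|] ->; last by rewrite !tnth0.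
    rewrite !tnthS tnth_mktuple; congr (_ + _).
    by rewrite !(tnth_nth 0) /= nth_behead.
  by apply/seteqP; split=> t; rewrite /xsection /A' /= !inE /= K.
transitivity (\int[@lebesgue_measure R]_x (lebesgue_tuple R n (xsection A' (x + thead s)%R)))%E.
  apply: eq_integral => x _ /=; rewrite E IH//.
  exact: measurable_xsection.
apply: (@ge0_integral_shift (thead s) (fun x => lebesgue_tuple R n (xsection A' x))) => //.
exact: measurable_fun_xsection.
Qed.

End Translation.

(** * Integrals of directional derivatives vanish *)

Section IntegrationByParts.
Context (R : realType) (V : vectType R) (n : nat) (b : n.-tuple V).
Hypothesis bb : basis_of {:V} b.
Local Notation mR := (measurableTypeR R).
Local Notation oc := (of_coord b).
Local Notation mu := (lebesgue_tuple R n).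

Lemma coord_of_coord i t : coord b i (oc t) = tnth t i.
Proof.
rewrite /of_coord; under eq_bigr do rewrite (tnth_nth 0 b).
by rewrite coord_sum_free// (basis_free bb).
Qed.

Definition coord_tuple (w : V) : n.-tuple mR := [tuple (coord b i w : mR) | i < n].

Lemma of_coord_add t w : oc (tuple_add (coord_tuple w) t) = oc t + w.
Proof.
rewrite /of_coord {2}(coord_basis bb (memvf w)) -big_split; apply: eq_bigr => i _.
by rewrite !tnth_mktuple scalerDl -tnth_nth.
Qed.

Lemma measurable_peval q : measurable_fun setT (fun t => peval b q (oc t)).
Proof.
elim/mpoly_ring_ind: q => [a|i|p q Hp Hq|p q Hp Hq].
- by rewrite (_ : (fun _ => _) = cst a); [exact: measurable_cst|apply/funext => t; rewrite pevalC].
- rewrite (_ : (fun _ => _) = (fun t => tnth t i)); first exact: measurable_tnth.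
  by apply/funext => t; rewrite pevalX coord_of_coord.
- rewrite (_ : (fun _ => _) = (fun t => peval b p (oc t) + peval b q (oc t))).
    exact: measurable_funD.
  by apply/funext => t; rewrite pevalD.
- rewrite (_ : (fun _ => _) = (fun t => peval b p (oc t) * peval b q (oc t))).
    exact: measurable_funM.
  by apply/funext => t; rewrite pevalM.
Qed.

Definition cube (rho : R) : set (n.-tuple mR) := [set t | forall i, `|tnth t i| <= rho].

Lemma cubeE rho : cube rho = [set t | forall i, `[- rho, rho] (tnth t i)].
Proof.
by rewrite set_itvcc; apply/seteqP; split=> t /= h i; have := h i; rewrite ler_norml.
Qed.

Lemma measurable_cube rho : measurable (cube rho).
Proof.
rewrite cubeE (_ : [set _ | _] =
    \bigcap_(i in setT) ((@tnth n mR)^~ i @^-1` `[- rho, rho])); last first.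
  by apply/seteqP; split=> t /= h i; [move=> _; exact: (h i) | exact: (h i I)].
apply: fin_bigcap_measurable => // i _.
by rewrite -[_ @^-1` _]setTI; apply: measurable_tnth.
Qed.

Lemma cube_lty rho : (mu (cube rho) < +oo)%E.
Proof.
rewrite cubeE (@lebesgue_tuple_box R n (fun=> `[- rho, rho]))//.
rewrite big_const_ord; elim: n => [|k IH] /=; first by rewrite ltry.
rewrite lte_mul_pinfty//.
rewrite ge0_fin_numE// lebesgue_measure_itv /=.
by case: ifP => // _; rewrite -EFinB ltry.
Qed.

Definition bounded_support (f : V -> R) := exists rho C,
  [/\ measurable_fun setT (f \o oc), forall v, `|f v| <= C &
      forall v i, rho < `|coord b i v| -> f v = 0].

Lemma integrable_bound rho (C : R) : mu.-integrable setT (fun t => (C * \1_(cube rho) t)%:E).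
Proof.
under eq_fun do rewrite EFinM.
apply: integrableZl => //.
have mc := measurable_cube rho.
apply/integrableP; split; first exact/measurable_EFinP/measurable_indic.
rewrite (eq_integral (fun x => (\1_(cube rho) x)%:E)); last first.
  by move=> t _; rewrite gee0_abs// lee_fin.
by rewrite integral_indic// setIT cube_lty.
Qed.

Lemma bounded_support_le f : bounded_support f -> exists rho C, measurable_fun setT (f \o oc) /\
  forall t, `|f (oc t)| <= C * \1_(cube rho) t.
Proof.
move=> [rho [C [mf fC f0]]]; exists rho, C; split=> // t.
rewrite indicE; have [_|] := boolP (t \in cube rho); first by rewrite mulr1.
rewrite notin_setE => /existsNP[i /negP]; rewrite -ltNge => ti.
by rewrite (f0 _ i) ?normr0 ?mulr0// coord_of_coord.
Qed.

Lemma bounded_support_integrable f : bounded_support f ->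
  mu.-integrable setT (fun t => (f (oc t))%:E).
Proof.
move=> /bounded_support_le[rho [C [mf fC]]].
apply: (le_integrable measurableT _ _ (integrable_bound rho C)) => //.
  exact/measurable_EFinP.
move=> t _; by rewrite !abse_EFin lee_fin (le_trans (fC t))// ler_norm.
Qed.

Lemma bounded_supportM (f g : V -> R) : bounded_support f -> measurable_fun setT (g \o oc) ->
  (forall rho, exists C : R, 0 <= C /\ forall v, (forall i, `|coord b i v| <= rho) -> `|g v| <= C) ->
  bounded_support (fun v => f v * g v).
Proof.
move=> [rho [C [mf fC f0]]] mg gb; have [C' [C'0 gC']] := gb rho.
exists rho, (C * C'); split.
- exact: (measurable_funM mf mg).
- move=> v; have [/existsP[i vi]|] := boolP [exists i, rho < `|coord b i v|].
    rewrite (f0 _ _ vi) mul0r normr0 mulr_ge0//; exact: le_trans (fC 0).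
  rewrite negb_exists => /forallP vi; rewrite normrM ler_pM//.
  by apply: gC' => i; rewrite leNgt.
- by move=> v i vi; rewrite (f0 _ _ vi) mul0r.
Qed.

Lemma integral_translate (f : V -> R) w : measurable_fun setT (f \o oc) ->
  mu.-integrable setT (fun t => (f (oc t + w))%:E) ->
  (\int[mu]_t (f (oc t + w))%:E = \int[mu]_t (f (oc t))%:E)%E.
Proof.
move=> mf fi.
have E : (fun t => (f (oc t + w))%:E) =
    (EFin \o (f \o oc)) \o tuple_add (coord_tuple w).
  by apply/funext => t /=; rewrite of_coord_add.
have mEf : measurable_fun setT (EFin \o (f \o oc)) by exact/measurable_EFinP.
rewrite E in fi; rewrite [in LHS]E.
have := @integral_pushforward _ _ _ _ _ _ (measurable_tuple_add (coord_tuple w)) mu setT _ mEf.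
rewrite preimage_setT => /(_ fi measurableT) <-.
apply: eq_measure_integral; first exact: measurable_tuple_add.
by move=> ? A mA _; exact: lebesgue_tuple_shift.
Qed.

(** Difference quotients have integral zero by translation invariance. The mean value theorem bounds
    them by the bound of f', they vanish outside a fixed cube, and dominated convergence gives the
    claim without any use of iterated integrals. *)
Lemma integral_deriv_eq0 (f f' : V -> R) w : bounded_support f ->
  (forall x, is_derive (0 : R) 1 (fun t => f (x + t *: w)) (f' x)) ->
  (exists C, forall x, `|f' x| <= C) ->
  (\int[mu]_t (f' (oc t))%:E = 0)%E.
Proof.
move=> fb df [C f'C].
have [rho [C0 [mf fC0 f0]]] := fb.
have diff (x : V) (s : R) : is_derive s 1 (fun t : R => f (x + t *: w)) (f' (x + s *: w)).
  have := df (x + s *: w); rewrite !is_derive1_caratheodory => -[g [gE gc g0]].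
  exists (fun z => g (z - s)); split.
  - move=> z; have := gE (z - s).
    by rewrite -addrA -scalerDl (addrC s) subrK !subr0 scale0r addr0.
  - apply: (continuous_comp (f := fun z => z - s)).
      by apply: continuousB => //; exact: cst_continuous.
    by rewrite subrr.
  - by rewrite subrr.
pose u (m : nat) : R := m.+1%:R^-1.
have u0 m : 0 < u m by rewrite invr_gt0 ltr0n.
pose D m t := (f (oc t + u m *: w) - f (oc t)) / u m.
have DC m t : `|D m t| <= C.
  have [||s _ H] := @MVT_segment R (fun h => f (oc t + h *: w))
      (fun h => f' (oc t + h *: w)) 0 (u m).
  - exact: ltW.
  - apply: continuous_subspaceT => y.
    have := @ex_derive _ _ _ _ _ _ _ (diff (oc t) y).
    by move=> /derivable1_diffP/differentiable_continuous.
  by rewrite /= scale0r addr0 subr0 in H; rewrite /D H mulfK ?gt_eqF.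
(* The steps u m are at most 1, so this enlarged cube contains the supports of all difference
   quotients. *)
pose rho' := rho + \sum_i `|coord b i w|.
have wle i : `|coord b i w| <= \sum_i `|coord b i w|.
  by rewrite (bigD1 i)//= lerDl sumr_ge0.
have D0 m t i : rho' < `|tnth t i| -> D m t = 0.
  move=> ti; have w0 := wle i; have ci := coord_of_coord i t.
  rewrite /D !(f0 _ i) ?subrr ?mul0r// ?ci.
    by have := normr_ge0 (coord b i w); rewrite /rho' in ti; lra.
  rewrite linearD linearZ /= ci.
  have h1 : `|u m * coord b i w| <= `|coord b i w|.
    rewrite normrM gtr0_norm// ler_piMl// /u invf_le1 ?ltr0n// ler1n//.
  have h2 := ler_normB (tnth t i + u m * coord b i w) (u m * coord b i w).
  by rewrite addrK in h2; rewrite /rho' in ti; lra.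
have fw m : measurable_fun setT (fun t => f (oc t + u m *: w)).
  rewrite (_ : (fun _ => _) = (f \o oc) \o tuple_add (coord_tuple (u m *: w))).
    by apply: measurableT_comp => //; exact: measurable_tuple_add.
  by apply/funext => t /=; rewrite of_coord_add.
have mD m : measurable_fun setT (D m).
  apply: measurable_funM; last exact: measurable_cst.
  exact: measurable_funB.
have Dcvg t : D m t @[m --> \oo] --> f' (oc t).
  have := df (oc t); rewrite is_derive1_caratheodory => -[g [gE gc <-]].
  have -> : (fun m => D m t) = (fun m => g (u m)).
    apply/funext => m; rewrite /D; have := gE (u m).
    by rewrite scale0r addr0 subr0 => ->; rewrite mulfK ?gt_eqF.
  apply: continuous_cvg => //; exact: cvg_harmonic.
have intD m : (\int[mu]_t (D m t)%:E = 0)%E.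
  have fi := bounded_support_integrable fb.
  have fwb : bounded_support (fun v => f (v + u m *: w)).
    exists rho', C0; split=> //; first exact: fw.
    move=> v i vi; apply: (f0 _ i); have w0 := wle i.
    rewrite linearD linearZ /=.
    have h1 : `|u m * coord b i w| <= `|coord b i w|.
      by rewrite normrM gtr0_norm// ler_piMl// /u invf_le1 ?ltr0n// ler1n.
    have h2 := ler_normB (coord b i v + u m * coord b i w) (u m * coord b i w).
    by rewrite addrK in h2; rewrite /rho' in vi; lra.
  have fwi := bounded_support_integrable fwb.
  have -> : (fun t => (D m t)%:E) =
      (fun t => ((u m)^-1%:E * ((f (oc t + u m *: w))%:E - (f (oc t))%:E))%E).
    by apply/funext => t; rewrite /D -EFinB -EFinM mulrC.
  rewrite integralZl//; last exact: integrableB.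
  rewrite integralB// integral_translate// subee ?mule0//.
  exact: integrable_fin_num.
have := @dominated_cvg _ _ _ mu setT measurableT (fun m t => (D m t)%:E)
  (fun t => (f' (oc t))%:E) (fun t => (C * \1_(cube rho') t)%:E).
move=> H; have {}H := H _ _ _ (integrable_bound _ _) _.
have : (fun m => \int[mu]_t (D m t)%:E)%E @ \oo --> (\int[mu]_t (f' (oc t))%:E)%E.
  apply: H.
  - by move=> m; exact/measurable_EFinP.
  - by move=> t _; apply: cvg_EFin; [exact: nearW|exact: Dcvg].
  - by [].
  - move=> m t _; rewrite abse_EFin lee_fin indicE.
    have [_|] := boolP (t \in cube rho'); first by rewrite mulr1.
    rewrite notin_setE => /existsNP[i /negP]; rewrite -ltNge => /D0 ->.
    by rewrite normr0 mulr0.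
under eq_fun do rewrite intD.
by move=> H0; apply/esym; apply: (cvg_unique (@ereal_hausdorff R) _ H0); exact: cvg_cst.
Qed.

End IntegrationByParts.

(** * Affine substitutions, degrees and bounds of polynomials *)

Section AffineComposition.
Context (R : realType) (V W : vectType R) (n N : nat) (b : n.-tuple V) (B : N.-tuple W).
Hypotheses (bb : basis_of {:V} b) (Bb : basis_of {:W} B).

Definition affine_tuple (y0 : W) (L : V -> W) : N.-tuple (mpoly.mpoly n R) :=
  [tuple mpoly.mpolyC n (coord B i y0) +
     \sum_j coord B i (L (tnth b j)) *: mpoly.mpolyX R (mpoly.mnm1 j) | i < N].

Lemma linear_coord_sum (L : V -> W) x : (forall a u v, L (a *: u + v) = a *: L u + L v) ->
  L x = \sum_j coord b j x *: L (tnth b j).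
Proof.
move=> LP.
have LD u v : L (u + v) = L u + L v by rewrite -[u]scale1r LP !scale1r.
have L0 : L 0 = 0 by apply: (addrI (L 0)); rewrite -LD !addr0.
rewrite {1}(coord_basis bb (memvf x)) (big_morph L LD L0); apply: eq_bigr => j _.
by rewrite -[_ *: _]addr0 LP L0 addr0 -tnth_nth.
Qed.

Lemma peval_affine q y0 (L : V -> W) x : (forall a u v, L (a *: u + v) = a *: L u + L v) ->
  peval b (mpoly.comp_mpoly (affine_tuple y0 L) q) x = peval B q (y0 + L x).
Proof.
move=> LP; rewrite /peval mpoly.comp_mpoly_meval; apply: mpoly.meval_eq => i.
rewrite tnth_mktuple [LHS]pevalD pevalC peval_sum linearD; congr (_ + _).
rewrite (linear_coord_sum x LP) linear_sum; apply: eq_bigr => j _.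
by rewrite pevalZ pevalX linearZ /= mulrC.
Qed.

Lemma polynomial_fun_affine f y0 (L : V -> W) :
  (forall a u v, L (a *: u + v) = a *: L u + L v) ->
  polynomial_fun f -> polynomial_fun (fun x => f (y0 + L x)).
Proof.
move=> LP /(polynomial_fun_basis Bb)[p pE].
rewrite (_ : (fun _ => _) = peval b (mpoly.comp_mpoly (affine_tuple y0 L) p)).
  exact: polynomial_peval.
by apply/funext => x; rewrite peval_affine// pE.
Qed.

End AffineComposition.

Section Degrees.
Context (R : realType) (n : nat).
Local Notation MP := (mpoly.mpoly n R).
Implicit Types p q : MP.

(** [msize] is the degree plus one, and 0 for the zero polynomial, which thus satisfies every
    bound. *)
Definition deg_le p d := (mpoly.msize p <= d.+1)%N.

Lemma deg_leW p d d' : (d <= d')%N -> deg_le p d -> deg_le p d'.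
Proof. by move=> dd /leq_trans; apply. Qed.

Lemma deg_leC a : deg_le (mpoly.mpolyC n a) 0.
Proof. by rewrite /deg_le mpoly.msizeC leq_b1. Qed.

Lemma deg_leX i : deg_le (mpoly.mpolyX R (mpoly.mnm1 i)) 1.
Proof. by rewrite /deg_le mpoly.msizeX mpoly.mdeg1. Qed.

Lemma deg_leD p q d : deg_le p d -> deg_le q d -> deg_le (p + q) d.
Proof.
by move=> pd qd; rewrite /deg_le (leq_trans (mpoly.msizeD_le _ _))// geq_max; apply/andP.
Qed.

Lemma deg_leM p q d d' : deg_le p d -> deg_le q d' -> deg_le (p * q) (d + d').
Proof.
rewrite /deg_le; have [->|p0] := eqVneq p 0; first by rewrite mul0r mpoly.msize0.
have [->|q0] := eqVneq q 0; first by rewrite mulr0 mpoly.msize0.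
move=> pd qd; rewrite mpoly.msizeM//.
by move: (mpoly.msize p) (mpoly.msize q) pd qd => x y; lia.
Qed.

Lemma deg_leZ a p d : deg_le p d -> deg_le (a *: p) d.
Proof. by move=> pd; rewrite -mpoly.mul_mpolyC -[d]add0n; apply: deg_leM => //; exact: deg_leC. Qed.

Lemma deg_leX_exp p d k : deg_le p d -> deg_le (p ^+ k) (k * d).
Proof.
move=> pd; elim: k => [|k IH]; first by rewrite expr0 -mpoly.mpolyC1 deg_leC.
by rewrite exprS mulSn; exact: deg_leM.
Qed.

Lemma deg_le_sum I (s : seq I) (F : I -> MP) d :
  (forall i, deg_le (F i) d) -> deg_le (\sum_(i <- s) F i) d.
Proof.
move=> Fd; elim/big_rec: _ => [|i p _ pd]; first by rewrite /deg_le mpoly.msize0.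
exact: deg_leD.
Qed.

Lemma msize_mderiv i p d :
  (mpoly.msize p <= d.+1)%N -> (mpoly.msize (mpoly.mderiv i p) <= d)%N.
Proof.
move=> pd; rewrite mpoly.msizeE.
rewrite big_seq; elim/big_ind: _ => // [x y xd yd|m]; first by rewrite geq_max xd.
rewrite mpoly.mcoeff_msupp mpoly.mcoeff_mderiv mulrn_eq0 /= => mp.
have : mpoly.mnm_add m (mpoly.mnm1 i) \in mpoly.msupp p.
  by rewrite mpoly.mcoeff_msupp; exact: mp.
move=> /mpoly.msize_mdeg_lt; rewrite mpoly.mdegD mpoly.mdeg1 => /leq_trans/(_ pd).
by rewrite addn1 ltnS.
Qed.

Lemma deg_le_prod I (t : seq I) (F : I -> MP) (w : I -> nat) :
  (forall i, deg_le (F i) (w i)) -> deg_le (\prod_(i <- t) F i) (\sum_(i <- t) w i)%N.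
Proof.
move=> Fw; elim/big_rec2: _ => [|i d p _ pd]; first by rewrite -mpoly.mpolyC1 deg_leC.
exact: deg_leM.
Qed.

Lemma deg_le_homog p d : (forall m, m \in mpoly.msupp p -> mpoly.mdeg m = d) -> deg_le p d.
Proof.
move=> pd; rewrite /deg_le mpoly.msizeE big_seq.
by elim/big_ind: _ => // [x y xd yd|m /pd -> //]; rewrite geq_max xd.
Qed.

End Degrees.

Section DegreeComposition.
Context (R : realType) (n k : nat) (l : n.-tuple (mpoly.mpoly k R)).
Hypothesis l1 : forall i, deg_le (tnth l i) 1.

Lemma deg_le_comp q d : deg_le q d -> deg_le (mpoly.comp_mpoly l q) d.
Proof.
move=> qd; rewrite [q]mpoly.mpolyE raddf_sum big_seq.
elim/big_ind: _ => [|x y xd yd|m mq] /=; first by rewrite /deg_le mpoly.msize0.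
  exact: deg_leD.
rewrite mpoly.comp_mpolyZ mpoly.comp_mpolyX; apply: deg_leZ.
apply: (@deg_leW _ _ _ (mpoly.mdeg m)).
  by have := mpoly.msize_mdeg_lt mq; rewrite /deg_le in qd => /leq_trans/(_ qd).
rewrite mpoly.mdegE; apply: deg_le_prod => i.
by rewrite -[X in deg_le _ X]muln1; exact: deg_leX_exp.
Qed.

End DegreeComposition.

Section Evaluation.
Context (R : realType) (V : vectType R) (n : nat) (b : n.-tuple V).
Hypothesis bb : basis_of {:V} b.
Implicit Type q : mpoly.mpoly n R.

Lemma deg_le_affine (W : vectType R) N (B : N.-tuple W) (y0 : W) (L : V -> W)
    (p : mpoly.mpoly N R) d :
  deg_le p d -> deg_le (mpoly.comp_mpoly (affine_tuple b B y0 L) p) d.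
Proof.
apply: deg_le_comp => i; rewrite tnth_mktuple; apply: deg_leD.
  by apply: (@deg_leW _ _ _ 0) => //; exact: deg_leC.
by apply: deg_le_sum => j; apply: deg_leZ; exact: deg_leX.
Qed.

Lemma size_pline q x w d : deg_le q d -> (size (pline b q x w) <= d.+1)%N.
Proof.
move=> qd; rewrite /pline /mpoly.mmap.
rewrite big_seq; elim/big_ind: _ => [|p p' pd pd'|m mq]; first by rewrite size_poly0.
  by rewrite (leq_trans (size_polyD _ _))// geq_max pd.
rewrite mul_polyC (leq_trans (size_scale_leq _ _))//.
have := mpoly.msize_mdeg_lt mq; rewrite /deg_le in qd => /leq_trans/(_ qd).
apply: leq_trans; rewrite mpoly.mdegE /mpoly.mmap1.
elim/big_rec2: _ => [|i p k _ pk]; first by rewrite size_poly1.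
rewrite (leq_trans (size_polyMleq _ _))//.
set g := (coord b i x)%:P + _; have g2 : (size g <= 2)%N.
  rewrite (leq_trans (size_polyD _ _))// geq_max (leq_trans (size_polyC_leq1 _))//.
  by rewrite mul_polyC (leq_trans (size_scale_leq _ _))// size_polyX.
have := size_poly_exp_leq g (mpoly.fun_of_multinom m i).
move: (size (polyseq (g ^+ _))) (size p) pk g2 => u v.
by move: (size g) (mpoly.fun_of_multinom m i) => [|[|[|a]]] c //=; lia.
Qed.

Lemma msize_pderiv w q d : (mpoly.msize q <= d.+1)%N -> (mpoly.msize (pderiv b w q) <= d)%N.
Proof.
move=> qd; rewrite /pderiv; elim/big_ind: _ => [|p p' pd pd'|i _].
- by rewrite mpoly.msize0.
- by rewrite (leq_trans (mpoly.msizeD_le _ _))// geq_max pd.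
- by rewrite (leq_trans (mpoly.msizeZ_le _ _))// msize_mderiv.
Qed.

Lemma peval_bounded q (rho : R) : exists C : R, 0 <= C /\
  forall v, (forall i, `|coord b i v| <= rho) -> `|peval b q v| <= C.
Proof.
elim/mpoly_ring_ind: q => [a|i|p q [C [C0 pC]] [D [D0 qD]]|p q [C [C0 pC]] [D [D0 qD]]].
- by exists `|a|; split=> // v _; rewrite pevalC.
- exists (Num.max rho 0); split; first by rewrite le_max lexx orbT.
  by move=> v vr; rewrite pevalX le_max vr.
- exists (C + D); split=> [|v vr]; first exact: addr_ge0.
  by rewrite pevalD (le_trans (ler_normD _ _))// lerD ?pC ?qD.
- exists (C * D); split=> [|v vr]; first exact: mulr_ge0.
  by rewrite pevalM normrM ler_pM ?pC ?qD.
Qed.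

Lemma measurable_linear (f : V -> R) : (forall a u v, f (a *: u + v) = a * f u + f v) ->
  measurable_fun setT (f \o of_coord b).
Proof.
move=> fP.
pose q : mpoly.mpoly n R := \sum_j f (tnth b j) *: mpoly.mpolyX R (mpoly.mnm1 j).
rewrite (_ : _ \o _ = fun t => peval b q (of_coord b t)); first exact: measurable_peval.
apply/funext => t /=; rewrite peval_sum [in LHS](coord_basis bb (memvf (of_coord b t))).
have fD u v : f (u + v) = f u + f v by rewrite -[u]scale1r fP scale1r mul1r.
have f0 : f 0 = 0 by apply: (addrI (f 0)); rewrite -fD !addr0.
rewrite (big_morph f fD f0); apply: eq_bigr => j _.
by rewrite -[_ *: _]addr0 fP f0 addr0 pevalZ pevalX -tnth_nth mulrC.
Qed.

End Evaluation.

(** * Integration by parts for functions cut off near the boundary *)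

Section CutOff.
Context (R : realType) (V : vectType R) (n : nat) (b : n.-tuple V).
Hypothesis bb : basis_of {:V} b.
Local Notation MP := (mpoly.mpoly n R).
Local Notation ev := (peval b).
Local Notation oc := (of_coord b).
Local Notation mu := (lebesgue_tuple R n).
Variables (D : set V) (P Q : MP).
Hypothesis D_open : forall v w, D v -> \forall t \near (0 : R), D (v + t *: w).
Hypothesis P_gt0 : forall v, D v -> 0 < ev P v.
Hypothesis Q_gt0 : forall v, D v -> 0 < ev Q v.
Hypothesis D_boundary : forall v w (eps : R), ~ D v -> 0 < eps ->
  \forall t \near (0 : R), D (v + t *: w) -> ev (P * Q) (v + t *: w) < eps.
Hypothesis D_bounded : exists rho : R, forall v, D v -> forall i, `|coord b i v| <= rho.
Hypothesis mD : measurable (oc @^-1` D).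
Variables (al be : R) (K : nat) (eps : R).
Hypothesis eps0 : 0 < eps.
Local Notation S := (P * Q - mpoly.mpolyC n eps).
Local Notation diff := (class_diff b P Q S al be K).

(** With S = P Q - eps the positive part vanishes near the boundary of [D], so extension by zero
    keeps the function differentiable on the whole space. *)
Definition cut_class j F (v : V) : R :=
  if v \in D then class_at b P Q S al be K j F v else 0.

Lemma cut_class0 j F v : (j < K)%N -> (D v -> ev (P * Q) v <= eps) -> cut_class j F v = 0.
Proof.
move=> jK vD; rewrite /cut_class; case: ifPn => // /set_mem/vD h.
rewrite /class_at /class_fun !pevalE in h *.
rewrite max_r; last by lra.
by rewrite expr0n subn_eq0 leqNgt jK mulr0 mul0r.
Qed.

(** Inside [D] this is the derivative rule of the class. Outside, points of [D] near v on the line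
    satisfy P Q < eps, so the function is identically zero there. *)
Lemma is_derive_cut_class j F v w : (j.+2 <= K)%N ->
  is_derive (0 : R) 1 (fun t => cut_class j F (v + t *: w)) (cut_class j.+1 (diff w F) v).
Proof.
move=> jK; have [vD|vD] := pselect (D v).
  have H := is_derive_class_at S al be P_gt0 Q_gt0 F w jK vD.
  rewrite {2}/cut_class mem_set//; apply: (near_eq_is_derive _ H).
  have := D_open w vD; apply: filterS => t Dt.
  by rewrite /cut_class mem_set.
rewrite {2}/cut_class memNset//; apply: (@near_eq_is_derive _ _ _ (cst 0)).
have := D_boundary w vD eps0; apply: filterS => t Dt.
rewrite cut_class0 ?(ltnW jK)// => Dv; exact/ltW/Dt.
Qed.

Lemma powR_le_bounds (x a l u : R) : 0 < l -> l <= a -> a <= u ->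
  a `^ x <= l `^ x + u `^ x.
Proof.
move=> l0 la au; have a0 := lt_le_trans l0 la; have u0 := lt_le_trans a0 au.
have [x0|x0] := leP 0 x.
  apply: (@le_trans _ _ (u `^ x)); last by rewrite lerDr powR_ge0.
  by apply: ge0_ler_powR; rewrite ?nnegrE ?(ltW a0) ?(ltW u0).
apply: (@le_trans _ _ (l `^ x)); last by rewrite lerDl powR_ge0.
rewrite -[x]opprK !(powRN _ (- x)) lef_pV2 ?posrE ?powR_gt0//.
by apply: ge0_ler_powR; rewrite ?nnegrE ?(ltW a0) ?(ltW l0)// oppr_ge0 ltW.
Qed.

Lemma measurable_class_fun S' x y m p :
  measurable_fun setT (class_fun b P Q S' x y m p \o oc).
Proof.
have mp q : measurable_fun setT (fun t => ev q (oc t)) := measurable_peval bb q.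
rewrite /class_fun; apply: measurable_funM; last exact: mp.
apply: measurable_funM; first apply: measurable_funM.
- exact: (measurableT_comp (measurable_powR x) (mp P)).
- exact: (measurableT_comp (measurable_powR y) (mp Q)).
- apply: measurable_funX; apply: measurable_maxr => //; exact: mp.
Qed.

Lemma bounded_support_cut_class j F : (j < K)%N -> bounded_support b (cut_class j F).
Proof.
move=> jK; have [rho Drho] := D_bounded.
have [CP [CP0 HP]] := peval_bounded b P rho.
have [CQ [CQ0 HQ]] := peval_bounded b Q rho.
have [CS [CS0 HS]] := peval_bounded b S rho.
have [CF [CF0 HF]] := peval_bounded b (F j) rho.
(* Where the cut-off is nonzero P Q > eps; with P and Q bounded above this bounds both from below,
   which controls negative powers. *)
pose lP := eps / (CQ + 1); pose lQ := eps / (CP + 1).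
pose aj := al - j%:R; pose bj := be - j%:R.
pose BP := lP `^ aj + CP `^ aj; pose BQ := lQ `^ bj + CQ `^ bj.
have BP0 : 0 <= BP by rewrite addr_ge0 ?powR_ge0.
have BQ0 : 0 <= BQ by rewrite addr_ge0 ?powR_ge0.
exists rho, (BP * BQ * CS ^+ (K - j) * CF); split.
- rewrite (_ : _ \o _ = (class_at b P Q S al be K j F \o oc) \_ (oc @^-1` D)).
    apply: (measurable_restrictT _ mD).1; apply: (measurable_funS measurableT) => //.
    exact: (measurable_class_fun S (al - j%:R) (be - j%:R) (K - j) (F j)).
  apply/funext => t; rewrite patchE /cut_class /=.
  by have -> : (t \in oc @^-1` D) = (oc t \in D) by apply/idP/idP => /set_mem h; apply/mem_set.
- move=> v; have [[vD vS]|nv] := pselect (D v /\ eps < ev (P * Q) v); last first.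
    rewrite cut_class0 ?normr0 ?mulr_ge0 ?exprn_ge0//.
    by move=> vD; rewrite leNgt; apply/negP => h; apply: nv.
  rewrite /cut_class mem_set// /class_at /class_fun -/aj -/bj.
  have vr := Drho v vD; have P0 := P_gt0 vD; have Q0 := Q_gt0 vD.
  have PC := HP v vr; have QC := HQ v vr.
  rewrite gtr0_norm// in PC; rewrite gtr0_norm// in QC.
  have lP0 : 0 < lP by rewrite divr_gt0//; lra.
  have lQ0 : 0 < lQ by rewrite divr_gt0//; lra.
  rewrite pevalM in vS.
  have lPv : lP <= ev P v by rewrite ler_pdivrMr ?(le_trans (ltW vS)) ?ler_wpM2l//; lra.
  have lQv : lQ <= ev Q v.
    by rewrite ler_pdivrMr ?(le_trans (ltW vS)) 1?mulrC ?ler_wpM2l//; lra.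
  rewrite !normrM ler_pM ?mulr_ge0 ?HF// ler_pM ?mulr_ge0//.
    by rewrite ler_pM// ger0_norm ?powR_ge0// powR_le_bounds.
  rewrite normrX lerXn2r ?nnegrE// (le_trans _ (HS v vr))//.
  by rewrite ger0_norm ?le_max ?lexx ?orbT// ge_max ler_norm normr_ge0.
- move=> v i vi; apply: cut_class0 => // vD.
  by have := Drho v vD i; rewrite leNgt vi.
Qed.

Let int g j F := (\int[mu]_t (cut_class j F (oc t) * ev g (oc t))%:E)%E.

Lemma bounded_support_cut_classM g j F : (j < K)%N ->
  bounded_support b (fun v => cut_class j F v * ev g v).
Proof.
move=> jK; apply: bounded_supportM => //; first exact: bounded_support_cut_class.
- exact: (measurable_peval bb g).
- exact: (peval_bounded b g).
Qed.

Lemma cut_class_parts g j F w : (j.+2 <= K)%N ->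
  int g j.+1 (diff w F) = (- int (pderiv b w g) j F)%E.
Proof.
move=> jK.
have b1 := bounded_support_cut_classM g (diff w F) jK.
have b2 := bounded_support_cut_classM (pderiv b w g) F (ltnW jK).
have i1 := bounded_support_integrable bb b1; have i2 := bounded_support_integrable bb b2.
have H : (int g j.+1 (diff w F) + int (pderiv b w g) j F = 0)%E.
  rewrite /int -integralD//.
  pose f' v := cut_class j.+1 (diff w F) v * ev g v + cut_class j F v * ev (pderiv b w g) v.
  apply: (@integral_deriv_eq0 _ _ _ _ bb _ f' w (bounded_support_cut_classM g F (ltnW jK))) => [v|].
  - have x0 : v + (0 : R) *: w = v by rewrite scale0r addr0.
    have H := is_deriveM (is_derive_cut_class F v w jK) (is_derive_peval b g v w 0).
    apply: (is_derive_eq H); rewrite !x0 /f' /GRing.scale /=; ring.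
  - have [? [C1 [_ H1 _]]] := b1; have [? [C2 [_ H2 _]]] := b2.
    by exists (C1 + C2) => v; rewrite (le_trans (ler_normD _ _))// lerD.
have := integrable_fin_num measurableT i1; have := integrable_fin_num measurableT i2.
move: H; rewrite -!/(int _ _ _); move: (int _ _ _) (int _ _ _) => [x| |] [y| |]//=.
by move=> [h] _ _; congr EFin; apply/eqP; rewrite -addr_eq0 h.
Qed.

(** Each integration by parts moves one derivative onto [g] and lowers its degree; the number of
    derivatives exceeds the degree, so [g] becomes zero. *)
Lemma cut_class_orthogonal g (ws : seq V) F : (mpoly.msize g <= size ws)%N -> (size ws < K)%N ->
  int g (size ws) (foldr (fun w => diff w) F ws) = 0%E.
Proof.
elim: ws g => [|w ws IH] g /= gw wK.
  apply: integral0_eq => t _; move: gw; rewrite leqn0 mpoly.msize_poly_eq0 => /eqP ->.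
  by rewrite peval0 mulr0.
by rewrite cut_class_parts// IH ?oppe0// ?(ltnW wK)// msize_pderiv.
Qed.

Lemma cut_class_act_orthogonal g q F M :
  (forall m, m \in mpoly.msupp q -> mpoly.mdeg m = M) -> (mpoly.msize g <= M)%N -> (M < K)%N ->
  int g M (act (fun i => diff (tnth b i)) q F) = 0%E.
Proof.
move=> qM gM MK; rewrite /act big_seq.
elim/big_rec: _ => [|m G mq IH].
  apply: integral0_eq => t _.
  by rewrite /cut_class /class_at /class_fun (_ : (0 : nat -> MP) M = 0)// peval0 mulr0; case: ifP; rewrite mul0r.
set Fm := act_monomial _ _ _.
have Fm0 : int g M Fm = 0%E.
  pose ws := flatten [seq nseq (mpoly.fun_of_multinom m i) (tnth b i) | i <- enum 'I_n].
  have wsM : size ws = M.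
    rewrite -(qM m mq) mpoly.mdegE size_flatten /shape -map_comp sumnE big_map big_enum /=.
    by apply: eq_bigr => i _; rewrite size_nseq.
  have -> : Fm = foldr (fun w => diff w) F ws.
    rewrite /Fm /act_monomial /ws; elim: (enum _) => //= i s ->; rewrite foldr_cat.
    by elim: (mpoly.fun_of_multinom m i) => //= k ->.
  by rewrite -[X in int g X]wsM cut_class_orthogonal// wsM.
rewrite /int.
have -> : (fun t => (cut_class M (mpoly.mcoeff m q *: Fm + G) (oc t) * ev g (oc t))%:E) =
    (fun t => (mpoly.mcoeff m q)%:E * (cut_class M Fm (oc t) * ev g (oc t))%:E +
      (cut_class M G (oc t) * ev g (oc t))%:E)%E.
  apply/funext => t; rewrite -EFinM -EFinD; congr EFin; rewrite mulrA -mulrDl.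
  congr (_ * _); rewrite /cut_class; case: ifP => _; last by rewrite mulr0 addr0.
  rewrite /class_at /class_fun.
  have -> : ev ((mpoly.mcoeff m q *: Fm + G) M) (oc t) =
      mpoly.mcoeff m q * ev (Fm M) (oc t) + ev (G M) (oc t) by rewrite -pevalZ -pevalD.
  by ring.
have i1 := bounded_support_integrable bb (bounded_support_cut_classM g Fm MK).
have i2 := bounded_support_integrable bb (bounded_support_cut_classM g G MK).
rewrite integralD//; last exact: integrableZl.
by rewrite integralZl// -/(int g M Fm) -/(int g M G) Fm0 IH mule0 adde0.
Qed.

End CutOff.

(** * Uniform estimate for the derivatives of the truncated function *)

Section ChartEstimate.
Context (R : realType) (V : vectType R) (mul : V -> V -> V) (e : V).
Hypothesis EJA : euclidean_jordan_algebra mul e.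
Variables (r : nat) (tr det : V -> R).
Hypothesis hr : jordan_rank mul e r.
Hypothesis htr : jordan_trace mul e r tr.
Hypothesis hdet : jordan_det mul e r det.
Hypothesis r_gt0 : (0 < r)%N.
Variables (n : nat) (b : n.-tuple V).
Hypothesis hb : orthonormal_basis mul tr b.
Let bb : basis_of {:V} b := proj1 hb.
Local Notation ip := (jinner mul tr).
Local Notation D := (cone_interval mul e tr).
Local Notation ev := (peval b).
Local Notation MP := (mpoly.mpoly n R).
Let detP x : ev (mpoly_of b det) x = det x.
Proof. by rewrite -(mpoly_ofP bb (proj1 hdet)). Qed.
Let detZ := det_scale EJA hr hdet.

Definition det_affine (y0 : V) (L : V -> V) : MP :=
  mpoly.comp_mpoly (affine_tuple b b y0 L) (mpoly_of b det).

Lemma det_affineE y0 L x : (forall a u v, L (a *: u + v) = a *: L u + L v) ->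
  ev (det_affine y0 L) x = det (y0 + L x).
Proof. by move=> LP; rewrite /det_affine (peval_affine b bb)// detP. Qed.

(** The factor 1/2 matches the pullback point ((e - v)/2, (e + v)/2) in the definition of C^(k). *)
Definition det_minus := det_affine (2^-1 *: e) (fun v => - (2^-1 *: v)).
Definition det_plus := det_affine (2^-1 *: e) (fun v => 2^-1 *: v).

Lemma det_minusE v : ev det_minus v = 2^-1 ^+ r * det (e - v).
Proof.
rewrite det_affineE => [|a x y]; last by vlra.
by rewrite -scalerBr detZ.
Qed.

Lemma det_plusE v : ev det_plus v = 2^-1 ^+ r * det (e + v).
Proof.
rewrite det_affineE => [|a x y]; last by vlra.
by rewrite -scalerDr detZ.
Qed.

Let half0 : 0 < 2^-1 ^+ r :> R. Proof. by rewrite exprn_gt0// invr_gt0. Qed.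

Lemma det_minus_gt0 v : D v -> 0 < ev det_minus v.
Proof.
by move=> [_ /(cone_gt0 EJA hr htr hdet r_gt0 hb) d]; rewrite det_minusE mulr_gt0.
Qed.

Lemma det_plus_gt0 v : D v -> 0 < ev det_plus v.
Proof.
by move=> [/(cone_gt0 EJA hr htr hdet r_gt0 hb) d _]; rewrite det_plusE mulr_gt0.
Qed.

Lemma interval_near v w : D v -> \forall t \near (0 : R), D (v + t *: w).
Proof.
move=> /(interval_open EJA hr htr r_gt0 hb w)[delta d0 H].
by apply/nbhs_ballP; exists delta => // t /=; rewrite /ball /= sub0r normrN => /H.
Qed.

Lemma polynomial_det_exp k : polynomial_fun (fun x => det x ^+ k).
Proof.
rewrite (_ : (fun _ => _) = ev (mpoly_of b det ^+ k)); first exact: polynomial_peval.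
by apply/funext => x; rewrite pevalXn detP.
Qed.

Lemma det_exp_scale k a x : det (a *: x) ^+ k = a ^+ (r * k) * det x ^+ k.
Proof. by rewrite detZ exprMn -exprM. Qed.

Lemma det_exp_homog k m :
  m \in mpoly.msupp (mpoly_of b (fun x => det x ^+ k)) -> mpoly.mdeg m = (r * k)%N.
Proof.
by apply: (mpoly_of_homog bb (polynomial_det_exp k)) => a x; exact: det_exp_scale.
Qed.

Variables (k K : nat) (lam mu : R).
Local Notation M := (r * k)%N.
Hypothesis MK : (M < K)%N.
Local Notation q := (mpoly_of b (fun x => det x ^+ k)).

Definition jet (P Q : MP) (eps : R) : nat -> MP :=
  act (fun i => class_diff b P Q (P * Q - mpoly.mpolyC n eps)
    (lam + k%:R - K%:R) (mu + k%:R - K%:R) K (tnth b i)) q (class_seq 1).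

(** The function P^(lam+k-K) Q^(mu+k-K) (PQ - eps)_+^K, which for eps = 0 and P, Q positive is
    P^(lam+k) Q^(mu+k). [truncation_diff] is its image under det(d/dv)^k, with polynomial factor
    taken from [jet]. *)
Definition truncation (P Q : MP) (eps : R) (v : V) : R :=
  class_at b P Q (P * Q - mpoly.mpolyC n eps) (lam + k%:R - K%:R) (mu + k%:R - K%:R) K
    0 (class_seq 1) v.

Definition truncation_diff (P Q : MP) (eps : R) (v : V) : R :=
  class_at b P Q (P * Q - mpoly.mpolyC n eps) (lam + k%:R - K%:R) (mu + k%:R - K%:R) K
    M (jet P Q eps) v.

Lemma truncationE P Q (eps : R) v : truncation P Q eps v =
  ev P v `^ (lam + k%:R - K%:R) * ev Q v `^ (mu + k%:R - K%:R) *
  Num.max (ev P v * ev Q v - eps) 0 ^+ K.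
Proof.
by rewrite /truncation /class_at /class_fun subn0 !subr0 !pevalE mulr1.
Qed.

Lemma truncation_diffP P Q eps (U : set V) :
  (forall x w, U x -> \forall t \near (0 : R), U (x + t *: w)) ->
  (forall x, U x -> 0 < ev P x) -> (forall x, U x -> 0 < ev Q x) ->
  forall f, (forall x, U x -> f x = truncation P Q eps x) ->
  forall x, U x -> diff_op b (fun x => det x ^+ k) f x = truncation_diff P Q eps x.
Proof.
move=> Uo UP UQ f fE x Ux.
exact: (diff_op_class Uo UP UQ MK (@det_exp_homog k) fE Ux).
Qed.

Lemma truncation_diff0 P Q eps v : ev P v * ev Q v <= eps -> truncation_diff P Q eps v = 0.
Proof.
move=> h; rewrite /truncation_diff /class_at /class_fun !pevalE max_r; last by lra.
by rewrite expr0n subn_eq0 leqNgt MK mulr0 mul0r.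
Qed.

Lemma truncation_rescale (P Q P0 Q0 : MP) (eps eps' t s : R) x y : 0 < t -> 0 < s ->
  0 < ev P x -> 0 < ev Q x -> t * s * eps' = eps ->
  ev P0 y = t * ev P x -> ev Q0 y = s * ev Q x ->
  truncation P0 Q0 eps y = t `^ (lam + k%:R) * s `^ (mu + k%:R) * truncation P Q eps' x.
Proof.
move=> t0 s0 P_gt0 Q_gt0 e' PE QE.
have powK (u z : R) : 0 < u -> u `^ (z - K%:R) * u ^+ K = u `^ z.
  move=> u0; rewrite -powR_mulrn ?ltW// -powRD; first by rewrite subrK.
  by rewrite (gt_eqF u0) implybT.
rewrite !truncationE PE QE !powRM ?ltW//.
have -> : t * ev P x * (s * ev Q x) - eps = (t * s) * (ev P x * ev Q x - eps').
  by rewrite mulrBr e'; ring.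
set z := ev P x * ev Q x - eps'.
have -> : Num.max (t * s * z) 0 = t * s * Num.max z 0.
  by rewrite maxr_pMr ?mulr0// mulr_ge0 ?ltW.
rewrite !exprMn.
by rewrite -(powK t (lam + k%:R) t0) -(powK s (mu + k%:R) s0); ring.
Qed.

(** Differentiate the identity of [truncation_rescale] for the affine map h -> v + L h. As [L] is
    symmetric and multiplies det by [a], the operator det(d/dh)^k picks up the factor a^k. *)
Lemma truncation_diff_chart (P Q P0 Q0 : MP) (E : set V) (eps eps' t s a : R) v (L : V -> V) :
  (forall x w, E x -> \forall u \near (0 : R), E (x + u *: w)) ->
  (forall x, E x -> 0 < ev P0 x) -> (forall x, E x -> 0 < ev Q0 x) ->
  (forall u x y, L (u *: x + y) = u *: L x + L y) ->
  (forall x y, ip (L x) y = ip x (L y)) -> (forall x, det (L x) = a * det x) ->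
  0 < t -> 0 < s -> t * s * eps' = eps ->
  (forall h, ev P0 (v + L h) = t * ev P h) -> (forall h, ev Q0 (v + L h) = s * ev Q h) ->
  E v -> a ^+ k * truncation_diff P0 Q0 eps v =
    t `^ (lam + k%:R) * s `^ (mu + k%:R) * truncation_diff P Q eps' 0.
Proof.
move=> Eo EP EQ LP Lsym Ldet t0 s0 e' tE sE Ev.
pose T h := v + L h.
have L0 : L 0 = 0 by have := LP (-1) 0 0; rewrite scaler0 addr0 scaleN1r addNr.
have TL x u w : T (x + u *: w) = T x + u *: L w by rewrite /T addrC [x + _]addrC LP; vlra.
have T0 : T 0 = v by rewrite /T L0 addr0.
pose U : set V := [set h | E (T h)].
have U0 : U 0 by rewrite /U /= T0.
have Uo x w : U x -> \forall u \near (0 : R), U (x + u *: w).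
  move=> Ux; have := Eo _ (L w) Ux; apply: filterS => u.
  by rewrite /U /= TL.
have UP x : U x -> 0 < ev P x by move=> /EP; rewrite tE pmulr_rgt0.
have UQ x : U x -> 0 < ev Q x by move=> /EQ; rewrite sE pmulr_rgt0.
pose f := truncation P0 Q0 eps.
set c := t `^ _ * s `^ _.
have fT x : U x -> (f \o T) x = c * truncation P Q eps' x.
  move=> Ux.
  exact: (truncation_rescale t0 s0 (UP x Ux) (UQ x Ux) e' (tE x) (sE x)).
have lhs : diff_op b (fun x => det x ^+ k) (f \o T) 0 = c * truncation_diff P Q eps' 0.
  have fE x : U x -> (f \o T) x = class_at b P Q (P * Q - mpoly.mpolyC n eps')
      (lam + k%:R - K%:R) (mu + k%:R - K%:R) K 0 (c *: class_seq 1) x.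
    move=> /fT ->; rewrite /truncation /class_at /class_fun.
    by rewrite (_ : (c *: class_seq 1) 0%N = c *: (1 : MP))// pevalZ; ring.
  rewrite (diff_op_class Uo UP UQ MK (@det_exp_homog k) fE U0).
  set G := act _ _.
  have Gl u x y : G (u *: x + y) = u *: G x + G y.
    by apply: act_linear => *; exact: class_diffP.
  have G0 : G 0 = 0 by have := Gl (-1) 0 0; rewrite scaler0 addr0 scaleN1r addNr.
  rewrite -[c *: _]addr0 Gl G0 addr0 /truncation_diff /jet -/G /class_at /class_fun.
  by rewrite (_ : (c *: G _) M = c *: G (class_seq 1) M)// pevalZ; ring.
rewrite -lhs.
rewrite -(truncation_diffP Eo EP EQ (f := f)) // -[v in LHS]T0.
have fE x : E x -> f x = truncation P0 Q0 eps x by [].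

symmetry.
apply: (diff_op_comp_class bb bb TL Eo EP EQ MK _ _ _ _ _ fE).
- exact: polynomial_det_exp.
- exact: polynomial_det_exp.
- by move=> *; exact: det_exp_scale.
- by move=> *; exact: det_exp_scale.
- move=> x; rewrite -exprMn -Ldet; congr (det _ ^+ k).
  rewrite [RHS](coord_basis bb (memvf _)); apply: eq_bigr => j _.
  rewrite -tnth_nth; congr (_ *: _).
  rewrite -(ip_coord EJA hr htr r_gt0 hb) Lsym.
  rewrite (ipC EJA) [X in _ = ip X _](coord_basis bb (memvf _)) (ip_suml EJA hr htr r_gt0).
  apply: eq_bigr => i _; rewrite -tnth_nth (ipE EJA hr htr r_gt0); congr (_ * _).
  by rewrite (ipC EJA) (ip_coord EJA hr htr r_gt0 hb).
- by rewrite /= T0.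
Qed.

Section Bounded.
Variable C : R.
Local Notation Theta := ((V -> V) * (V -> V) * R)%type.

Definition chart_bound (th : Theta) :=
  (forall i j, `|coord b i (th.1.1 (tnth b j))| <= C /\ `|coord b i (th.1.2 (tnth b j))| <= C) /\
  0 <= th.2 <= 1.

(** The parameter is a pair of linear maps and a truncation level. These functions form the algebra
    to which the results on families are applied. *)
Definition chart_bounded (a : Theta -> R) := exists B, forall th, chart_bound th -> `|a th| <= B.

Let cbC a : chart_bounded (fun=> a). Proof. by exists `|a|. Qed.
Let cbD f g : chart_bounded f -> chart_bounded g -> chart_bounded (fun t => f t + g t).
Proof.
move=> [B fB] [B' gB]; exists (B + B') => th hth.
by rewrite (le_trans (ler_normD _ _))// lerD ?fB ?gB.
Qed.
Let cbM f g : chart_bounded f -> chart_bounded g -> chart_bounded (fun t => f t * g t).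
Proof.
move=> [B fB] [B' gB]; exists (B * B') => th hth.
by rewrite normrM ler_pM ?fB ?gB.
Qed.

Lemma jet_chart_bounded j : chart_bounded (fun th =>
  ev (jet (det_affine e (fun h => - th.1.2 h)) (det_affine e th.1.1) th.2 j) 0).
Proof.
apply: (mfam_peval cbC cbD cbM).
have fam_det (L : Theta -> V -> V) : (forall i j, chart_bounded (fun th => coord b i (L th (tnth b j)))) ->
    mfam chart_bounded (fun th => det_affine e (L th)).
  move=> Lb; apply: (mfam_comp cbC) => i; apply: mfam_add; first exact: (mfam_cst cbC).
  apply: (mfam_sum cbC) => l.
  exact: (mfam_scale (Lb i l) (mfam_cst cbC _)).
have PF : mfam chart_bounded (fun th => det_affine e (fun h => - th.1.2 h)).
  apply: fam_det => i l; exists C => th [/(_ i l)[_]] + _.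
  by rewrite linearN normrN.
have QF : mfam chart_bounded (fun th => det_affine e th.1.1).
  by apply: fam_det => i l; exists C => th [/(_ i l)[]].
apply: (mfam_act cbC) => //.
- apply: mfam_add; first exact: mfam_mul.
  rewrite (_ : (fun _ => _) = (fun th => - th.2 *: (1 : MP))).
    apply: mfam_base; exists 1 => th [_ /andP[h0 h1]]; rewrite normrN ger0_norm//.
  by apply/funext => th; rewrite scaleNr -mpoly.mul_mpolyC mulr1.
- by move=> i; exact: (mfam_cst cbC).
Qed.

End Bounded.

(** If P Q <= eps at v the left side vanishes. Otherwise the chart at v moves the evaluation to 0,
    where both rescaled determinants equal 1 and the jets are uniformly bounded. The factors
    collected are t^(lam+k) s^(mu+k) / (4^r t s)^k with t = P(v) and s = Q(v), that is 4^(-rk) t^lam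
    s^mu. *)
Lemma truncation_diff_le : exists C, 0 <= C /\ forall eps v, 0 <= eps -> D v ->
  `|truncation_diff det_minus det_plus eps v| <=
    C * (ev det_minus v `^ lam * ev det_plus v `^ mu).
Proof.
have [C HC] := interval_chart EJA hr htr hdet r_gt0 hb.
have [B HB] := jet_chart_bounded C M.
pose c0 : R := 4 ^+ r ^- k.
have c00 : 0 <= c0 by rewrite invr_ge0 exprn_ge0// exprn_ge0.
exists (c0 * `|B|); split; first by rewrite mulr_ge0.
move: det_minus det_plus det_minusE det_plusE det_minus_gt0 det_plus_gt0.
move=> P0 Q0 P0E Q0E P0_gt0 Q0_gt0 eps v eps0 Dv.
have t0 := P0_gt0 v Dv; have s0 := Q0_gt0 v Dv.
have [ge_eps|lt_eps] := leP (ev P0 v * ev Q0 v) eps.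
  by rewrite truncation_diff0// normr0 !mulr_ge0 ?powR_ge0.
have [A [B' [[AP BP] dA dB [symAB detAB] AB]]] := HC v Dv.
have ts0 : 0 < ev P0 v * ev Q0 v by exact: mulr_gt0.
(* The truncation level seen in the chart stays in [0, 1] for every eps below P Q, which is why the
   estimate is uniform in eps. *)
have [eps' e' eps'1] : exists2 eps', ev P0 v * ev Q0 v * eps' = eps & 0 <= eps' <= 1.
  exists (eps / (ev P0 v * ev Q0 v)); first by rewrite mulrC divfK ?gt_eqF.
  by rewrite divr_ge0 ?(ltW ts0)//= ler_pdivrMr// mul1r ltW.
have := HB (A, B', eps') (conj AB eps'1); rewrite /=.
have BNP a x y : - B' (a *: x + y) = a *: - B' x + - B' y by rewrite BP opprD scalerN.
move: (det_affine e (fun h => - B' h)) (fun x => det_affineE e x BNP) => P PE.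
move: (det_affine e A) (fun x => det_affineE e x AP) => Q QE bnd.
have tE h : ev P0 (v + A (B' h)) = ev P0 v * ev P h by rewrite !P0E dA mulrA PE.
have sE h : ev Q0 (v + A (B' h)) = ev Q0 v * ev Q h by rewrite !Q0E dB mulrA QE.
have LP u x y : A (B' (u *: x + y)) = u *: A (B' x) + A (B' y) by rewrite BP AP.
have := truncation_diff_chart interval_near P0_gt0 Q0_gt0 LP symAB detAB t0 s0 e' tE sE Dv.
have dm : det (e - v) * det (e + v) = 4 ^+ r * (ev P0 v * ev Q0 v).
  rewrite P0E Q0E (_ : 4 = 2 * 2 :> R); last by ring.
  have : (2 : R) ^+ r * 2^-1 ^+ r = 1 by rewrite -exprMn mulfV ?expr1n.
  rewrite exprMn; move: (2 ^+ r) (2^-1 ^+ r) (det _) (det _) => x y z w xy.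
  transitivity ((x * y) * (x * y) * (z * w)); first by rewrite xy; ring.
  by ring.
have diff0 : truncation_diff P Q eps' 0 =
    Num.max (1 - eps') 0 ^+ (K - M) * ev (jet P Q eps' M) 0.
  have P1E : ev P 0 = 1.
    have B0 : B' 0 = 0 by have := BP (-1) 0 0; rewrite scaler0 addr0 scaleN1r addNr.
    by rewrite PE B0 oppr0 addr0 (det1 EJA hr hdet).
  have Q1 : ev Q 0 = 1.
    have A0 : A 0 = 0 by have := AP (-1) 0 0; rewrite scaler0 addr0 scaleN1r addNr.
    by rewrite QE A0 addr0 (det1 EJA hr hdet).
  by rewrite /truncation_diff /class_at /class_fun !pevalE P1E Q1 mulr1 !powR1 !mul1r.
rewrite dm diff0; move: (truncation_diff _ _ _ _) bnd (ev P0 v) (ev Q0 v) t0 s0.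
move: (ev (jet P Q eps' M) 0) => p Phi bnd t s t0 s0.
rewrite !powRD ?(gt_eqF t0) ?(gt_eqF s0) ?implybT//.
rewrite !powR_mulrn ?(ltW t0) ?(ltW s0)// !exprMn => H.
have z : (4 ^+ r) ^+ k * (t ^+ k * s ^+ k) != 0.
  by rewrite !mulf_neq0 ?expf_neq0 ?pnatr_eq0 ?(gt_eqF t0) ?(gt_eqF s0).
have -> : Phi = c0 * (t `^ lam * s `^ mu) * (Num.max (1 - eps') 0 ^+ (K - M) * p).
  apply: (mulfI z); rewrite H /c0; field.
  by rewrite !expf_neq0.
rewrite normrM [`|c0 * _|]ger0_norm ?mulr_ge0 ?powR_ge0//.
have : 0 <= t `^ lam * s `^ mu by rewrite mulr_ge0 ?powR_ge0.
move: (t `^ lam * s `^ mu) => w w0.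
rewrite -!mulrA ler_wpM2l// [`|B| * _]mulrC ler_wpM2l//.
rewrite normrM -[leRHS]mul1r ler_pM// ?(le_trans bnd) ?ler_norm//.
have m1 : 0 <= Num.max (1 - eps') 0 by rewrite le_max lexx orbT.
rewrite ger0_norm ?exprn_ge0// exprn_ile1// ge_max ler01 andbT.
by case/andP: eps'1; lra.
Qed.

(** The exponents do not involve eps; the positive part and the jet depend on eps through functions
    continuous at 0. *)
Lemma truncation_diff_cvg P Q v :
  (fun i : nat => truncation_diff P Q i.+1%:R^-1 v) @ \oo --> truncation_diff P Q 0 v.
Proof.
pose A (a : R -> R) := {for 0, continuous a}.
have Ac a : A (fun=> a) by exact: cst_continuous.
have AD f g : A f -> A g -> A (fun t => f t + g t) by move=> *; exact: continuousD.
have AM f g : A f -> A g -> A (fun t => f t * g t) by move=> *; exact: continuousM.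
have c0 : A (truncation_diff P Q ^~ v).
  apply: (AM _ _); last first.
    have Sm : mfam A (fun t => P * Q - mpoly.mpolyC n t).
      apply: mfam_add; first exact: (mfam_cst Ac).
      rewrite (_ : (fun _ => _) = (fun t => - t *: (1 : MP))).
        by apply: mfam_base; exact: opp_continuous.
      by apply/funext => th; rewrite scaleNr -mpoly.mul_mpolyC mulr1.
    apply: (mfam_peval Ac AD AM).
    apply: (mfam_act Ac) => //; try exact: (mfam_cst Ac).
    by move=> j; exact: (mfam_cst Ac).
  apply: (AM _ _); first exact: Ac.
  pose f t := Num.max (ev (P * Q - mpoly.mpolyC n t) v) 0.
  have fA : A f.
    apply: continuous_max; last exact: Ac.
    rewrite (_ : (fun _ => _) = (fun t => ev (P * Q) v + - t)).
      by apply: (AD _ _); [exact: Ac|exact: opp_continuous].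
    by apply/funext => t; rewrite pevalD pevalN pevalC.
  elim: (K - M)%N => [|j IH]; first exact: Ac.
  rewrite (_ : (fun _ => _) = (fun t => f t * f t ^+ j)); first exact: (AM _ _ fA IH).
  by apply/funext => t; rewrite exprS.
have h0 : (fun i : nat => i.+1%:R^-1 : R) @ \oo --> (0 : R) by exact: cvg_harmonic.
exact: (continuous_cvg _ c0 h0).
Qed.

End ChartEstimate.

(** * Growth of degrees under differentiation *)

Section ClassDegree.
Context (R : realType) (V : vectType R) (n : nat) (b : n.-tuple V).
Local Notation MP := (mpoly.mpoly n R).
Implicit Types p q : MP.

Lemma msizeM_leq p q a d :
  (mpoly.msize p <= a.+1)%N -> (mpoly.msize q <= d)%N -> (mpoly.msize (p * q) <= a + d)%N.
Proof.
have [->|p0] := eqVneq p 0; first by rewrite mul0r mpoly.msize0.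
have [->|q0] := eqVneq q 0; first by rewrite mulr0 mpoly.msize0.
move=> pa qd; rewrite mpoly.msizeM//.
by move: (mpoly.msize p) (mpoly.msize q) pa qd => x y; lia.
Qed.

Lemma msize_exp p k : p != 0 -> mpoly.msize (p ^+ k) = (k * (mpoly.msize p).-1).+1.
Proof.
move=> p0; have p1 : (0 < mpoly.msize p)%N by rewrite lt0n mpoly.msize_poly_eq0.
elim: k => [|k IH]; first by rewrite expr0 mpoly.msize1.
by rewrite exprS mpoly.msizeM ?expf_neq0// IH mulSn; move: (mpoly.msize p) p1 => [|x] //=; lia.
Qed.

Lemma peval_eq_near p q : basis_of {:V} b ->
  (forall w, \forall t \near (0 : R), peval b p (t *: w) = peval b q (t *: w)) -> p = q.
Proof.
move=> bb H; apply/eqP; rewrite -subr_eq0; apply/eqP/(peval_eq0 bb) => w.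
rewrite -[w]add0r -[w in 0 + w]scale1r -horner_pline.
set h := pline _ _ _ _; suff -> : h = 0 by rewrite horner0.
apply/eqP; apply: contraT => h0.
have /nbhs_ballP[delta /= d0 Hd] := H w.
pose s := [seq delta / (i.+2%:R : R) | i <- iota 0 (size h)].
suff : (size s < size h)%N by rewrite size_map size_iota ltnn.
apply: max_poly_roots => //.
  apply/allP => x /mapP[i _ ->]; apply/rootP; rewrite horner_pline add0r pevalD pevalN.
  apply/eqP; rewrite subr_eq0; apply/eqP; apply: Hd.
  rewrite /ball /= sub0r normrN gtr0_norm ?divr_gt0// ltr_pdivrMr//.
  by rewrite ltr_pMr// ltr1n.
have d1 : delta != 0 by rewrite gt_eqF.
by rewrite map_inj_uniq ?iota_uniq// => i j /(mulfI d1)/invr_inj/eqP; rewrite eqr_nat => /eqP[].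
Qed.

Variables (P Q S : MP) (r : nat).
Hypotheses (P_deg : deg_le P r) (Q_deg : deg_le Q r) (S_deg : deg_le S (2 * r)).

(** Every term is a product of P, Q, S and p, of total degree at most 4r + d, with one factor
    differentiated; each step thus raises the degree by at most 4r - 1. *)
Lemma deg_le_class_step al be nu w p d : deg_le p d ->
  (mpoly.msize (class_step b P Q S al be nu w p) <= 4 * r + d)%N.
Proof.
move=> pd; have dP := msize_pderiv b w P_deg; have dQ := msize_pderiv b w Q_deg.
have dS := msize_pderiv b w S_deg.
have dp := msize_pderiv b w pd.
have PQ : deg_le (P * Q) (r + r) by exact: deg_leM.
have H1 : (mpoly.msize (mpoly.mpolyC n al * pderiv b w P * Q * S) <= 2 * r + (r + (0 + r)))%N.
  rewrite mulrC msizeM_leq// mulrC msizeM_leq// msizeM_leq//.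
  exact: deg_leC.
have H2 : (mpoly.msize (mpoly.mpolyC n be * P * pderiv b w Q * S) <= 2 * r + ((0 + r) + r))%N.
  rewrite mulrC msizeM_leq// msizeM_leq//.
  by apply: deg_leM => //; exact: deg_leC.
have H3 : (mpoly.msize (mpoly.mpolyC n nu * P * Q * pderiv b w S) <= (0 + r + r) + 2 * r)%N.
  rewrite msizeM_leq//; apply: deg_leM => //.
  by apply: deg_leM => //; exact: deg_leC.
have H4 : (mpoly.msize (P * Q * S * pderiv b w p) <= (r + r + 2 * r) + d)%N.
  by rewrite msizeM_leq//; exact: deg_leM.
rewrite /class_step (leq_trans (mpoly.msizeD_le _ _))// geq_max; apply/andP; split; last first.
  by apply: leq_trans H4 _; lia.
rewrite mulrC [(4 * r + d)%N]addnC msizeM_leq//.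
rewrite (leq_trans (mpoly.msizeD_le _ _))// geq_max (leq_trans (mpoly.msizeD_le _ _)) ?geq_max /=.
- by apply: leq_trans H3 _; lia.
- by rewrite (leq_trans H1) ?(leq_trans H2)//; lia.
Qed.

Lemma deg_le_act_class (r_gt0 : (0 < r)%N) al be K (ws : 'I_n -> V) q j :
  deg_le (act (fun i => class_diff b P Q S al be K (ws i)) q (class_seq 1) j)
    (j * (4 * r - 1)).
Proof.
pose H (F : nat -> MP) := forall j, deg_le (F j) (j * (4 * r - 1)).
have H0 : H 0 by move=> i; rewrite /deg_le mpoly.msize0.
have H1 : H (class_seq 1).
  by case=> [|i] /=; [rewrite -mpoly.mpolyC1; exact: deg_leC | rewrite /deg_le mpoly.msize0].
have HD w F : H F -> H (class_diff b P Q S al be K w F).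
  move=> HF [|i] /=; first by rewrite /deg_le mpoly.msize0.
  rewrite /deg_le (leq_trans (deg_le_class_step _ _ _ _ (HF i)))//; lia.
suff : H (act (fun i => class_diff b P Q S al be K (ws i)) q (class_seq 1)) by exact.
rewrite /act; elim/big_ind: _ => // [F G HF HG i|m _ i]; first exact: deg_leD.
apply: deg_leZ; move: i; rewrite -/(H _) /act_monomial.
elim: (enum _) => //= i s IH; elim: (mpoly.fun_of_multinom m i) => //= k; exact: HD.
Qed.

End ClassDegree.

(** * The Rodrigues formula and the degree of C^(k) *)

Section Rodrigues.
Context (R : realType) (V : vectType R) (mul : V -> V -> V) (e : V).
Hypothesis EJA : euclidean_jordan_algebra mul e.
Variables (r : nat) (tr det : V -> R).
Hypothesis hr : jordan_rank mul e r.
Hypothesis htr : jordan_trace mul e r tr.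
Hypothesis hdet : jordan_det mul e r det.
Hypothesis r_gt0 : (0 < r)%N.
Variables (n : nat) (b : n.-tuple V).
Hypothesis hb : orthonormal_basis mul tr b.
Let bb : basis_of {:V} b := proj1 hb.
Local Notation ip := (jinner mul tr).
Local Notation D := (cone_interval mul e tr).
Local Notation Om := (symmetric_cone mul tr).
Local Notation ev := (peval b).
Local Notation MP := (mpoly.mpoly n R).
Local Notation B := (prod_basis b).
Let Bb := prod_basisP bb.
Let detZ := det_scale EJA hr hdet.
Variables (k K : nat) (lam mu : R).
Local Notation M := (r * k)%N.
Hypothesis MK : (M < K)%N.
Variable c : V * V -> R.
Hypothesis cP : polynomial_extension mul b det tr lam mu k c.
Local Notation C := (C_pullback e c).
Local Notation P0 := (det_minus e det b).
Local Notation Q0 := (det_plus e det b).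
Local Notation q := (mpoly_of b (fun x => det x ^+ k)).
Local Notation Phi := (truncation_diff r det b k K lam mu P0 Q0).

Let T (v : V) : V * V := (2^-1 *: (e - v), 2^-1 *: (e + v)).
Let L (v : V) : V * V := (- (2^-1 *: v), 2^-1 *: v).

Let LP a x y : L (a *: x + y) = a *: L x + L y.
Proof. by congr pair; vlra. Qed.

Let TE v : T v = (2^-1 *: e, 2^-1 *: e) + L v.
Proof. by congr pair; vlra. Qed.

Lemma polynomial_pullback : polynomial_fun C.
Proof.
rewrite (_ : C = fun v => c ((2^-1 *: e, 2^-1 *: e) + L v)).
  exact: (polynomial_fun_affine bb Bb _ LP (proj1 cP)).
by apply/funext => v; rewrite -TE.
Qed.

Lemma coord_prod_basis (i : 'I_(n + n)) (z : V * V) : coord B i z =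
  match fintype.split i with inl j => coord b j z.1 | inr j => coord b j z.2 end.
Proof.
set a := fun i => match fintype.split i with inl j => coord b j z.1 | inr j => coord b j z.2 end.
suff zE : z = \sum_i a i *: B`_i by rewrite [in LHS]zE coord_sum_free ?(basis_free Bb).
have l (f g : 'I_n -> V) (u : 'I_n -> R) :
    \sum_i u i *: (f i, g i) = (\sum_i u i *: f i, \sum_i u i *: g i).
  by elim/big_ind3: _ => // ? ? ? ? ? ? -> ->.
have sl j : fintype.split (lshift n j) = inl j by exact: (unsplitK (inl j)).
have sr j : fintype.split (rshift n j) = inr j by exact: (unsplitK (inr j)).
have Bl j : a (lshift n j) *: B`_(lshift n j) = coord b j z.1 *: (tnth b j, 0).
  by rewrite -(tnth_nth 0 B) tnth_prod_basis /a sl.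
have Br j : a (rshift n j) *: B`_(rshift n j) = coord b j z.2 *: (0, tnth b j).
  by rewrite -(tnth_nth 0 B) tnth_prod_basis /a sr.
rewrite big_split_ord (eq_bigr _ (fun j _ => Bl j)) (eq_bigr _ (fun j _ => Br j)).
have cb (x : V) : \sum_j coord b j x *: tnth b j = x.
  by rewrite [RHS](coord_basis bb (memvf x)); apply: eq_bigr => j _; rewrite -tnth_nth.
have z0 (x : V) : \sum_j coord b j x *: (0 : V) = 0 by rewrite big1 // => j _; rewrite scaler0.
rewrite (l (tnth b) (fun=> 0)) (l (fun=> 0) (tnth b)) !cb !z0 {Bl Br}.
by case: z @a => x y a /=; congr pair; rewrite /= ?addr0 ?add0r.
Qed.

Let PP : mpoly.mpoly (n + n) R := mpoly_of B (fun z => det z.1).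
Let QQ : mpoly.mpoly (n + n) R := mpoly_of B (fun z => det z.2).

Lemma polynomial_comp_linear (f : V -> R) (F : V * V -> V) :
  (forall a x y, F (a *: x + y) = a *: F x + F y) ->
  polynomial_fun f -> polynomial_fun (fun z => f (F z)).
Proof.
move=> FP fp; rewrite (_ : (fun _ => _) = fun z => f (0 + F z)).
  exact: (polynomial_fun_affine Bb bb 0 FP fp).
by apply/funext => z; rewrite add0r.
Qed.

Let PE z : peval B PP z = det z.1.
Proof.
by rewrite -mpoly_ofP//; apply: (@polynomial_comp_linear _ fst) => //; exact: (proj1 hdet).
Qed.

Let QE z : peval B QQ z = det z.2.
Proof.
by rewrite -mpoly_ofP//; apply: (@polynomial_comp_linear _ snd) => //; exact: (proj1 hdet).
Qed.

Let cone_near x w : Om x -> \forall t \near (0 : R), Om (x + t *: w).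
Proof.
move=> /(cone_open EJA hr htr r_gt0 hb)[d d0 Hd].
have := @continuous_horner _ ((ip w w)%:P * 'X * 'X) 0.
rewrite /continuous_at [X in _ --> X]hornerM hornerX mulr0 => /cvgr_lt/(_ d d0).
apply: filterS => t wt; apply: Hd.
rewrite addrC addKr !(ipE EJA hr htr r_gt0).
move: wt; rewrite !hornerE /=; congr (_ < d); ring.
Qed.

Let U : set (V * V) := [set z | Om z.1 /\ Om z.2].

Lemma powR_cancel (x y s t w : R) : 0 < x -> 0 < y ->
  x `^ s * y `^ t * (x `^ (- s) * y `^ (- t) * w) = w.
Proof.
move=> x0 y0; have xs := powR_gt0 s x0; have yt := powR_gt0 t y0.
by rewrite !powRN; field; rewrite !gt_eqF.
Qed.

(** Untruncated, the function is the pullback under T of det(x)^(lam+k) det(y)^(mu+k). The linear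
    part of T sends w to (-w/2, w/2), so d/dv acts as -1/2 times d/dx - d/dy, and det^k is
    homogeneous of degree rk. *)
Lemma rodrigues v : D v -> Phi 0 v = (- 2^-1) ^+ M * (ev P0 v `^ lam * ev Q0 v `^ mu * C v).
Proof.
move=> Dv.
have T1 : det (T v).1 = ev P0 v by rewrite (det_minusE EJA hr hdet hb) detZ.
have T2 : det (T v).2 = ev Q0 v by rewrite (det_plusE EJA hr hdet hb) detZ.
have P0_gt0 := det_minus_gt0 EJA hr htr hdet r_gt0 hb.
have Q0_gt0 := det_plus_gt0 EJA hr htr hdet r_gt0 hb.
have DU x : D x -> U (T x).
  by case=> H1 H2; split; apply: (cone_scale EJA hr htr hdet r_gt0 hb); rewrite ?invr_gt0.
have [c1 c2] := DU v Dv.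
rewrite /C_pullback -[c _]/(c ((T v).1, (T v).2)) (proj2 cP)// /c_fun T1 T2.
pose f (z : V * V) := det z.1 `^ (lam + k%:R) * det z.2 `^ (mu + k%:R).
rewrite -/f.
transitivity ((- 2^-1) ^+ M * diff_op B (fun z => det (z.1 - z.2) ^+ k) f (T v)); last first.
  by rewrite (powR_cancel _ _ _ (P0_gt0 _ Dv) (Q0_gt0 _ Dv)).
have Do := interval_near EJA hr htr r_gt0 hb.
have Phi_diff : Phi 0 v = diff_op b (fun x => det x ^+ k) (f \o T) v.
  symmetry; apply: (truncation_diffP EJA hr hdet hb MK Do P0_gt0 Q0_gt0) => // x Dx.
  rewrite truncationE /= /f -/(T x).
  have -> : det (T x).1 = ev P0 x by rewrite (det_minusE EJA hr hdet hb) detZ.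
  have -> : det (T x).2 = ev Q0 x by rewrite (det_plusE EJA hr hdet hb) detZ.
  have := P0_gt0 x Dx; have := Q0_gt0 x Dx; move: (ev P0 x) (ev Q0 x) => t s s0 t0.
  rewrite subr0 max_l ?mulr_ge0 ?ltW// exprMn.
  have powK (u z : R) : 0 < u -> u `^ (z - K%:R) * u ^+ K = u `^ z.
    move=> u0; rewrite -powR_mulrn ?(ltW u0)// -powRD; first by rewrite subrK.
    by rewrite (gt_eqF u0) implybT.
  by rewrite -(powK t (lam + k%:R) t0) -(powK s (mu + k%:R) s0); ring.
rewrite Phi_diff.
have TL x t w : T (x + t *: w) = T x + t *: L w.
  by rewrite !TE [x + _]addrC LP [t *: L w + _]addrC addrA.
have Uo x w : U x -> \forall t \near (0 : R), U (x + t *: w).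
  by move=> [/(cone_near w.1) u1 /(cone_near w.2) u2]; near do split.
have UP x : U x -> 0 < peval B PP x.
  by move=> [/(cone_gt0 EJA hr htr hdet r_gt0 hb)]; rewrite PE.
have UQ x : U x -> 0 < peval B QQ x.
  by move=> [_ /(cone_gt0 EJA hr htr hdet r_gt0 hb)]; rewrite QE.
have fE x : U x -> f x = class_at B PP QQ 1 (lam + k%:R) (mu + k%:R) K 0 (class_seq 1) x.
  move=> _; rewrite /class_at /class_fun !subr0 !peval1 PE QE max_l ?ler01// expr1n !mulr1.
  by [].
have pk := polynomial_det_exp hdet hb k.
apply: (diff_op_comp_class bb Bb TL Uo UP UQ MK _ _ _ _ _ fE) => //.
- apply: (@polynomial_comp_linear (fun x => det x ^+ k) (fun z => z.1 - z.2)) => //.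
  by move=> a x y /=; rewrite opprD addrACA scalerBr.
- by move=> *; exact: (det_exp_scale EJA hr hdet).
- move=> a x; rewrite -(det_exp_scale EJA hr hdet); congr (det _ ^+ k).
  by rewrite scalerBr.
(* In coordinates the transpose of L is (x, y) -> -(x - y)/2. *)
- move=> x; rewrite -(det_exp_scale EJA hr hdet); congr (det _ ^+ k).
  have sl j : fintype.split (lshift n j) = inl j by exact: (unsplitK (inl j)).
  have sr j : fintype.split (rshift n j) = inr j by exact: (unsplitK (inr j)).
  rewrite [RHS](coord_basis bb (memvf _)); apply: eq_bigr => j _.
  rewrite -tnth_nth; congr (_ *: _); rewrite big_split_ord /=.
  under eq_bigr => i _ do rewrite !coord_prod_basis sl /=.
  under [in X in _ + X]eq_bigr => i _ do rewrite !coord_prod_basis sr /=.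
  have bj i : coord b i (tnth b j) = (i == j)%:R.
    by rewrite (tnth_nth 0) coord_free ?(basis_free bb) 1?eq_sym.
  rewrite (bigD1 j)//= [X in _ + X + _]big1 => [|i ij]; last first.
    by rewrite linearN linearZ /= bj (negbTE ij) mulr0 oppr0 mul0r.
  rewrite (bigD1 j)//= [X in _ + (_ + X)]big1 => [|i ij]; last first.
    by rewrite linearZ /= bj (negbTE ij) mulr0 mul0r.
  rewrite !(linearN, linearZ, linearB) /= bj eqxx /GRing.scale /= mulr1n mulrN1 !addr0.
  by rewrite mulr1; ring.
Unshelve. all: by end_near. Qed.

(** At eps = 0 the Rodrigues formula clears all real powers and becomes a polynomial identity C^(k)
    (P Q)^N = const J, with J of degree at most M (4r - 1). Since P Q has degree exactly 2r, the
    degree of C^(k) is at most M (4r - 1) - 2r (2M - k) = M. *)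
Lemma pullback_degree : deg_le (mpoly_of b C) M.
Proof.
set g := mpoly_of b C.
have gE v : C v = ev g v by rewrite /g -(mpoly_ofP bb polynomial_pullback).
(* The power left over in P^lam = P^(lam + k - K - M) P^(K - M) P^N; the subtraction is genuine
   because k <= M. *)
pose N := (2 * M - k)%N.
pose J := jet det b k K lam mu P0 Q0 0 M.
have Do := interval_near EJA hr htr r_gt0 hb.
have D0 := interval0 EJA hr htr hdet r_gt0 hb.
have P0_gt0 := det_minus_gt0 EJA hr htr hdet r_gt0 hb.
have Q0_gt0 := det_plus_gt0 EJA hr htr hdet r_gt0 hb.
have det_deg : deg_le (mpoly_of b det) r.
  apply: deg_le_homog => m; apply: (mpoly_of_homog bb (proj1 hdet)); exact: detZ.
have P_deg : deg_le P0 r by exact: deg_le_affine.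
have Q_deg : deg_le Q0 r by exact: deg_le_affine.
(* The exact degree of P and Q is visible on the line through [e]. *)
have lead p s : deg_le p r -> (forall t, ev p (t *: e) = (2^-1 * (1 + s * t)) ^+ r) -> s != 0 ->
    mpoly.msize p = r.+1.
  move=> pr pE s0; apply/eqP; rewrite eqn_leq; apply/andP; split; first exact: pr.
  pose h : {poly R} := 2^-1 *: (1 + s *: 'X).
  have h1 : size h = 2.
    rewrite size_scale ?invr_eq0// addrC size_addl ?size_scale// ?size_polyX ?size_poly1//.
  have E : pline b p 0 e = h ^+ r.
    apply/eqP; rewrite -subr_eq0; apply/eqP/poly_eq0_horner => t.
    rewrite hornerD hornerN horner_pline add0r pE horner_exp.
    by rewrite /h !hornerE /= subrr.
  have h0 : h != 0 by rewrite -size_poly_eq0 h1.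
  rewrite ltnNge; apply/negP => pr'.
  have pr1 : deg_le p r.-1 by rewrite /deg_le prednK.
  have := size_pline bb 0 e pr1; have := size_exp h r.
  rewrite h1 -E prednK// mul1n; move: (size (pline b p 0 e)) r_gt0 => z z0 zr.
  by rewrite -zr in z0 *; case: z z0 {zr} => //= z _; rewrite ltnn.
have P_size : mpoly.msize P0 = r.+1.
  apply: (lead _ (-1)) P_deg _ _ => [t|]; last by rewrite oppr_eq0 oner_eq0.
  rewrite (det_minusE EJA hr hdet hb) -{1}[e]scale1r -scalerBl detZ (det1 EJA hr hdet) mulr1.
  by rewrite -exprMn mulN1r.
have Q_size : mpoly.msize Q0 = r.+1.
  apply: (lead _ 1) Q_deg _ _ => [t|]; last by rewrite oner_eq0.
  rewrite (det_plusE EJA hr hdet hb) -{1}[e]scale1r -scalerDl detZ (det1 EJA hr hdet) mulr1.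
  by rewrite -exprMn mul1r.
have s0 : (- 2^-1 : R) ^+ M != 0 by rewrite expf_neq0// oppr_eq0 invr_eq0.
have rod v : D v -> ((- 2^-1) ^+ M)^-1 * ev J v = (ev P0 v * ev Q0 v) ^+ N * C v.
  move=> Dv; have := rodrigues Dv; rewrite /truncation_diff /class_at /class_fun -/J !pevalE.
  have := P0_gt0 v Dv; have := Q0_gt0 v Dv; move: (ev P0 v) (ev Q0 v) (ev J v) (C v).
  move=> t s j Cv s_gt0 t_gt0; rewrite subr0 max_l ?mulr_ge0 ?ltW//.
  have pow (x y : R) : 0 < x -> x `^ (y + k%:R - K%:R - M%:R) * x ^+ (K - M) * x ^+ N = x `^ y /\
      0 < x `^ (y + k%:R - K%:R - M%:R) * x ^+ (K - M).
    move=> x0; split; last by rewrite mulr_gt0 ?powR_gt0 ?exprn_gt0.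
    rewrite -mulrA -exprD -powR_mulrn ?ltW// -powRD ?(gt_eqF x0) ?implybT//.
    congr (_ `^ _).
    have -> : (K - M + N)%N%:R = K%:R + M%:R - k%:R :> R.
      rewrite -natrD -natrB; last by rewrite /N; nia.
      by congr (_%:R); rewrite /N; nia.
    by ring.
  have [tE t1] := pow t lam t_gt0; have [sE s1] := pow s mu s_gt0.
  rewrite -tE -sE exprMn => H.
  have z : t `^ (lam + k%:R - K%:R - M%:R) * t ^+ (K - M) *
    (s `^ (mu + k%:R - K%:R - M%:R) * s ^+ (K - M)) != 0 by rewrite gt_eqF// mulr_gt0.
  apply: (mulfI z); rewrite exprMn.
  move: H s0; move: ((- 2^-1) ^+ M) => sg.
  move: (_ `^ _) (_ `^ _) (t ^+ _) (s ^+ _) (t ^+ _) (s ^+ _) z => y x u w u' w' z H s0.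
  transitivity (sg^-1 * (x * y * (u' * w') * j)); first by ring.
  rewrite H; field; exact: s0.
(* The identity holds on the interval, which contains a segment around 0 in every direction; this
   suffices for polynomials. *)
have gJ : g * (P0 * Q0) ^+ N = ((- 2^-1) ^+ M)^-1 *: J.
  apply: (peval_eq_near bb) => w.
  have := Do _ w D0; apply: filterS => t; rewrite add0r => /rod H.
  by rewrite !pevalE H -gE mulrC.
have [g0|g0] := eqVneq g 0; first by rewrite g0 /deg_le mpoly.msize0.
have J_deg : deg_le J (M * (4 * r - 1)).
  apply: (deg_le_act_class _ P_deg Q_deg) => //.
  by rewrite mpoly.mpolyC0 subr0 mul2n -addnn; exact: deg_leM.
have P0n0 : P0 != 0 by rewrite -mpoly.msize_poly_eq0 P_size.
have Q0n0 : Q0 != 0 by rewrite -mpoly.msize_poly_eq0 Q_size.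
have := deg_leZ ((- 2^-1) ^+ M)^-1 J_deg; rewrite -gJ /deg_le.
rewrite mpoly.msizeM ?expf_neq0 ?mulf_neq0// msize_exp ?mulf_neq0// mpoly.msizeM// P_size Q_size.
have g1 : (0 < mpoly.msize g)%N by rewrite lt0n mpoly.msize_poly_eq0.
move: (mpoly.msize g) g1 => m g1; rewrite /N; nia.
Qed.

End Rodrigues.

(** * Measurability, integrability and the limit eps -> 0 *)

Section Orthogonality.
Context (R : realType) (V : vectType R) (mul : V -> V -> V) (e : V).
Hypothesis EJA : euclidean_jordan_algebra mul e.
Local Notation "x ** y" := (mul x y) (at level 40, left associativity).
Variables (r : nat) (tr det : V -> R).
Hypothesis hr : jordan_rank mul e r.
Hypothesis htr : jordan_trace mul e r tr.
Hypothesis hdet : jordan_det mul e r det.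
Hypothesis r_gt0 : (0 < r)%N.
Variables (n : nat) (b : n.-tuple V).
Hypothesis hb : orthonormal_basis mul tr b.
Let bb : basis_of {:V} b := proj1 hb.
Local Notation ip := (jinner mul tr).
Local Notation D := (cone_interval mul e tr).
Local Notation ev := (peval b).
Local Notation oc := (of_coord b).
Local Notation nu := (lebesgue_tuple R n).
Local Notation P0 := (det_minus e det b).
Local Notation Q0 := (det_plus e det b).

Lemma interval_coord_bounded : exists rho : R, forall v, D v -> forall i, `|coord b i v| <= rho.
Proof.
exists (ip e e + 1) => v /(interval_bounded EJA hr htr hdet r_gt0 hb) ve i.
have := coord_sqr_le EJA hr htr r_gt0 hb v i; have := ip_ge0 EJA hr htr r_gt0 hb v.
rewrite ler_norml; move: ve; move: (coord b i v) (ip v v) (ip e e) => x y z *.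
by apply/andP; split; nra.
Qed.

Lemma interval_det_near v w (eps : R) : ~ D v -> 0 < eps ->
  \forall t \near (0 : R), D (v + t *: w) -> ev (P0 * Q0) (v + t *: w) < eps.
Proof.
move=> nD eps0.
have [] := interval_boundary EJA hr htr hdet r_gt0 hb (f := ev (P0 * Q0)) w _ _ nD eps0.
- by move=> x y; exists (pline b (P0 * Q0) x y) => t; rewrite horner_pline.
- move=> u; rewrite pevalM (det_minusE EJA hr hdet hb) (det_plusE EJA hr hdet hb).
  by case=> ->; rewrite mulr0 ?mul0r ?mulr0.
- move=> delta d0 H; apply/nbhs_ballP; exists delta => // t.
  by rewrite /ball /= sub0r normrN; exact: H.
Qed.

(** By [coneP] and [psd_rat] the interval is cut out by countably many linear inequalities and two
    nonvanishing determinants. *)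
Lemma measurable_interval : measurable (oc @^-1` D).
Proof.
pose y (q : n.-tuple rat) := \sum_i ratr (tnth q i) *: tnth b i.
pose F (s : R) (q : n.-tuple rat) := [set t | 0 <= ip (e + s *: oc t) (y q ** y q)].
(* Enumerates the rational test vectors by natural numbers; indices that code no tuple impose no
   condition. *)
pose G (k : nat) := if unpickle k is Some q then F 1 q `&` F (-1) q else setT.
pose H (s : R) := [set t | det (e + s *: oc t) != 0].
have DE : oc @^-1` D = (\bigcap_k G k) `&` (H 1 `&` H (-1)).
  have cone_eq (s : R) t : symmetric_cone mul tr (e + s *: oc t) <->
      (forall q, F s q t) /\ H s t.
    rewrite (coneP EJA hr htr hdet r_gt0 hb); split=> -[p d]; split=> //.
      by move=> q; apply: p.
    by apply/(psd_rat EJA hr htr r_gt0 hb).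
  have one t : e + oc t = e + 1 *: oc t by rewrite scale1r.
  have mone t : e - oc t = e + -1 *: oc t by rewrite scaleN1r.
  apply/seteqP; split=> t /=.
    rewrite /cone_interval /= one mone => -[/cone_eq[F1 H1] /cone_eq[F2 H2]].
    split=> // k _; rewrite /G; by case: (unpickle k).
  move=> [Gt [H1 H2]]; rewrite /cone_interval /= one mone.
  have Ft q : F 1 q t /\ F (-1) q t by have := Gt (pickle q) I; rewrite /G pickleK.
  by split; apply/cone_eq; split=> // q; have [] := Ft q.
have mlin (z : V) (s : R) : measurable_fun setT (fun t => ip (e + s *: oc t) z).
  rewrite (_ : (fun t => _) = (fun t => ip e z + s * ip (oc t) z)); last first.
    by apply/funext => t; rewrite !(ipE EJA hr htr r_gt0).
  apply: measurable_funD => //; apply: measurable_funM => //.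
  apply: (measurable_linear bb (f := fun x => ip x z)) => a u v.
  by rewrite !(ipE EJA hr htr r_gt0).
have mF s q : measurable (F s q).
  rewrite (_ : F s q = (fun t => ip (e + s *: oc t) (y q ** y q)) @^-1` `[0, +oo[).
    rewrite -[_ @^-1` _]setTI; apply: (mlin (y q ** y q) s) => //; exact: measurable_itv.
  by apply/seteqP; split=> t /=; rewrite in_itv /= andbT.
have mH (s : R) : measurable (H s).
  have LP a u v : s *: (a *: u + v) = a *: (s *: u) + s *: v.
    by rewrite scalerDr !scalerA mulrC.
  rewrite (_ : H s = ~` ((fun t => ev (det_affine det b e (fun v => s *: v)) (oc t)) @^-1` [set 0])).
    apply: measurableC; rewrite -[_ @^-1` _]setTI; exact: (measurable_peval bb _ measurableT (measurable_set1 0)).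
  apply/seteqP; split=> t /=; rewrite (det_affineE hdet hb)//.
    by move=> /eqP.
  by move=> /eqP.
rewrite DE; apply: measurableI; last exact: measurableI.
apply: bigcapT_measurable => k; rewrite /G.
by case: (unpickle k) => [q|]; [exact: measurableI | exact: measurableT].
Qed.

Variables (lam mu : R).
Hypotheses (lam0 : 0 <= lam) (mu0 : 0 <= mu).
Local Notation w := (jacobi_weight e det lam mu).

Lemma jacobi_weightE v : D v ->
  w v = (2 ^+ r) `^ lam * (2 ^+ r) `^ mu * (ev P0 v `^ lam * ev Q0 v `^ mu).
Proof.
move=> Dv; have P_gt0 := det_minus_gt0 EJA hr htr hdet r_gt0 hb Dv.
have Q_gt0 := det_plus_gt0 EJA hr htr hdet r_gt0 hb Dv.
have dm : det (e - v) = 2 ^+ r * ev P0 v.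
  by rewrite (det_minusE EJA hr hdet hb) mulrA -exprMn mulfV ?expr1n ?mul1r.
have dp : det (e + v) = 2 ^+ r * ev Q0 v.
  by rewrite (det_plusE EJA hr hdet hb) mulrA -exprMn mulfV ?expr1n ?mul1r.
rewrite /jacobi_weight dm dp.
move: (ev P0 v) (ev Q0 v) P_gt0 Q_gt0 => p q p0 q0.
by rewrite !powRM ?exprn_ge0 ?(ltW p0) ?(ltW q0)// mulrACA.
Qed.

(** P and Q are bounded on the bounded set I, and with nonnegative exponents so are their powers. *)
Lemma weight_bounded : exists C, 0 <= C /\ forall v, D v ->
  ev P0 v `^ lam * ev Q0 v `^ mu <= C.
Proof.
have [rho Hrho] := interval_coord_bounded.
have P_gt0 := det_minus_gt0 EJA hr htr hdet r_gt0 hb.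
have Q_gt0 := det_plus_gt0 EJA hr htr hdet r_gt0 hb.
move: P0 Q0 P_gt0 Q_gt0 => P Q P_gt0 Q_gt0.
have [CP [CP0 HP]] := peval_bounded b P rho; have [CQ [CQ0 HQ]] := peval_bounded b Q rho.
exists (CP `^ lam * CQ `^ mu); split=> [|v Dv]; first by rewrite mulr_ge0 ?powR_ge0.
have Pv := P_gt0 v Dv; have Qv := Q_gt0 v Dv.
have PC := le_trans (ler_norm _) (HP v (Hrho v Dv)).
have QC := le_trans (ler_norm _) (HQ v (Hrho v Dv)).
by rewrite ler_pM ?powR_ge0//; apply: ge0_ler_powR; rewrite ?nnegrE// ltW.
Qed.

Lemma measurable_weight : measurable_fun setT (w \o oc).
Proof.
have md (s : R) : measurable_fun setT (fun t => det (e + s *: oc t)).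
  have LP a u v : s *: (a *: u + v) = a *: (s *: u) + s *: v.
    by rewrite scalerDr !scalerA mulrC.
  rewrite (_ : (fun t => _) = (fun t => ev (det_affine det b e (fun v => s *: v)) (oc t))).
    exact: measurable_peval.
  by apply/funext => t; rewrite (det_affineE hdet hb).
rewrite (_ : _ \o _ = fun t => det (e + -1 *: oc t) `^ lam * det (e + 1 *: oc t) `^ mu).
  by apply: measurable_funM; apply: (measurableT_comp (measurable_powR _)).
by apply/funext => t; rewrite /= /jacobi_weight scaleN1r scale1r.
Qed.

Lemma integrable_weight_sqr g :
  nu.-integrable (oc @^-1` D) (fun t => (ev g (oc t) ^+ 2 * w (oc t))%:E).
Proof.
have [rho Hrho] := interval_coord_bounded.
have [C [C0 HC]] := weight_bounded; have [G [G0 HG]] := peval_bounded b g rho.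
pose c : R := (2 ^+ r) `^ lam * (2 ^+ r) `^ mu.
have c0 : 0 <= c by rewrite mulr_ge0 ?powR_ge0.
have mI := measurable_interval.
have ib := integrableS measurableT mI (@subsetT _ _) (integrable_bound n rho (G ^+ 2 * (c * C))).
apply: (le_integrable mI _ _ ib).
  apply/measurable_EFinP; apply: (measurable_funS measurableT) => //.
  apply: measurable_funM; last exact: measurable_weight.
  by apply: measurable_funX; exact: measurable_peval.
move=> t Dt; rewrite !abse_EFin lee_fin (le_trans _ (ler_norm _))//.
have ct : cube rho t by move=> i; rewrite -(coord_of_coord bb); exact: Hrho.
rewrite indicE mem_set// mulr1 jacobi_weightE// -/c normrM normrX.
rewrite ler_pM ?exprn_ge0 ?lerXn2r ?nnegrE ?HG//; last first.
  by rewrite ger0_norm ?ler_wpM2l ?HC// !mulr_ge0 ?powR_ge0.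
by move=> i; exact: Hrho.
Qed.

(** The truncated integrals vanish for every eps > 0 because C^(l) has degree at most rl < rk. By
    [truncation_diff_le] and the bounded weight a constant on a cube dominates them, and the
    Rodrigues formula identifies the limit as the integral of C^(k) C^(l) against the weight. *)
Lemma pullback_orthogonal (c : nat -> V * V -> R) (k l : nat) :
  (forall k, polynomial_extension mul b det tr lam mu k (c k)) -> (l < k)%N ->
  integral_over b D (fun v => C_pullback e (c k) v * C_pullback e (c l) v * w v) = 0%E.
Proof.
move=> cP lk; pose M := (r * k)%N; pose K := M.+2.
have MK : (M < K)%N by rewrite /K ltnS leqnSn.
have MKl : (r * l < (r * l).+1)%N by [].
have [rho Hrho] := interval_coord_bounded.
have [C [C0 HC]] := truncation_diff_le EJA hr htr hdet r_gt0 hb lam mu MK.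
have [C1 [C10 HC1]] := weight_bounded.
have rod v := rodrigues EJA hr htr hdet r_gt0 hb MK (cP k) (v := v).
have mI := measurable_interval.
(* The constant between Phi 0 and C^(k) times the weight: it undoes the sign and scale of the
   Rodrigues formula and the halves inside P and Q. *)
pose kap := (2 ^+ r) `^ lam * (2 ^+ r) `^ mu * ((- 2^-1) ^+ M)^-1 : R.
have s0 : (- 2^-1 : R) ^+ M != 0 by rewrite expf_neq0// oppr_eq0 invr_eq0.
pose g0 := mpoly_of b (C_pullback e (c l)).
have g0E v : C_pullback e (c l) v = ev g0 v.
  by rewrite /g0 -(mpoly_ofP bb)//; exact: (polynomial_pullback e hb (cP l)).
pose g := kap *: g0.
have g_deg : (mpoly.msize g <= M)%N.
  have := deg_leZ kap (pullback_degree EJA hr htr hdet r_gt0 hb MKl (cP l)).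
  move=> /leq_trans; apply; rewrite /M.
  by rewrite -(prednK r_gt0); nia.
pose al := lam + k%:R - K%:R; pose be := mu + k%:R - K%:R.
pose Phi eps := truncation_diff r det b k K lam mu P0 Q0 eps.
have Phi_cvg v : (fun i : nat => Phi i.+1%:R^-1 v) @ \oo --> Phi 0 v.
  exact: (@truncation_diff_cvg R V r det n b k K lam mu P0 Q0 v).
(* Extended by zero to all of space, so that the whole argument takes place over the full domain of
   the coordinate measure. *)
pose ff (eps : R) t := ((if oc t \in D then Phi eps (oc t) else 0) * ev g (oc t))%:E.
have cutE (eps : R) : ff eps = fun t => (cut_class b D P0 Q0 al be K eps M
    (jet det b k K lam mu P0 Q0 eps) (oc t) * ev g (oc t))%:E by [].
have ff0 (eps : R) : 0 < eps -> (\int[nu]_t ff eps t = 0)%E.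
  move=> eps0; rewrite cutE.
  apply: (cut_class_act_orthogonal bb (interval_near EJA hr htr r_gt0 hb)
    (det_minus_gt0 EJA hr htr hdet r_gt0 hb) (det_plus_gt0 EJA hr htr hdet r_gt0 hb)
    interval_det_near interval_coord_bounded mI al be eps0) => //.
  by move=> m; exact: (det_exp_homog EJA hr hdet hb).
have [G [G0 HG]] := peval_bounded b g rho.
pose bnd := C * C1 * G.
have bnd0 : 0 <= bnd by rewrite !mulr_ge0.
have ff_le (eps : R) t : 0 <= eps -> (`|ff eps t| <= (bnd * \1_(cube rho) t)%:E)%E.
  move=> eps0; rewrite abse_EFin lee_fin; case: ifPn => [/set_mem Dt|_]; last first.
    by rewrite mul0r normr0 mulr_ge0.
  have ct : cube rho t by move=> i; rewrite -(coord_of_coord bb); exact: Hrho.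
  rewrite indicE mem_set// mulr1 normrM ler_pM// ?HG//; last exact: Hrho.
  by rewrite (le_trans (HC _ _ eps0 Dt))// ler_wpM2l// HC1.
have ff_lim : (\int[nu]_t ff 0%R t = 0)%E.
  have H := @dominated_cvg _ _ _ nu setT measurableT (fun i => ff i.+1%:R^-1) (ff 0)
    (fun t => (bnd * \1_(cube rho) t)%:E).
  have mff i : measurable_fun setT (ff i.+1%:R^-1).
    rewrite cutE; apply/measurable_EFinP.
    have i0 : 0 < i.+1%:R^-1 :> R by rewrite invr_gt0.
    have [? [? [m _ _]]] := bounded_support_cut_classM bb (det_minus_gt0 EJA hr htr hdet r_gt0 hb)
      (det_plus_gt0 EJA hr htr hdet r_gt0 hb) interval_coord_bounded mI al be i0 g
      (jet det b k K lam mu P0 Q0 i.+1%:R^-1) MK.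
    exact: m.
  have cff t : ff i.+1%:R^-1 t @[i --> \oo] --> ff (0 : R) t.
    apply: cvg_EFin; first exact: nearW.
    have lim : (fun i : nat => if oc t \in D then Phi i.+1%:R^-1 (oc t) else 0) @ \oo -->
        (if oc t \in D then Phi 0 (oc t) else 0).
      have := Phi_cvg (oc t); move: (Phi) => Ph.
      by case: (oc t \in D) => // _; exact: cvg_cst.
    exact: (cvgM lim (cvg_cst _)).
  have i0 i : 0 <= i.+1%:R^-1 :> R by rewrite invr_ge0 ler0n.
  have {H} := H mff (fun t _ => cff t) (fun _ _ => isT) (integrable_bound n rho bnd)
    (fun i t _ => ff_le _ t (i0 i)).
  rewrite (_ : (fun i => _) = fun=> 0%E); last first.
    by apply/funext => i; rewrite ff0// invr_gt0.
  by move=> /cvg_lim <- //; rewrite lim_cst.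
rewrite /integral_over integral_mkcond -[RHS]ff_lim; apply: eq_integral => t _.
rewrite patchE /ff /=.
have -> : (t \in oc @^-1` D) = (oc t \in D) by apply/idP/idP => /set_mem h; apply/mem_set.
case: ifPn => [/set_mem Dt|_]; last by rewrite mul0r.
congr EFin; rewrite /Phi rod// g0E jacobi_weightE// /g pevalZ /kap.
move: (C_pullback e (c k) (oc t)) (ev g0 (oc t)) ((2 ^+ r) `^ lam * (2 ^+ r) `^ mu) (ev P0 _ `^ lam * _) => x y u z.
move: ((- 2^-1) ^+ M) s0 => s s0; by field.
Qed.

End Orthogonality.

(** In rank 0 the minimal polynomial would be the constant 1, whose value is [e]. *)
Lemma rank_gt0 (R : realType) (V : vectType R) (mul : V -> V -> V) (e : V) r :
  e != 0 -> jordan_rank mul e r -> (0 < r)%N.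
Proof.
move=> e0 [_ [x [p [[pm px _] pr]]]]; rewrite lt0n; apply: contra_neqN e0 => /eqP r0.
have p1 : size p = 1%N.
  have : (0 < size p)%N by rewrite size_poly_gt0 monic_neq0.
  by move: pr; rewrite r0; case: (size p) => [|[|]].
move: px; rewrite /jhorner p1 big_ord1 /jpow /=.
by move: pm; rewrite monicE lead_coefE p1 => /eqP ->; rewrite scale1r.
Qed.

Theorem proposition4p1 (R : realType) (V : vectType R) (mul : V -> V -> V)
    (e : V) (n r d : nat) (tr det : V -> R) (b : n.-tuple V) (lam mu : R)
    (c : nat -> V * V -> R) :
  euclidean_jordan_algebra mul e -> simple_jordan mul e ->
  jordan_rank mul e r -> characteristic_number mul e d ->
  jordan_trace mul e r tr -> jordan_det mul e r det ->
  orthonormal_basis mul tr b ->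
  (r%:R - 1) * (d%:R / 2) < lam -> (r%:R - 1) * (d%:R / 2) < mu ->
  (forall k, polynomial_extension mul b det tr lam mu k (c k)) ->
  let C k := C_pullback e (c k) in
  let w := jacobi_weight e det lam mu in
  let I := cone_interval mul e tr in
  (forall k, in_weighted_L2 b I w (C k)) /\
  (forall k l, k <> l ->
    integral_over b I (fun v => C k v * C l v * w v) = 0%E).
Proof.
move=> EJA [e0 _] hr _ htr hdet hb hlam hmu cP C w D.
have r_gt0 := rank_gt0 e0 hr.
(* The lower bound on the exponents is nonnegative because r >= 1; this yields the sign of [lam] and
   [mu] that bounds the weight. *)
have rd0 : 0 <= (r%:R - 1) * (d%:R / 2) :> R.
  by rewrite mulr_ge0 ?divr_ge0// subr_ge0 ler1n.
have lam0 := ltW (le_lt_trans rd0 hlam); have mu0 := ltW (le_lt_trans rd0 hmu).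
have [bb _] := hb.
split=> [k|k l /eqP kl].
  have CE v : C k v = peval b (mpoly_of b (C k)) v.
    by rewrite -(mpoly_ofP bb)//; exact: (polynomial_pullback e hb (cP k)).
  split.
    apply: (measurable_funS measurableT) => //.
    rewrite (_ : (fun t => _) = fun t => peval b (mpoly_of b (C k)) (of_coord b t)).
      exact: measurable_peval.
    by apply/funext => t; rewrite -CE.
  rewrite (_ : (fun t => _) = fun t =>
    (peval b (mpoly_of b (C k)) (of_coord b t) ^+ 2 * w (of_coord b t))%:E).
    exact: (integrable_weight_sqr EJA hr htr hdet r_gt0 hb).
  by apply/funext => t; rewrite -CE.
(* The integrand is symmetric in k and l, so the polynomial of larger index may be the one that is
   integrated by parts. *)
move: kl; rewrite neq_ltn => /orP[kl|lk]; last first.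
  exact: (pullback_orthogonal EJA hr htr hdet r_gt0 hb lam0 mu0 cP lk).
have := pullback_orthogonal EJA hr htr hdet r_gt0 hb lam0 mu0 cP kl.
rewrite /integral_over => <-; apply: eq_integral => t _; congr (_ * _)%:E.
exact: mulrC.
Qed.
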